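(* The following are provable in $\mathrm{PZFC}$ (in BS4). Below, each right-hand side ''$\Sigma\models\varphi\leftrightarrow\Sigma\vdash_L\varphi$'' is asserted for all sets of formulas $\Sigma$ and all formulas $\varphi$ not containing $\to$ or $\bot$, and $\models$ is Tarski semantic consequence. (1) $\mathrm{ACLA}\ \leftrightarrow\ (\Sigma\models\varphi\leftrightarrow\Sigma\vdash_{FDE}\varphi)$. (2) $\mathrm{ACLA}_{\mathrm{cons}}\ \leftrightarrow\ (\Sigma\models\varphi\leftrightarrow\Sigma\vdash_{K3}\varphi)$. (3) $\mathrm{ACLA}_{\mathrm{comp}}\ \leftrightarrow\ (\Sigma\models\varphi\leftrightarrow\Sigma\vdash_{LP}\varphi)$. (4) $\forall x(x^!=x^?)\ \leftrightarrow\ (\Sigma\models\varphi\leftrightarrow\Sigma\vdash_{FOL}\varphi)$. (5) Exactly one of the four situations in (1)–(4) holds, i.e. exactly one of $\mathrm{ACLA}$, $\mathrm{ACLA}_{\mathrm{cons}}$, $\mathrm{ACLA}_{\mathrm{comp}}$, $\forall x(x^!=x^?)$ holds.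
   Context: LOGIC BS4. BS4 is a four-valued first-order logic with primitive symbols $\sim$ (native negation), $\wedge,\vee,\to,\bot,\forall,\exists,=$; $\varphi\leftrightarrow\psi$ is $(\varphi\to\psi)\wedge(\psi\to\varphi)$. Vocabularies contain only constant and relation symbols. A T/F-model $\mathcal M$ has a (nonempty) domain $M$, an element $c^{\mathcal M}\in M$ for each constant, for each $n$-ary relation symbol $R$ two sets $(R^{\mathcal M})^+,(R^{\mathcal M})^-\subseteq M^n$ (with no relation assumed between them), the relation $=^+$ which is true identity on $M$, and a symmetric binary relation $=^-$ on $M$. Truth $\models^T$ and falsity $\models^F$ are defined recursively: an atomic formula is true iff its $+$ interpretation holds and false iff its $-$ interpretation holds; $\sim\varphi$ is true iff $\varphi$ is false, and false iff $\varphi$ is true; $\varphi\wedge\psi$ is true iff both are true, false iff at least one is false; $\varphi\vee\psi$ is true iff at least one is true, false iff both are false; $\varphi\to\psi$ is true iff ($\varphi$ true implies $\psi$ true), false iff $\varphi$ is true and $\psi$ is false; $\exists x\varphi$ is true iff some instance is true, false iff all instances are false; $\forall x\varphi$ is true iff all instances are true, false iff some instance is false; $\bot$ is never true and always false. $\Sigma\vdash_{BS4}\varphi$ means: for every T/F-model $\mathcal M$, if $\mathcal M\models^T\Sigma$ then $\mathcal M\models^T\varphi$ (there is a sound and complete Hilbert calculus for this relation). ABBREVIATIONS. $\varphi\Rightarrow\psi$ is $(\varphi\to\psi)\wedge(\sim\psi\to\sim\varphi)$; $\varphi\Leftrightarrow\psi$ is $(\varphi\leftrightarrow\psi)\wedge(\sim\varphi\leftrightarrow\sim\psi)$;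 $\neg\varphi$ is $\varphi\to\bot$; $!\varphi$ is $\sim\neg\varphi$; $?\varphi$ is $\neg\sim\varphi$; $\circ\varphi$ is $!\varphi\leftrightarrow{?}\varphi$ (''$\varphi$ is classical''). $x\neq y$, $x\notin y$, $x\not\subseteq y$ are $\sim(x=y)$, $\sim(x\in y)$, $\sim(x\subseteq y)$. SETS. The language of set theory is $\{\in\}$. $x=\{y:\varphi(y)\}$ abbreviates $\forall y(y\in x\Leftrightarrow\varphi(y))$. $x\subseteq y$ is $\forall z(z\in x\Rightarrow z\in y)$. $x^!=\{y:{!}(y\in x)\}$, $x^?=\{y:{?}(y\in x)\}$. A set $x$ is classical if $\forall y(y\in x^!\leftrightarrow y\in x^?)$. $\{u_0,\dots,u_n\}=\{y:{!}(y=u_0)\vee\dots\vee{!}(y=u_n)\}$. $\langle u,v\rangle=\{\{u\},\{u,v\}\}$; the ordered pair $(a,b)$ is the set with $(a,b)^!=\{\langle x,\varnothing\rangle:x\in a^!\}\cup\{\langle y,\{\varnothing\}\rangle:y\in b^!\}$ and $(a,b)^?$ given likewise from $a^?,b^?$. $A\times B=\{(a,b):a\in A\wedge b\in B\}$; $\mathrm{dom}(R)=\{x:\exists y\,(x,y)\in R\}$. For a classical set $A$, a classical function from $A$ to $B$ is a classical set $f\subseteq A\times B$ with $\mathrm{dom}(f)=A$ and $\forall x\forall y\forall z(((x,y)\in f\wedge(x,z)\in f)\to{!}(y=z))$. AXIOMS OF PZFC (in BS4; schemas for all formulas $\varphi$, with parameters). Extensionality: $\forall x\forall y(x=y\Leftrightarrow\forall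 z(z\in x\Leftrightarrow z\in y))$. Comprehension: $\forall u\exists x\forall y(y\in x\Leftrightarrow(y\in u\wedge\varphi(y)))$. Classical Superset: $\forall x\exists C(x\subseteq C\wedge\forall y\,{\circ}(y\in C))$. Replacement: $[\forall x\forall y\,{\circ}\varphi(x,y)\wedge\forall x\exists y(\varphi(x,y)\wedge\forall z(\varphi(x,z)\to{!}(y=z)))]\to\forall x\exists y\forall z(z\in y\Leftrightarrow\exists w(w\in x\wedge\varphi(w,z)))$. Pairing: $\forall u\forall v\exists x\forall y(y\in x\Leftrightarrow({!}(y=u)\vee{!}(y=v)))$. Power Set: $\forall u\exists v\forall x(x\in v\Leftrightarrow{!}(x\subseteq u))$. Union: $\forall u\exists x\forall y(y\in x\Leftrightarrow\exists z(y\in z\wedge z\in u))$. Infinity: $\exists x(\varnothing\in x\wedge\forall y(y\in x\to y\cup\{y\}\in x))$. Foundation: $\forall x(\forall y(y\in x^!\cup x^?\to\varphi(y))\to\varphi(x))\to\forall u\,\varphi(u)$. Choice: for every classical $u$, if $\forall x(x\in u\to\exists y(y\in x))$ then there is a classical function $f$ with $\mathrm{dom}(f)=u$ and $f(x)\in x$ for all $x\in u$. ANTI-CLASSICALITY AXIOMS. ACLA: $\exists x(x^!\not\subseteq x^?)\wedge\exists x(x^?\not\subseteq x^!)$. $\mathrm{ACLA}_{\mathrm{cons}}$: $\forall x(x^!\subseteq x^?)\wedge\exists x(x^?\not\subseteq x^!)$. $\mathrm{ACLA}_{\mathrm{comp}}$: $\forall x(x^?\subseteq x^!)\wedge\exists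 x(x^!\not\subseteq x^?)$. SEMANTICS INSIDE PZFC. First-order syntax (with $\sim,\wedge,\vee,\to,\bot,\forall,\exists,=$; no function symbols) is coded by classical sets. A Tarski model $\mathcal M$ consists of a classical set $M$ as domain and (not necessarily classical) interpretations for all constant and relation symbols ($R^{\mathcal M}\subseteq M^n$). Satisfaction is defined recursively, all equivalences being strong ($\Leftrightarrow$), with the logical words on the right being those of the BS4 meta-theory: $\mathcal M\models(t=s)[a,b]\Leftrightarrow a=b$; $\mathcal M\models R(t_1,\dots,t_n)[a_1,\dots,a_n]\Leftrightarrow R^{\mathcal M}(a_1,\dots,a_n)$; $\mathcal M\models{\sim}\varphi\Leftrightarrow{\sim}(\mathcal M\models\varphi)$; $\mathcal M\models\varphi\wedge\psi\Leftrightarrow(\mathcal M\models\varphi\wedge\mathcal M\models\psi)$, and similarly for $\vee,\to,\leftrightarrow$; $\mathcal M\models\exists x\varphi(x)\Leftrightarrow\mathcal M\models\varphi[a]$ for some $a\in M$; $\mathcal M\models\forall x\varphi(x)\Leftrightarrow\mathcal M\models\varphi[a]$ for all $a\in M$; $\mathcal M\models\bot\Leftrightarrow\bot$. Tarski consequence: $\Sigma\models\varphi$ iff for every Tarski model $\mathcal M$, $\mathcal M\models\Sigma\to\mathcal M\models\varphi$. Inside PZFC, a T/F-model $\mathcal M$ has a (nonempty) classical set $M$ as domain, an element $c^{\mathcal M}\in M$ for each constant, for each $n$-ary relation symbol $R$ two classical subsets $(R^{\mathcal M})^+,(R^{\mathcal M})^-$ of $M^n$ (with no relation assumed between them), and classical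 subsets $=^+$ and $=^-$ of $M\times M$, where $=^-$ is symmetric and $a=^+b\leftrightarrow{!}(a=b)$ for $a,b\in M$. The classical relations $\mathcal M\models^T\varphi$ and $\mathcal M\models^F\varphi$ are defined recursively: for atomic $\varphi$, $\mathcal M\models^T\varphi$ iff its $+$ interpretation holds, and $\mathcal M\models^F\varphi$ iff its $-$ interpretation holds; $\mathcal M\models^T{\sim}\varphi$ iff $\mathcal M\models^F\varphi$, and $\mathcal M\models^F{\sim}\varphi$ iff $\mathcal M\models^T\varphi$; $\mathcal M\models^T\varphi\wedge\psi$ iff $\mathcal M\models^T\varphi$ and $\mathcal M\models^T\psi$, and $\mathcal M\models^F\varphi\wedge\psi$ iff $\mathcal M\models^F\varphi$ or $\mathcal M\models^F\psi$; $\mathcal M\models^T\varphi\vee\psi$ iff $\mathcal M\models^T\varphi$ or $\mathcal M\models^T\psi$, and $\mathcal M\models^F\varphi\vee\psi$ iff $\mathcal M\models^F\varphi$ and $\mathcal M\models^F\psi$; $\mathcal M\models^T\varphi\to\psi$ iff ($\mathcal M\models^T\varphi$ implies $\mathcal M\models^T\psi$), and $\mathcal M\models^F\varphi\to\psi$ iff $\mathcal M\models^T\varphi$ and $\mathcal M\models^F\psi$; $\mathcal M\models^T\exists x\varphi(x)$ iff $\mathcal M\models^T\varphi[a]$ for some $a\in M$, and $\mathcal M\models^F\exists x\varphi(x)$ iff $\mathcal M\models^F\varphi[a]$ for all $a\in M$; $\mathcal M\models^T\forall x\varphi(x)$ iff $\mathcal M\models^T\varphi[a]$ for all $a\in M$,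 and $\mathcal M\models^F\forall x\varphi(x)$ iff $\mathcal M\models^F\varphi[a]$ for some $a\in M$; $\mathcal M\models^T\bot$ never holds and $\mathcal M\models^F\bot$ always holds. The relation $\Sigma\vdash_{BS4}\varphi$ inside PZFC is the T/F-semantic consequence relation: for every such T/F-model $\mathcal M$, if $\mathcal M\models^T\Sigma$ then $\mathcal M\models^T\varphi$. FRAGMENTS. $K3^\to$ is the logic obtained from BS4 by restricting to T/F-models with $(R^{\mathcal M})^+\cap(R^{\mathcal M})^-=\varnothing$ for all relation symbols $R$, including equality. $LFI1$ is obtained by restricting to T/F-models with $(R^{\mathcal M})^+\cup(R^{\mathcal M})^-=M^n$ for all $n$-ary relation symbols $R$, including equality. $FDE$, $K3$, $LP$ are the $\to$- and $\bot$-free fragments of BS4, $K3^\to$, $LFI1$, respectively. $FOL$ is classical first-order logic with equality ($\sim$ being classical negation). $\vdash_L$ is the corresponding consequence relation. *)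

(* Defs.v *)
(* Formulas of the language {∈}, with de Bruijn indices. *)

Inductive form : Type :=
| FBot
| FIn (i j : nat)
| FEq (i j : nat)
| FNot (p : form)
| FAnd (p q : form)
| FOr (p q : form)
| FImp (p q : form)
| FAll (p : form)
| FEx (p : form).

Record TFmodel : Type := {
  dom :> Type;
  dom_inhabited : inhabited dom;
  in_pos : dom -> dom -> Prop;
  in_neg : dom -> dom -> Prop;
  eq_neg : dom -> dom -> Prop;         (* =^+ is Leibniz equality *)
  eq_neg_sym : forall a b, eq_neg a b -> eq_neg b a }.

Definition scons {T : Type} (a : T) (e : nat -> T) (i : nat) : T :=
  match i with O => a | S j => e j end.

Fixpoint truth (M : TFmodel) (e : nat -> M) (p : form) {struct p} : Prop :=
  match p with
  | FBot => False
  | FIn i j => in_pos M (e i) (e j)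
  | FEq i j => e i = e j
  | FNot p => falsity M e p
  | FAnd p q => truth M e p /\ truth M e q
  | FOr p q => truth M e p \/ truth M e q
  | FImp p q => truth M e p -> truth M e q
  | FAll p => forall a : M, truth M (scons a e) p
  | FEx p => exists a : M, truth M (scons a e) p
  end
with falsity (M : TFmodel) (e : nat -> M) (p : form) {struct p} : Prop :=
  match p with
  | FBot => True
  | FIn i j => in_neg M (e i) (e j)
  | FEq i j => eq_neg M (e i) (e j)
  | FNot p => truth M e p
  | FAnd p q => falsity M e p \/ falsity M e q
  | FOr p q => falsity M e p /\ falsity M e q
  | FImp p q => truth M e p /\ falsity M e q
  | FAll p => exists a : M, falsity M (scons a e) p
  | FEx p => forall a : M, falsity M (scons a e) p
  end.

(* A formula with free variables stands for its universal closure. *)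
Definition models (M : TFmodel) (p : form) : Prop :=
  forall e : nat -> M, truth M e p.

Definition BS4_proves (Sigma : form -> Prop) (p : form) : Prop :=
  forall M : TFmodel, (forall q, Sigma q -> models M q) -> models M p.

Fixpoint rename (r : nat -> nat) (p : form) {struct p} : form :=
  let up := fun i => match i with O => O | S j => S (r j) end in
  match p with
  | FBot => FBot
  | FIn i j => FIn (r i) (r j)
  | FEq i j => FEq (r i) (r j)
  | FNot p => FNot (rename r p)
  | FAnd p q => FAnd (rename r p) (rename r q)
  | FOr p q => FOr (rename r p) (rename r q)
  | FImp p q => FImp (rename r p) (rename r q)
  | FAll p => FAll (rename up p)
  | FEx p => FEx (rename up p)
  end.

(* An element of [fm] is a formula waiting for the number [n] of binders above
   it.  A bound variable is represented by its level [k], the number of binders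
   above its own binder; under [n] binders its de Bruijn index is
   [n - S k].  A term is a variable or a class term {y : φ(y)}. *)

Definition fm : Type := nat -> form.

Inductive trm : Type :=
| Var (k : nat)
| Cls (f : nat -> fm).

Definition sentence (A : fm) : form := A 0.

Definition fbot : fm := fun _ => FBot.
Definition fnot (A : fm) : fm := fun n => FNot (A n).
Definition fconj (A B : fm) : fm := fun n => FAnd (A n) (B n).
Definition fdisj (A B : fm) : fm := fun n => FOr (A n) (B n).
Definition fimp (A B : fm) : fm := fun n => FImp (A n) (B n).
Definition fall (A : trm -> fm) : fm := fun n => FAll (A (Var n) (S n)).
Definition fex (A : trm -> fm) : fm := fun n => FEx (A (Var n) (S n)).
Definition cls (A : trm -> fm) : trm := Cls (fun k => A (Var k)).

Definition fiff (A B : fm) : fm := fconj (fimp A B) (fimp B A).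
Definition fsimp (A B : fm) : fm := fconj (fimp A B) (fimp (fnot B) (fnot A)).
Definition fsiff (A B : fm) : fm := fconj (fiff A B) (fiff (fnot A) (fnot B)).
Definition fneg (A : fm) : fm := fimp A fbot.
Definition bang (A : fm) : fm := fnot (fneg A).
Definition quest (A : fm) : fm := fneg (fnot A).
Definition circ (A : fm) : fm := fiff (bang A) (quest A).
Definition ftop : fm := fneg fbot.

Declare Scope bs4_scope.
Delimit Scope bs4_scope with bs4.
Bind Scope bs4_scope with trm fm.

Notation "⊥" := fbot : bs4_scope.
Notation "∼ A" := (fnot A) (at level 75, right associativity) : bs4_scope.
Notation "¬ A" := (fneg A) (at level 75, right associativity) : bs4_scope.
Notation "A ∧ B" := (fconj A B) (at level 80, right associativity) : bs4_scope.
Notation "A ∨ B" := (fdisj A B) (at level 85, right associativity) : bs4_scope.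
Notation "A → B" := (fimp A B)
  (at level 99, B at level 200, right associativity) : bs4_scope.
Notation "A ↔ B" := (fiff A B) (at level 95, no associativity) : bs4_scope.
Notation "A ⇒ B" := (fsimp A B) (at level 95, no associativity) : bs4_scope.
Notation "A ⇔ B" := (fsiff A B) (at level 95, no associativity) : bs4_scope.
Notation "∀ x .. y , A" := (fall (fun x => .. (fall (fun y => A)) ..))
  (at level 200, x binder, y binder, right associativity) : bs4_scope.
Notation "∃ x .. y , A" := (fex (fun x => .. (fex (fun y => A)) ..))
  (at level 200, x binder, y binder, right associativity) : bs4_scope.
Notation "⦃ x | A ⦄" := (cls (fun x => A))
  (at level 0, x name, A at level 200) : bs4_scope.

Local Open Scope bs4_scope.

(* Elimination of a term from ψ(t): for t = {y : φ(y)} this is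
   ∃x (!(x = {y : φ(y)}) ∧ ψ(x)).  Because of the [!], it has exactly the truth
   value of ψ at the set in question whenever that set exists. *)
Definition described (t : trm) (psi : nat -> fm) : fm :=
  match t with
  | Var k => psi k
  | Cls f => fun n =>
      FEx ((bang (fall (fun y => match y with
                                 | Var j => fsiff (fun m => FIn (m - S j) (m - S n)) (f j)
                                 | Cls _ => fbot
                                 end))
            ∧ psi n) (S n))
  end.

Definition mem (t u : trm) : fm :=
  described t (fun k => match u with
                        | Var l => fun n => FIn (n - S k) (n - S l)
                        | Cls f => f k
                        end).
Notation "t ∈ u" := (mem t u) (at level 70, no associativity) : bs4_scope.

(* Equality with a class term abbreviates coextensionality, as in
   x = {y : φ(y)} := ∀y (y ∈ x ⇔ φ(y)). *)
Definition eqt (t u : trm) : fm :=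
  match t, u with
  | Var k, Var l => fun n => FEq (n - S k) (n - S l)
  | _, _ => ∀ y, y ∈ t ⇔ y ∈ u
  end.
Notation "t = u" := (eqt t u) : bs4_scope.
Notation "t ≡ u" := (bang (eqt t u)) (at level 70, no associativity) : bs4_scope.

Definition subset (t u : trm) : fm := ∀ z, z ∈ t ⇒ z ∈ u.
Notation "t ⊆ u" := (subset t u) (at level 70, no associativity) : bs4_scope.

(* φ(t) and φ(t,u): index 0 (resp. indices 0, 1) of φ are the displayed
   arguments; the remaining free variables of φ are parameters. *)
Definition inst1 (p : form) (t : trm) : fm :=
  described t (fun k n => rename (scons (n - S k) (fun j => n + j)) p).
Definition inst2 (p : form) (t u : trm) : fm :=
  described t (fun k => described u (fun l n =>
    rename (scons (n - S k) (scons (n - S l) (fun j => n + j))) p)).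

Definition bang_set (x : trm) : trm := ⦃ y | bang (y ∈ x) ⦄.
Definition quest_set (x : trm) : trm := ⦃ y | quest (y ∈ x) ⦄.
Definition classical (x : trm) : fm := ∀ y, y ∈ bang_set x ↔ y ∈ quest_set x.

Definition union (x y : trm) : trm := ⦃ z | z ∈ x ∨ z ∈ y ⦄.
Definition inter (x y : trm) : trm := ⦃ z | z ∈ x ∧ z ∈ y ⦄.
Notation "x ∪ y" := (union x y) (at level 50, left associativity) : bs4_scope.
Notation "x ∩ y" := (inter x y) (at level 40, left associativity) : bs4_scope.

Definition empty : trm := ⦃ y | ⊥ ⦄.
Notation "∅" := empty : bs4_scope.
Definition sing (u : trm) : trm := ⦃ y | y ≡ u ⦄.
Definition upair (u v : trm) : trm := ⦃ y | y ≡ u ∨ y ≡ v ⦄.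
Definition kpair (u v : trm) : trm := upair (sing u) (upair u v).
Notation "⟨ u , v ⟩" := (kpair u v)
  (at level 0, u at level 99, v at level 99) : bs4_scope.

(* The ordered pair (a,b).  The connectives ∃, ∧, ∨ commute with ! and ?, and
   !, ? do not change ≡, so (a,b)^! = {⟨x,∅⟩ : x ∈ a^!} ∪ {⟨y,{∅}⟩ : y ∈ b^!}
   and likewise for ?. *)
Definition opair (a b : trm) : trm :=
  ⦃ z | (∃ x, z ≡ ⟨x, ∅⟩ ∧ x ∈ a) ∨ (∃ y, z ≡ ⟨y, sing ∅⟩ ∧ y ∈ b) ⦄.
Notation "⟪ a , b ⟫" := (opair a b)
  (at level 0, a at level 99, b at level 99) : bs4_scope.

Definition cprod (A B : trm) : trm :=
  ⦃ p | ∃ a b, p ≡ ⟪a, b⟫ ∧ a ∈ A ∧ b ∈ B ⦄.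
Definition dom_of (R : trm) : trm := ⦃ x | ∃ y, ⟪x, y⟫ ∈ R ⦄.
Definition cfun (f A B : trm) : fm :=
  classical f ∧ f ⊆ cprod A B ∧ dom_of f = A ∧
  (∀ x y z, ⟪x, y⟫ ∈ f ∧ ⟪x, z⟫ ∈ f → y ≡ z).

(* f(x), as the class of its members *)
Definition app (f x : trm) : trm := ⦃ z | ∃ y, ⟪x, y⟫ ∈ f ∧ z ∈ y ⦄.

Definition ax_extensionality : fm := ∀ x y, x = y ⇔ (∀ z, z ∈ x ⇔ z ∈ y).
Definition ax_comprehension (p : form) : fm :=
  ∀ u, ∃ x, ∀ y, y ∈ x ⇔ (y ∈ u ∧ inst1 p y).
Definition ax_superset : fm := ∀ x, ∃ C, x ⊆ C ∧ (∀ y, circ (y ∈ C)).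
Definition ax_replacement (p : form) : fm :=
  ((∀ x y, circ (inst2 p x y)) ∧
   (∀ x, ∃ y, inst2 p x y ∧ (∀ z, inst2 p x z → y ≡ z)))
  → (∀ x, ∃ y, ∀ z, z ∈ y ⇔ (∃ w, w ∈ x ∧ inst2 p w z)).
Definition ax_pairing : fm := ∀ u v, ∃ x, ∀ y, y ∈ x ⇔ (y ≡ u ∨ y ≡ v).
Definition ax_power : fm := ∀ u, ∃ v, ∀ x, x ∈ v ⇔ bang (x ⊆ u).
Definition ax_union : fm := ∀ u, ∃ x, ∀ y, y ∈ x ⇔ (∃ z, y ∈ z ∧ z ∈ u).
Definition inductive (x : trm) : fm :=
  ∅ ∈ x ∧ (∀ y, y ∈ x → y ∪ sing y ∈ x).
Definition ax_infinity : fm := ∃ x, inductive x.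
Definition ax_foundation (p : form) : fm :=
  (∀ x, (∀ y, y ∈ bang_set x ∪ quest_set x → inst1 p y) → inst1 p x)
  → (∀ u, inst1 p u).
Definition ax_choice : fm :=
  ∀ u, classical u →
    (∀ x, x ∈ u → ∃ y, y ∈ x) →
    ∃ f, (∃ B, cfun f u B) ∧ (∀ x, x ∈ u → app f x ∈ x).

Inductive PZFC : form -> Prop :=
| PZFC_extensionality : PZFC (sentence ax_extensionality)
| PZFC_comprehension p : PZFC (sentence (ax_comprehension p))
| PZFC_superset : PZFC (sentence ax_superset)
| PZFC_replacement p : PZFC (sentence (ax_replacement p))
| PZFC_pairing : PZFC (sentence ax_pairing)
| PZFC_power : PZFC (sentence ax_power)
| PZFC_union : PZFC (sentence ax_union)
| PZFC_infinity : PZFC (sentence ax_infinity)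
| PZFC_foundation p : PZFC (sentence (ax_foundation p))
| PZFC_choice : PZFC (sentence ax_choice).

Definition ACLA : fm :=
  (∃ x, ∼ (bang_set x ⊆ quest_set x)) ∧ (∃ x, ∼ (quest_set x ⊆ bang_set x)).
Definition ACLA_cons : fm :=
  (∀ x, bang_set x ⊆ quest_set x) ∧ (∃ x, ∼ (quest_set x ⊆ bang_set x)).
Definition ACLA_comp : fm :=
  (∀ x, quest_set x ⊆ bang_set x) ∧ (∃ x, ∼ (bang_set x ⊆ quest_set x)).
Definition all_classical : fm := ∀ x, bang_set x = quest_set x.

(* Intersecting only the classical inductive sets makes ω classical. *)
Definition omega : trm :=
  ⦃ n | ∀ I, classical I ∧ inductive I → n ∈ I ⦄.
Fixpoint num (k : nat) : trm :=
  match k with O => ∅ | S j => num j ∪ sing (num j) end.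

(* A vocabulary: a set C of constant symbols and a set P of relation symbols,
   where ⟨x,n⟩ is a relation symbol of arity n. *)
Definition vocabulary (C P : trm) : fm :=
  classical C ∧ classical P ∧
  (∀ r, r ∈ P → ∃ x n, n ∈ omega ∧ r ≡ ⟨x, n⟩).

Definition var_code (n : trm) : trm := ⟨num 0, n⟩.
Definition const_code (c : trm) : trm := ⟨num 1, c⟩.
Definition Term (C : trm) : trm :=
  ⦃ t | (∃ n, n ∈ omega ∧ t ≡ var_code n) ∨ (∃ c, c ∈ C ∧ t ≡ const_code c) ⦄.

(* In [rel_code r t], the argument list t is a function from the arity of r to
   the terms. *)
Definition eq_code (t u : trm) : trm := ⟨num 0, ⟨t, u⟩⟩.
Definition rel_code (r t : trm) : trm := ⟨num 1, ⟨r, t⟩⟩.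
Definition not_code (p : trm) : trm := ⟨num 2, p⟩.
Definition and_code (p q : trm) : trm := ⟨num 3, ⟨p, q⟩⟩.
Definition or_code (p q : trm) : trm := ⟨num 4, ⟨p, q⟩⟩.
Definition imp_code (p q : trm) : trm := ⟨num 5, ⟨p, q⟩⟩.
Definition bot_code : trm := ⟨num 6, ∅⟩.
Definition ex_code (n p : trm) : trm := ⟨num 7, ⟨n, p⟩⟩.
Definition all_code (n p : trm) : trm := ⟨num 8, ⟨n, p⟩⟩.

Definition formula_closed (full : bool) (C P F : trm) : fm :=
  (∀ t u, t ∈ Term C ∧ u ∈ Term C → eq_code t u ∈ F) ∧
  (∀ r x n t, r ∈ P ∧ r ≡ ⟨x, n⟩ ∧ cfun t n (Term C) → rel_code r t ∈ F) ∧
  (∀ p, p ∈ F → not_code p ∈ F) ∧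
  (∀ p q, p ∈ F ∧ q ∈ F → and_code p q ∈ F) ∧
  (∀ p q, p ∈ F ∧ q ∈ F → or_code p q ∈ F) ∧
  (∀ n p, n ∈ omega ∧ p ∈ F → ex_code n p ∈ F) ∧
  (∀ n p, n ∈ omega ∧ p ∈ F → all_code n p ∈ F) ∧
  (if full then (∀ p q, p ∈ F ∧ q ∈ F → imp_code p q ∈ F) ∧ bot_code ∈ F
   else ftop).

(* [Formula false C P] consists of the formulas without → and ⊥. *)
Definition Formula (full : bool) (C P : trm) : trm :=
  ⦃ p | ∀ F, classical F ∧ formula_closed full C P F → p ∈ F ⦄.

(* M^n, and for n = ω the assignments of the variables in M *)
Definition power (M n : trm) : trm := ⦃ s | bang (cfun s n M) ⦄.

Definition upd (s n a : trm) : trm :=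
  ⦃ p | (p ∈ s ∧ ¬ (∃ b, p ≡ ⟪n, b⟫)) ∨ p ≡ ⟪n, a⟫ ⦄.

(* the value of the term t, as the class of its members *)
Definition val (cI s t : trm) : trm :=
  ⦃ z | (∃ n, t ≡ var_code n ∧ z ∈ app s n) ∨
        (∃ c, t ≡ const_code c ∧ z ∈ app cI c) ⦄.
Definition vals (cI s n t : trm) : trm :=
  ⦃ p | ∃ i b, i ∈ n ∧ b ≡ val cI s (app t i) ∧ p ≡ ⟪i, b⟫ ⦄.

Definition tarski_model (C P M cI rI : trm) : fm :=
  classical M ∧ (∃ a, a ∈ M) ∧ cfun cI C M ∧ (∃ B, cfun rI P B) ∧
  (∀ r x n, r ∈ P ∧ r ≡ ⟨x, n⟩ → app rI r ⊆ power M n).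

(* The Tarski clauses for a set S of pairs ⟨φ,s⟩ ("φ holds under s"), relative
   to a biconditional, a negation and an equality: (⇔, ∼, =) for Tarski models
   over BS4, and (↔, ¬, ≡) for classical structures. *)
Definition sat_clauses (iff : fm -> fm -> fm) (neg : fm -> fm)
    (eq : trm -> trm -> fm) (C P M cI rI S : trm) : fm :=
  let F := Formula true C P in
  ∀ s, s ∈ power M omega →
  (∀ t u a b, t ∈ Term C ∧ u ∈ Term C ∧ a ≡ val cI s t ∧ b ≡ val cI s u →
     iff (⟨eq_code t u, s⟩ ∈ S) (eq a b)) ∧
  (∀ r x n t a, r ∈ P ∧ r ≡ ⟨x, n⟩ ∧ cfun t n (Term C) ∧ a ≡ vals cI s n t →
     iff (⟨rel_code r t, s⟩ ∈ S) (a ∈ app rI r)) ∧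
  (∀ p, p ∈ F → iff (⟨not_code p, s⟩ ∈ S) (neg (⟨p, s⟩ ∈ S))) ∧
  (∀ p q, p ∈ F ∧ q ∈ F →
     iff (⟨and_code p q, s⟩ ∈ S) (⟨p, s⟩ ∈ S ∧ ⟨q, s⟩ ∈ S)) ∧
  (∀ p q, p ∈ F ∧ q ∈ F →
     iff (⟨or_code p q, s⟩ ∈ S) (⟨p, s⟩ ∈ S ∨ ⟨q, s⟩ ∈ S)) ∧
  (∀ p q, p ∈ F ∧ q ∈ F →
     iff (⟨imp_code p q, s⟩ ∈ S) (⟨p, s⟩ ∈ S → ⟨q, s⟩ ∈ S)) ∧
  iff (⟨bot_code, s⟩ ∈ S) ⊥ ∧
  (∀ n p, n ∈ omega ∧ p ∈ F →
     iff (⟨ex_code n p, s⟩ ∈ S) (∃ a, a ∈ M ∧ ⟨p, upd s n a⟩ ∈ S)) ∧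
  (∀ n p, n ∈ omega ∧ p ∈ F →
     iff (⟨all_code n p, s⟩ ∈ S) (∀ a, a ∈ M → ⟨p, upd s n a⟩ ∈ S)).

Definition tarski_sat (C P M cI rI p s : trm) : fm :=
  ∃ S, bang (sat_clauses fsiff fnot eqt C P M cI rI S) ∧ ⟨p, s⟩ ∈ S.

Definition tarski_conseq (C P Sigma p : trm) : fm :=
  ∀ M cI rI, tarski_model C P M cI rI →
  ∀ s, s ∈ power M omega →
    (∀ q, q ∈ Sigma → tarski_sat C P M cI rI q s) → tarski_sat C P M cI rI p s.

Definition classical_model (C P M cI rI : trm) : fm :=
  tarski_model C P M cI rI ∧ (∀ r, r ∈ P → classical (app rI r)).

Definition FOL_sat (C P M cI rI p s : trm) : fm :=
  ∃ S, bang (classical S ∧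
             sat_clauses fiff fneg (fun a b => a ≡ b) C P M cI rI S) ∧
       ⟨p, s⟩ ∈ S.

Definition FOL_conseq (C P Sigma p : trm) : fm :=
  ∀ M cI rI, classical_model C P M cI rI →
  ∀ s, s ∈ power M omega →
    (∀ q, q ∈ Sigma → FOL_sat C P M cI rI q s) → FOL_sat C P M cI rI p s.

Definition TF_model (C P M cI rp rn ep en : trm) : fm :=
  classical M ∧ (∃ a, a ∈ M) ∧ cfun cI C M ∧
  (∃ B, cfun rp P B) ∧ (∃ B, cfun rn P B) ∧
  (∀ r x n, r ∈ P ∧ r ≡ ⟨x, n⟩ →
     classical (app rp r) ∧ app rp r ⊆ power M n ∧
     classical (app rn r) ∧ app rn r ⊆ power M n) ∧
  classical ep ∧ ep ⊆ cprod M M ∧ classical en ∧ en ⊆ cprod M M ∧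
  (∀ a b, ⟪a, b⟫ ∈ en → ⟪b, a⟫ ∈ en) ∧
  (∀ a b, a ∈ M ∧ b ∈ M → (⟪a, b⟫ ∈ ep ↔ a ≡ b)).

(* The clauses for ⊨^T (the set X) and ⊨^F (the set Y). *)
Definition TF_clauses (C P M cI rp rn ep en X Y : trm) : fm :=
  let F := Formula true C P in
  ∀ s, s ∈ power M omega →
  (∀ t u a b, t ∈ Term C ∧ u ∈ Term C ∧ a ≡ val cI s t ∧ b ≡ val cI s u →
     (⟨eq_code t u, s⟩ ∈ X ↔ ⟪a, b⟫ ∈ ep) ∧
     (⟨eq_code t u, s⟩ ∈ Y ↔ ⟪a, b⟫ ∈ en)) ∧
  (∀ r x n t a, r ∈ P ∧ r ≡ ⟨x, n⟩ ∧ cfun t n (Term C) ∧ a ≡ vals cI s n t →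
     (⟨rel_code r t, s⟩ ∈ X ↔ a ∈ app rp r) ∧
     (⟨rel_code r t, s⟩ ∈ Y ↔ a ∈ app rn r)) ∧
  (∀ p, p ∈ F →
     (⟨not_code p, s⟩ ∈ X ↔ ⟨p, s⟩ ∈ Y) ∧
     (⟨not_code p, s⟩ ∈ Y ↔ ⟨p, s⟩ ∈ X)) ∧
  (∀ p q, p ∈ F ∧ q ∈ F →
     (⟨and_code p q, s⟩ ∈ X ↔ (⟨p, s⟩ ∈ X ∧ ⟨q, s⟩ ∈ X)) ∧
     (⟨and_code p q, s⟩ ∈ Y ↔ (⟨p, s⟩ ∈ Y ∨ ⟨q, s⟩ ∈ Y))) ∧
  (∀ p q, p ∈ F ∧ q ∈ F →
     (⟨or_code p q, s⟩ ∈ X ↔ (⟨p, s⟩ ∈ X ∨ ⟨q, s⟩ ∈ X)) ∧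
     (⟨or_code p q, s⟩ ∈ Y ↔ (⟨p, s⟩ ∈ Y ∧ ⟨q, s⟩ ∈ Y))) ∧
  (∀ p q, p ∈ F ∧ q ∈ F →
     (⟨imp_code p q, s⟩ ∈ X ↔ (⟨p, s⟩ ∈ X → ⟨q, s⟩ ∈ X)) ∧
     (⟨imp_code p q, s⟩ ∈ Y ↔ (⟨p, s⟩ ∈ X ∧ ⟨q, s⟩ ∈ Y))) ∧
  (¬ (⟨bot_code, s⟩ ∈ X) ∧ ⟨bot_code, s⟩ ∈ Y) ∧
  (∀ n p, n ∈ omega ∧ p ∈ F →
     (⟨ex_code n p, s⟩ ∈ X ↔ (∃ a, a ∈ M ∧ ⟨p, upd s n a⟩ ∈ X)) ∧
     (⟨ex_code n p, s⟩ ∈ Y ↔ (∀ a, a ∈ M → ⟨p, upd s n a⟩ ∈ Y))) ∧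
  (∀ n p, n ∈ omega ∧ p ∈ F →
     (⟨all_code n p, s⟩ ∈ X ↔ (∀ a, a ∈ M → ⟨p, upd s n a⟩ ∈ X)) ∧
     (⟨all_code n p, s⟩ ∈ Y ↔ (∃ a, a ∈ M ∧ ⟨p, upd s n a⟩ ∈ Y))).

Definition TF_true (C P M cI rp rn ep en p s : trm) : fm :=
  ∃ X, (∃ Y, bang (classical X ∧ classical Y ∧
                   TF_clauses C P M cI rp rn ep en X Y)) ∧
       ⟨p, s⟩ ∈ X.

(* Consequence over the T/F-models satisfying [restr P M rp rn ep en]. *)
Definition TF_conseq (restr : trm -> trm -> trm -> trm -> trm -> trm -> fm)
    (C P Sigma p : trm) : fm :=
  ∀ M cI rp rn ep en,
  TF_model C P M cI rp rn ep en ∧ restr P M rp rn ep en →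
  ∀ s, s ∈ power M omega →
    (∀ q, q ∈ Sigma → TF_true C P M cI rp rn ep en q s) →
    TF_true C P M cI rp rn ep en p s.

Definition BS4_conseq : trm -> trm -> trm -> trm -> fm :=
  TF_conseq (fun P M rp rn ep en => ftop).
Definition K3imp_conseq : trm -> trm -> trm -> trm -> fm :=
  TF_conseq (fun P M rp rn ep en =>
    (∀ r, r ∈ P → app rp r ∩ app rn r = ∅) ∧ ep ∩ en = ∅).
Definition LFI1_conseq : trm -> trm -> trm -> trm -> fm :=
  TF_conseq (fun P M rp rn ep en =>
    (∀ r x n, r ∈ P ∧ r ≡ ⟨x, n⟩ → app rp r ∪ app rn r = power M n) ∧
    ep ∪ en = cprod M M).

(* Σ ⊨ φ ↔ Σ ⊢ φ for all Σ and φ in the fragment without → and ⊥.  In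
   particular the consequence relations of FDE, K3 and LP are those of BS4,
   K3^→ and LFI1 on this fragment. *)
Definition coincide (conseq : trm -> trm -> trm -> trm -> fm) (C P : trm) : fm :=
  ∀ Sigma p, Sigma ⊆ Formula false C P ∧ p ∈ Formula false C P →
    (tarski_conseq C P Sigma p ↔ conseq C P Sigma p).

Definition coincide_FDE : trm -> trm -> fm := coincide BS4_conseq.
Definition coincide_K3 : trm -> trm -> fm := coincide K3imp_conseq.
Definition coincide_LP : trm -> trm -> fm := coincide LFI1_conseq.
Definition coincide_FOL : trm -> trm -> fm := coincide FOL_conseq.

Definition exactly_one (A B C D : fm) : fm :=
  (A ∨ B ∨ C ∨ D) ∧
  ¬ (A ∧ B) ∧ ¬ (A ∧ C) ∧ ¬ (A ∧ D) ∧ ¬ (B ∧ C) ∧ ¬ (B ∧ D) ∧ ¬ (C ∧ D).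

(* Main.v *)
From Stdlib Require Import Classical ClassicalEpsilon FunctionalExtensionality PeanoNat Lia.
Require Import Defs.

(* In a model V of PZFC every set is determined by its positive and its negative members, and the
   four situations are distinguished by which of gluts (z both positive and negative member of x)
   and gaps (neither) occur.

   A Tarski model is turned into a T/F-model with the same domain by separating the positive and
   the negative part of each interpretation; a satisfaction set S splits into the classical sets of
   its positive and negative members.  This T/F-model is consistent when V has no gluts and complete
   when V has no gaps.  Conversely let a T/F-model satisfy the same two conditions.  Replace a in M
   by the set f(a) whose positive members are the b in M with b =^+ a and whose negative members are
   the b with b =^- a or b not in M.  It exists in V, because it needs a glut only if V has one and
   similarly for gaps, and f(a) and f(b) are unequal (falsely equal) exactly when a =^- b.  Hence the
   T/F-model is isomorphic to one obtained from a Tarski model.  An induction on formulas shows that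
   truth and falsity sets have no gluts or no gaps either when the model has none, so that they can
   be merged into a satisfaction set S in V.  So Tarski consequence is T/F-consequence over the
   models allowed by V.

   Conversely "v0 ≠ v0 entails v1 = v2" holds for Tarski models iff V has no gluts, and "v0 = v0
   entails v1 = v2 or v1 ≠ v2" holds iff V has no gaps; these two entailments tell FDE, K3, LP and FOL
   apart. *)
Set Implicit Arguments.

(** * Truth values of formulas with class terms *)

(** The argument concerns an arbitrary model [V] of the axioms, in a classical metatheory. The ω and
    the formulas of [V] may be nonstandard, so induction over them is legitimate only for predicates
    definable in [V]. Hence the calculus [Def], which records that a predicate is the truth of some
    formula with parameters. Truth alone suffices there: prefixing [!] keeps the truth condition and
    makes the formula false wherever it is not true, so that a bounded definable predicate separates
    a classical set.

    A satisfaction relation has to be a set of [V], and it is obtained as a fixed point on the set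
    of all pairs of a formula and an assignment. The obstacle is implication, whose truth depends
    negatively on the truth of its antecedent. Truth, falsity and the absence of each are therefore
    generated together, by one monotone operator on four relations; only afterwards does an
    induction on formulas show that the last two are complements of the first two. *)

Lemma truth_rename (M : TFmodel) (p : form) : forall r e,
  (truth M e (rename r p) <-> truth M (fun i => e (r i)) p) /\
  (falsity M e (rename r p) <-> falsity M (fun i => e (r i)) p).
Proof.
  assert (up : forall r e (a : M),
    (fun i => scons a e (match i with O => O | S j => S (r j) end)) =
    scons a (fun i => e (r i))).
  { intros r e a; apply functional_extensionality; now intros [|i]. }
  induction p; intros r e; cbn [rename truth falsity]; try tauto;
    try (specialize (IHp r e); tauto);
    try (specialize (IHp1 r e); specialize (IHp2 r e); tauto).
  - split; [split; intros H a; specialize (H a)|split; intros [a H]; exists a];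
      pose proof (IHp (fun i => match i with O => O | S j => S (r j) end) (scons a e)) as K;
      cbv beta in K; rewrite up in K; tauto.
  - split; [split; intros [a H]; exists a|split; intros H a; specialize (H a)];
      pose proof (IHp (fun i => match i with O => O | S j => S (r j) end) (scons a e)) as K;
      cbv beta in K; rewrite up in K; tauto.
Qed.

Record universe : Type := {
  carrier :> TFmodel;
  PZFC_holds : forall q, PZFC q -> models carrier q }.

Notation "x ∊ y" := (in_pos _ x y) (at level 70, no associativity).
Notation "x ∉- y" := (in_neg _ x y) (at level 70, no associativity).

Section Semantics.
Context {V : TFmodel}.
Implicit Types (e : nat -> V) (A B : fm) (t u : trm) (x y : V).

(** [T] stands last so that it can be an existential variable: [sem] builds it while descending
    through [A], and the result is the meaning of the formula in ordinary logic. *)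
Definition tr n e A (T : Prop) : Prop := truth V e (A n) <-> T.
Definition fa n e A (T : Prop) : Prop := falsity V e (A n) <-> T.

(** A class term is unfolded under more binders than stood above the place where it was written;
    [e'] puts the values of these binders in front. *)
Definition extends n e m (e' : nat -> V) : Prop :=
  exists d, m = d + n /\ forall i, e' (d + i) = e i.

(* The class term t has the positive members P and the negative members Q. *)
Definition cdn n e t (P Q : V -> Prop) : Prop :=
  forall m e' k, extends n e m e' -> k < m ->
    tr m e' (mem (Var k) t) (P (e' (m - S k))) /\
    fa m e' (mem (Var k) t) (Q (e' (m - S k))).

(** A class term denotes a set with the same positive and negative members; a class that forms no
    set still has a [cdn]. *)
Definition den n e t x : Prop :=
  match t with
  | Var k => k < n /\ e (n - S k) = x
  | Cls _ => cdn n e t (fun z => z ∊ x) (fun z => z ∉- x)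
  end.

Lemma extends_refl n e : extends n e n e.
Proof. exists 0; auto. Qed.

Lemma extends_trans n e m e' l e'' :
  extends n e m e' -> extends m e' l e'' -> extends n e l e''.
Proof.
  intros [d [-> H]] [d' [-> H']]; exists (d' + d); split; [lia|].
  intros i; rewrite <- H, <- H', Nat.add_assoc; auto.
Qed.

Lemma extends_scons n e a : extends n e (S n) (scons a e).
Proof. now exists 1. Qed.

Lemma extends_lookup n e m e' k :
  extends n e m e' -> k < n -> k < m /\ e' (m - S k) = e (n - S k).
Proof.
  intros [d [-> H]] L; split; [lia|].
  replace (d + n - S k) with (d + (n - S k)) by lia; auto.
Qed.

Lemma cdn_extends n e m e' t P Q : extends n e m e' -> cdn n e t P Q -> cdn m e' t P Q.
Proof. intros X H l e'' k Y L; apply H; auto; eapply extends_trans; eauto. Qed.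

Lemma den_extends n e m e' t x : extends n e m e' -> den n e t x -> den m e' t x.
Proof.
  destruct t as [k|f]; [|apply cdn_extends].
  intros X [L <-]; now apply extends_lookup.
Qed.

Lemma den_scons n e a t x : den n e t x -> den (S n) (scons a e) t x.
Proof. apply den_extends, extends_scons. Qed.

Lemma cdn_scons n e a t P Q : cdn n e t P Q -> cdn (S n) (scons a e) t P Q.
Proof. apply cdn_extends, extends_scons. Qed.

Lemma den_var n e a : den (S n) (scons a e) (Var n) a.
Proof. split; [lia|]; now rewrite Nat.sub_diag. Qed.

Lemma den_cdn n e t x : den n e t x -> cdn n e t (fun z => z ∊ x) (fun z => z ∉- x).
Proof.
  destruct t as [l|f]; [|auto].
  intros [L <-] m e' k X Lk; destruct (extends_lookup X L) as [? <-].
  split; unfold tr, fa; cbn; tauto.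
Qed.

Lemma cdn_iff n e t (P Q P' Q' : V -> Prop) :
  (forall z, P z <-> P' z) -> (forall z, Q z <-> Q' z) -> cdn n e t P Q -> cdn n e t P' Q'.
Proof.
  intros HP HQ H m e' k X L; destruct (H m e' k X L).
  unfold tr, fa in *; rewrite <- HP, <- HQ; auto.
Qed.

Lemma cdn_cls n e (A : trm -> fm) (P Q : V -> Prop) :
  (forall m e' t z, extends n e m e' -> den m e' t z -> tr m e' (A t) (P z)) ->
  (forall m e' t z, extends n e m e' -> den m e' t z -> fa m e' (A t) (Q z)) ->
  cdn n e (cls A) P Q.
Proof.
  intros HP HQ m e' k X L; split; [apply HP|apply HQ]; cbn; auto.
Qed.

Lemma tr_iff n e A (T T' : Prop) : (T <-> T') -> tr n e A T -> tr n e A T'.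
Proof. unfold tr; tauto. Qed.
Section Connectives.
Variables (n : nat) (e : nat -> V) (A B : fm) (T T' F F' : Prop).

Lemma tr_bot : tr n e fbot False. Proof. unfold tr; cbn; tauto. Qed.
Lemma fa_bot : fa n e fbot True. Proof. unfold fa; cbn; tauto. Qed.
Lemma tr_not : fa n e A F -> tr n e (fnot A) F. Proof. auto. Qed.
Lemma fa_not : tr n e A T -> fa n e (fnot A) T. Proof. auto. Qed.
(* The second premise may use the first conjunct: a class term in B need only
   denote when A is true. *)
Lemma tr_conj : tr n e A T -> (T -> tr n e B T') -> tr n e (fconj A B) (T /\ T').
Proof. unfold tr; cbn; tauto. Qed.
Lemma fa_conj : fa n e A F -> fa n e B F' -> fa n e (fconj A B) (F \/ F').
Proof. unfold fa; cbn; tauto. Qed.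
Lemma tr_disj : tr n e A T -> tr n e B T' -> tr n e (fdisj A B) (T \/ T').
Proof. unfold tr; cbn; tauto. Qed.
Lemma fa_disj : fa n e A F -> fa n e B F' -> fa n e (fdisj A B) (F /\ F').
Proof. unfold fa; cbn; tauto. Qed.
Lemma tr_imp : tr n e A T -> (T -> tr n e B T') -> tr n e (fimp A B) (T -> T').
Proof. unfold tr; cbn; tauto. Qed.
Lemma fa_imp : tr n e A T -> (T -> fa n e B F') -> fa n e (fimp A B) (T /\ F').
Proof. unfold tr, fa; cbn; tauto. Qed.
Lemma tr_fiff : tr n e A T -> tr n e B T' -> tr n e (fiff A B) (T <-> T').
Proof. unfold tr; cbn; tauto. Qed.
Lemma tr_simp : tr n e A T -> fa n e A F -> tr n e B T' -> fa n e B F' ->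
  tr n e (fsimp A B) ((T -> T') /\ (F' -> F)).
Proof. unfold tr, fa; cbn; tauto. Qed.
Lemma fa_simp : tr n e A T -> fa n e B F' -> fa n e (fsimp A B) (T /\ F').
Proof. unfold tr, fa; cbn; tauto. Qed.
Lemma tr_siff : tr n e A T -> fa n e A F -> tr n e B T' -> fa n e B F' ->
  tr n e (fsiff A B) ((T <-> T') /\ (F <-> F')).
Proof. unfold tr, fa; cbn; tauto. Qed.
Lemma fa_siff : tr n e A T -> fa n e A F -> tr n e B T' -> fa n e B F' ->
  fa n e (fsiff A B) ((T /\ F') \/ (T' /\ F)).
Proof. unfold tr, fa; cbn; tauto. Qed.
Lemma tr_neg : tr n e A T -> tr n e (fneg A) (~ T).
Proof. unfold tr; cbn; tauto. Qed.
Lemma fa_neg : tr n e A T -> fa n e (fneg A) T.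
Proof. unfold tr, fa; cbn; tauto. Qed.
Lemma tr_bang : tr n e A T -> tr n e (bang A) T.
Proof. unfold tr; cbn; tauto. Qed.
Lemma fa_bang : tr n e A T -> fa n e (bang A) (~ T).
Proof. unfold tr, fa; cbn; tauto. Qed.
Lemma tr_quest : fa n e A F -> tr n e (quest A) (~ F).
Proof. unfold tr, fa; cbn; tauto. Qed.
Lemma fa_quest : fa n e A F -> fa n e (quest A) F.
Proof. unfold fa; cbn; tauto. Qed.
Lemma tr_top : tr n e ftop True. Proof. unfold tr; cbn; tauto. Qed.
End Connectives.

Section Quantifiers.
Variables (n : nat) (e : nat -> V) (A : trm -> fm) (T : V -> Prop).

Lemma tr_all : (forall a, tr (S n) (scons a e) (A (Var n)) (T a)) ->
  tr n e (fall A) (forall a, T a).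
Proof. intros H; split; intros K a; specialize (K a); now apply H. Qed.
Lemma fa_all : (forall a, fa (S n) (scons a e) (A (Var n)) (T a)) ->
  fa n e (fall A) (exists a, T a).
Proof. intros H; split; intros [a K]; exists a; now apply H. Qed.
Lemma tr_ex : (forall a, tr (S n) (scons a e) (A (Var n)) (T a)) ->
  tr n e (fex A) (exists a, T a).
Proof. intros H; split; intros [a K]; exists a; now apply H. Qed.
Lemma fa_ex : (forall a, fa (S n) (scons a e) (A (Var n)) (T a)) ->
  fa n e (fex A) (forall a, T a).
Proof. intros H; split; intros K a; specialize (K a); now apply H. Qed.
End Quantifiers.

End Semantics.

(** * Definability *)

Section Definability.
Context {V : TFmodel}.
Implicit Types (e c : nat -> V).

(** Interleaving leaves infinitely many places both for variables (even indices) and for parameters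
    (odd indices). *)
Fixpoint mix e c (i : nat) : V :=
  match i with
  | 0 => e 0
  | 1 => c 0
  | S (S j) => mix (fun i => e (S i)) (fun i => c (S i)) j
  end.

Lemma mix_even i : forall e c, mix e c (2 * i) = e i.
Proof.
  induction i; intros e c; [easy|].
  replace (2 * S i) with (S (S (2 * i))) by lia; cbn [mix]; apply IHi.
Qed.

Lemma mix_odd i : forall e c, mix e c (2 * i + 1) = c i.
Proof.
  induction i; intros e c; [easy|].
  replace (2 * S i + 1) with (S (S (2 * i + 1))) by lia; cbn [mix]; apply IHi.
Qed.

(* Def P: P is definable from the values of e, with arbitrary parameters. *)
Definition Def (P : (nat -> V) -> Prop) : Prop :=
  exists p c, forall e, truth V (mix e c) p <-> P e.

Definition DefF (g : (nat -> V) -> V) : Prop :=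
  Def (fun e => e 0 = g (fun i => e (S i))).

Definition split_index (f g : nat -> nat) (k : nat) : nat :=
  if Nat.even k then f (Nat.div2 k) else g (Nat.div2 k).

Lemma truth_rename_mix (p : form) (f g : nat -> nat) e c e' :
  (forall i, e' (f i) = e i) -> (forall i, e' (g i) = c i) ->
  (truth V e' (rename (split_index f g) p) <-> truth V (mix e c) p).
Proof.
  intros H K; rewrite (proj1 (truth_rename V p (split_index f g) e')).
  replace (fun i => e' (split_index f g i)) with (mix e c); [tauto|].
  apply functional_extensionality; intros i; unfold split_index.
  destruct (Nat.Even_or_Odd i) as [[j ->]|[j ->]].
  - rewrite Nat.even_even, Nat.div2_double, H; apply mix_even.
  - rewrite Nat.even_odd. replace (2 * j + 1) with (S (2 * j)) at 2 by lia.
    rewrite Nat.div2_succ_double, K; apply mix_odd.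
Qed.

Lemma Def_iff (P Q : (nat -> V) -> Prop) :
  (forall e, P e <-> Q e) -> Def P -> Def Q.
Proof. intros H [p [c K]]; exists p, c; intros e; rewrite K; apply H. Qed.

Lemma Def_subst (r : nat -> nat) (P : (nat -> V) -> Prop) :
  Def P -> Def (fun e => P (fun i => e (r i))).
Proof.
  intros [p [c K]].
  exists (rename (split_index (fun i => 2 * r i) (fun i => 2 * i + 1)) p), c; intros e.
  rewrite <- K; apply truth_rename_mix; intros i; [apply mix_even|apply mix_odd].
Qed.

(** The two formulas come with unrelated parameters [c] and [c']; a further interleaving gives them
    common ones. *)
Lemma Def_pair (P Q : (nat -> V) -> Prop) : Def P -> Def Q ->
  exists p q c, forall e, (truth V (mix e c) p <-> P e) /\ (truth V (mix e c) q <-> Q e).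
Proof.
  intros [p [c K]] [p' [c' K']].
  exists (rename (split_index (fun i => 2 * i) (fun i => 2 * (2 * i) + 1)) p),
    (rename (split_index (fun i => 2 * i) (fun i => 2 * (2 * i + 1) + 1)) p'), (mix c c').
  intros e; rewrite <- K, <- K'; split; apply truth_rename_mix; intros i;
    rewrite ?mix_even, ?mix_odd, ?mix_even, ?mix_odd; auto.
Qed.

(** Native negation would lead to falsity, about which [Def] says nothing; it is [p → ⊥] that is
    true iff [p] is not true. *)
Lemma Def_not (P : (nat -> V) -> Prop) : Def P -> Def (fun e => ~ P e).
Proof. intros [p [c K]]; exists (FImp p FBot), c; intros e; cbn; rewrite K; tauto. Qed.

Lemma Def_and (P Q : (nat -> V) -> Prop) : Def P -> Def Q -> Def (fun e => P e /\ Q e).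
Proof.
  intros HP HQ; destruct (Def_pair HP HQ) as [p [q [c K]]].
  exists (FAnd p q), c; intros e; cbn; destruct (K e); tauto.
Qed.

Lemma Def_or (P Q : (nat -> V) -> Prop) : Def P -> Def Q -> Def (fun e => P e \/ Q e).
Proof.
  intros HP HQ; destruct (Def_pair HP HQ) as [p [q [c K]]].
  exists (FOr p q), c; intros e; cbn; destruct (K e); tauto.
Qed.

Lemma Def_imp (P Q : (nat -> V) -> Prop) : Def P -> Def Q -> Def (fun e => P e -> Q e).
Proof.
  intros HP HQ; destruct (Def_pair HP HQ) as [p [q [c K]]].
  exists (FImp p q), c; intros e; cbn; destruct (K e); tauto.
Qed.

Lemma Def_equiv (P Q : (nat -> V) -> Prop) : Def P -> Def Q -> Def (fun e => P e <-> Q e).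
Proof. intros; apply Def_and; apply Def_imp; auto. Qed.

(** A proposition of the metatheory is decided classically, so one of two fixed sentences defines
    it. *)
Lemma Def_cst (T : Prop) : Def (fun _ => T).
Proof.
  destruct (dom_inhabited V) as [a].
  exists (if excluded_middle_informative T then FImp FBot FBot else FBot), (fun _ => a).
  intros e; destruct (excluded_middle_informative T); cbn; tauto.
Qed.

Lemma Def_all (P : V -> (nat -> V) -> Prop) :
  Def (fun e => P (e 0) (fun i => e (S i))) -> Def (fun e => forall a, P a e).
Proof.
  intros [p [c K]].
  (* The bound variable takes index 0, in front of the whole interleaving, so every other index
     moves up by one. *)
  exists (FAll (rename (split_index (fun i => match i with 0 => 0 | S j => S (2 * j) end)
    (fun i => S (2 * i + 1))) p)), c.
  assert (H : forall e a, truth V (scons a (mix e c)) (rename (split_index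
    (fun i => match i with 0 => 0 | S j => S (2 * j) end) (fun i => S (2 * i + 1))) p)
    <-> P a e).
  { intros e a; rewrite (@truth_rename_mix p _ _ (scons a e) c).
    - apply (K (scons a e)).
    - intros [|i]; cbn [scons]; [easy|apply mix_even].
    - intros i; cbn [scons]; apply mix_odd. }
  intros e; cbn [truth]; split; intros A a; apply H, A.
Qed.

Lemma Def_ex (P : V -> (nat -> V) -> Prop) :
  Def (fun e => P (e 0) (fun i => e (S i))) -> Def (fun e => exists a, P a e).
Proof.
  intros H; apply Def_iff with (fun e => ~ forall a, ~ P a e).
  - intros e; split; [apply not_all_not_ex|firstorder].
  - apply Def_not, Def_all, Def_not, H.
Qed.

Lemma DefF_var i : DefF (fun e => e i).
Proof.
  destruct (dom_inhabited V) as [a]; exists (FEq (2 * 0) (2 * S i)), (fun _ => a).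
  intros e; cbn [truth]; now rewrite !mix_even.
Qed.

Lemma DefF_cst a : DefF (fun _ => a).
Proof.
  exists (FEq (2 * 0) (2 * 0 + 1)), (fun _ => a).
  intros e; cbn [truth]; now rewrite mix_even, mix_odd.
Qed.

Lemma Def_atom (R : V -> V -> Prop) (g h : (nat -> V) -> V) :
  Def (fun e => R (e 0) (e 1)) -> DefF g -> DefF h -> Def (fun e => R (g e) (h e)).
Proof.
  intros HR Hg Hh.
  apply Def_iff with (fun e => exists a b, a = g e /\ b = h e /\ R a b).
  - intros e; split; [intros (a & b & -> & -> & H); auto|exists (g e), (h e); auto].
  - apply (Def_ex (fun a e => exists b, a = g e /\ b = h e /\ R a b)).
    apply (Def_ex (fun b e => e 0 = g (fun i => e (S i)) /\ b = h (fun i => e (S i)) /\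
      R (e 0) b)).
    repeat apply Def_and.
    + apply (Def_subst (fun i => match i with 0 => 1 | S j => S (S j) end) Hg).
    + apply (Def_subst (fun i => match i with 0 => 0 | S j => S (S j) end) Hh).
    + apply (Def_subst (fun i => match i with 0 => 1 | _ => 0 end) HR).
Qed.

Lemma Def_in g h : DefF g -> DefF h -> Def (fun e => g e ∊ h e).
Proof.
  apply (@Def_atom (fun a b => a ∊ b)).
  destruct (dom_inhabited V) as [a]; exists (FIn (2 * 0) (2 * 1)), (fun _ => a).
  intros e; cbn [truth]; now rewrite !mix_even.
Qed.

Lemma Def_notin g h : DefF g -> DefF h -> Def (fun e => g e ∉- h e).
Proof.
  apply (@Def_atom (fun a b => a ∉- b)).
  destruct (dom_inhabited V) as [a]; exists (FNot (FIn (2 * 0) (2 * 1))), (fun _ => a).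
  intros e; cbn [truth falsity]; now rewrite !mix_even.
Qed.

Lemma Def_eq g h : DefF g -> DefF h -> Def (fun e => g e = h e).
Proof. apply (@Def_atom (fun a b => a = b)), (DefF_var 0). Qed.

Lemma Def_pred (R : V -> Prop) (g : (nat -> V) -> V) :
  Def (fun e => R (e 0)) -> DefF g -> Def (fun e => R (g e)).
Proof. intros H Hg; apply (@Def_atom (fun a _ => R a) g g); auto. Qed.

Lemma DefF_fun (f : V -> V) (g : (nat -> V) -> V) :
  DefF (fun e => f (e 0)) -> DefF g -> DefF (fun e => f (g e)).
Proof.
  intros Hf Hg; unfold DefF.
  apply (@Def_atom (fun a b => a = f b) (fun e => e 0)); [apply Hf|apply DefF_var|].
  apply (Def_subst (fun i => match i with 0 => 0 | S j => S (S j) end) Hg).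
Qed.

Lemma DefF_fun2 (f : V -> V -> V) (g h : (nat -> V) -> V) :
  DefF (fun e => f (e 0) (e 1)) -> DefF g -> DefF h -> DefF (fun e => f (g e) (h e)).
Proof.
  intros Hf Hg Hh; unfold DefF.
  apply Def_iff with (fun e => exists a, a = h (fun i => e (S i)) /\
    e 0 = f (g (fun i => e (S i))) a).
  { intros e; split; [intros (a & -> & ?); auto|eauto]. }
  apply (Def_ex (fun a e => a = h (fun i => e (S i)) /\ e 0 = f (g (fun i => e (S i))) a)).
  apply Def_and.
  { apply (Def_subst (fun i => match i with 0 => 0 | S j => S (S j) end) Hh). }
  apply Def_iff with (fun e => exists b, b = g (fun i => e (S (S i))) /\ e 1 = f b (e 0)).
  { intros e; split; [intros (b & -> & ?); auto|eauto]. }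
  apply (Def_ex (fun b e => b = g (fun i => e (S (S i))) /\ e 1 = f b (e 0))).
  apply Def_and.
  { apply (Def_subst (fun i => match i with 0 => 0 | S j => S (S (S j)) end) Hg). }
  apply (Def_subst (fun i => match i with 0 => 2 | 1 => 0 | _ => 1 end) Hf).
Qed.

Lemma DefF_subst (r : nat -> nat) (g : (nat -> V) -> V) :
  DefF g -> DefF (fun e => g (fun i => e (r i))).
Proof.
  intros H; apply (Def_subst (fun i => match i with 0 => 0 | S j => S (r j) end) H).
Qed.

Lemma Def_let (P : V -> (nat -> V) -> Prop) g :
  Def (fun e => P (e 0) (fun i => e (S i))) -> DefF g -> Def (fun e => P (g e) e).
Proof.
  intros H Hg; apply Def_iff with (fun e => exists a, a = g e /\ P a e).
  { intros e; split; [intros (a & -> & ?); auto|eauto]. }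
  apply (Def_ex (fun a e => a = g e /\ P a e)); apply Def_and; auto.
Qed.

Lemma Def_atom3 (R : V -> V -> V -> Prop) g h j :
  Def (fun e => R (e 0) (e 1) (e 2)) -> DefF g -> DefF h -> DefF j ->
  Def (fun e => R (g e) (h e) (j e)).
Proof.
  intros HR Hg Hh Hj.
  apply (Def_let (fun a e => R a (h e) (j e))); [|auto].
  apply (Def_let (fun b e => R (e 0) b (j (fun i => e (S i))))); [|apply (DefF_subst S Hh)].
  apply (Def_let (fun d e => R (e 1) (e 0) d)); [|apply (DefF_subst (fun i => S (S i)) Hj)].
  apply (Def_subst (fun i => match i with 0 => 2 | 1 => 1 | _ => 0 end) HR).
Qed.

Lemma DefF_fun3 (f : V -> V -> V -> V) g h j :
  DefF (fun e => f (e 0) (e 1) (e 2)) -> DefF g -> DefF h -> DefF j ->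
  DefF (fun e => f (g e) (h e) (j e)).
Proof.
  intros Hf Hg Hh Hj.
  apply (Def_let (fun a e => e 0 = f a (h (fun i => e (S i))) (j (fun i => e (S i)))));
    [|apply (DefF_subst S Hg)].
  apply (Def_let (fun b e => e 1 = f (e 0) b (j (fun i => e (S (S i))))));
    [|apply (DefF_subst (fun i => S (S i)) Hh)].
  apply (Def_let (fun d e => e 2 = f (e 1) (e 0) d));
    [|apply (DefF_subst (fun i => S (S (S i))) Hj)].
  apply (Def_subst (fun i => match i with 0 => 3 | 1 => 2 | 2 => 1 | _ => 0 end) Hf).
Qed.

Definition the (P : V -> Prop) : V := epsilon (dom_inhabited V) P.

Lemma the_spec (P : V -> Prop) : (exists x, P x) -> P (the P).
Proof. apply epsilon_spec. Qed.

End Definability.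

Ltac splits := repeat match goal with |- _ /\ _ => split end.

Create HintDb defi discriminated.
#[global] Hint Constants Opaque : defi.
#[global] Hint Resolve DefF_cst DefF_var : defi.

(** A hook, redefined once the terms [setof] and [csetof] are available. *)
Ltac defi_comprehension := fail.

Ltac defi := cbv beta; lazymatch goal with
  | |- @DefF _ _ => first
      [ solve [auto 50 with defi nocore]
      | defi_comprehension; defi
      | idtac ]
  | |- @Def _ _ => first
      [ apply Def_cst
      | solve [auto 50 with defi nocore]
      | first [ apply Def_in | apply Def_notin | apply Def_eq | apply Def_equiv | apply Def_and
              | apply Def_or | apply Def_not | apply Def_imp | apply Def_ex | apply Def_all ]; defi
      | idtac ]
  | |- _ => idtac
  end.

(** * Consequences of the axioms *)

Section Universe.
Context {V : universe}.
Implicit Types (e : nat -> V) (x y z u v w a b : V).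

Lemma PZFC_at {A : fm} e : PZFC (sentence A) -> truth V e (A 0).
Proof. intros H; exact (PZFC_holds V H e). Qed.

Lemma extensionality x y :
  (forall z, z ∊ x <-> z ∊ y) -> (forall z, z ∉- x <-> z ∉- y) -> x = y.
Proof.
  intros H K; pose proof (PZFC_at (fun _ => x) PZFC_extensionality) as X.
  cbn in X; destruct (X x y) as [[_ X1] _]; apply X1; intros z.
  specialize (H z); specialize (K z); tauto.
Qed.

(** The falsity half of the strong equivalence in Extensionality: [z ∈ x ⇔ z ∈ y] is false iff [z]
    is a positive member of one set and a negative member of the other. In particular a set with a
    glut is unequal to itself. *)
Lemma eq_neg_iff x y :
  eq_neg V x y <-> exists z, (z ∊ x /\ z ∉- y) \/ (z ∊ y /\ z ∉- x).
Proof.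
  pose proof (PZFC_at (fun _ => x) PZFC_extensionality) as X.
  cbn in X; destruct (X x y) as [_ [X1 X2]]; split.
  - intros H; destruct (X1 H) as [z K]; exists z; tauto.
  - intros [z K]; apply X2; exists z; tauto.
Qed.

Lemma comprehension (p : form) e u : exists x, forall y,
  (y ∊ x <-> y ∊ u /\ truth V (scons y e) p) /\
  (y ∉- x <-> y ∉- u \/ falsity V (scons y e) p).
Proof.
  pose proof (PZFC_at e (PZFC_comprehension p) u) as [x X]; exists x; intros y.
  specialize (X y); cbn in X; revert X.
  rewrite (proj1 (truth_rename V p _ _)), (proj2 (truth_rename V p _ _)).
  replace (fun i => scons y (scons x (scons u e)) (scons 0 (fun j => S (S (S j))) i))
    with (scons y e) by (apply functional_extensionality; now intros [|i]).
  tauto.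
Qed.

(** The notion [classical] of the object language, by [tr_classical]. *)
Definition crisp x : Prop := forall y, y ∉- x <-> ~ y ∊ x.

(** By the last clause the gaps of [x] lie in [C] as well, which makes crisp supersets suitable
    bounds for four-valued sets. *)
Lemma superset x : exists C, crisp C /\ (forall z, z ∊ x -> z ∊ C) /\
  (forall z, ~ z ∊ C -> z ∉- x).
Proof.
  pose proof (PZFC_at (fun _ => x) PZFC_superset) as X; cbn in X.
  destruct (X x) as [C [H K]]; exists C.
  assert (CC : crisp C) by (intros y; specialize (K y); tauto).
  split; [easy|split]; intros z; [apply H|].
  intros Z; apply H, CC, Z.
Qed.

Lemma sep_exists (P : V -> Prop) u : Def (fun e => P (e 0)) -> (forall z, P z -> z ∊ u) ->
  exists x, forall z, (z ∊ x <-> P z) /\ (z ∉- x <-> ~ P z).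
Proof.
  intros [p [c H]] B; destruct (superset u) as [C [CC [S1 _]]].
  (* [!p] is false wherever it is not true, and [C] is crisp, so the separated set has neither gluts
     nor gaps. *)
  destruct (comprehension (FNot (FImp (rename (split_index (fun i => 0) S) p) FBot)) c C)
    as [x X]; exists x; intros z; destruct (X z) as [X1 X2]; clear X.
  assert (K : truth V (scons z c) (rename (split_index (fun i => 0) S) p) <-> P z).
  { rewrite (@truth_rename_mix _ p _ _ (fun _ => z) c); auto; apply (H (fun _ => z)). }
  cbn in X1, X2; rewrite X1, X2, K, (CC z); specialize (B z); specialize (S1 z); tauto.
Qed.

(** Comprehension inherits the negative members of the set it starts from. Starting from a crisp
    superset of [u], these are just the non-members, and [Q] holds there anyway. *)
Lemma fsep_exists (P Q : V -> Prop) (p : form) e u :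
  (forall z, truth V (scons z e) p <-> P z) -> (forall z, falsity V (scons z e) p <-> Q z) ->
  (forall z, P z -> z ∊ u) -> (forall z, ~ z ∊ u -> Q z) ->
  exists x, forall z, (z ∊ x <-> P z) /\ (z ∉- x <-> Q z).
Proof.
  intros HP HQ BP BQ; destruct (superset u) as [C [CC [S1 _]]].
  destruct (comprehension p e C) as [x X]; exists x; intros z.
  destruct (X z) as [X1 X2]; rewrite X1, X2, HP, HQ, (CC z).
  specialize (BP z); specialize (BQ z); specialize (S1 z).
  destruct (classic (z ∊ u)); destruct (classic (z ∊ C)); tauto.
Qed.

Lemma empty_exists : exists x, forall z, (z ∊ x <-> False) /\ (z ∉- x <-> True).
Proof.
  destruct (dom_inhabited V) as [a].
  destruct (comprehension FBot (fun _ => a) a) as [x X]; exists x; intros z.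
  destruct (X z) as [X1 X2]; cbn in X1, X2; tauto.
Qed.

Definition has_members (P Q : V -> Prop) x : Prop :=
  forall z, (z ∊ x <-> P z) /\ (z ∉- x <-> Q z).

(* Junk value: the empty set when there is no such set. *)
Definition setof (P Q : V -> Prop) : V :=
  the (fun x => has_members P Q x \/
    ((~ exists y, has_members P Q y) /\ has_members (fun _ => False) (fun _ => True) x)).
Definition csetof (P : V -> Prop) : V := setof P (fun z => ~ P z).
Definition emp : V := csetof (fun _ => False).

Lemma setof_or_junk P Q : has_members P Q (setof P Q) \/
  ((~ exists y, has_members P Q y) /\ has_members (fun _ => False) (fun _ => True) (setof P Q)).
Proof.
  apply (the_spec (fun x => has_members P Q x \/
    ((~ exists y, has_members P Q y) /\ has_members (fun _ => False) (fun _ => True) x))).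
  destruct (classic (exists y, has_members P Q y)) as [[y H]|H]; [exists y; auto|].
  destruct empty_exists as [y Y]; exists y; auto.
Qed.

Lemma setof_spec P Q : (exists x, has_members P Q x) -> has_members P Q (setof P Q).
Proof. intros H; destruct (setof_or_junk P Q); tauto. Qed.

Lemma has_members_unique P Q x y : has_members P Q x -> has_members P Q y -> x = y.
Proof.
  intros H K; apply extensionality; intros z; destruct (H z), (K z); tauto.
Qed.

Lemma setof_unique P Q x : has_members P Q x -> setof P Q = x.
Proof. intros H; apply has_members_unique with P Q; [apply setof_spec; eauto|auto]. Qed.

Definition bounded (P : V -> Prop) : Prop := exists u, forall z, P z -> z ∊ u.

Lemma csetof_spec P : Def (fun e => P (e 0)) -> bounded P ->
  forall z, (z ∊ csetof P <-> P z) /\ (z ∉- csetof P <-> ~ P z).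
Proof.
  intros D [u B]; apply (@setof_spec P (fun z => ~ P z)).
  apply (@sep_exists P u D B).
Qed.

(** Although [setof] is chosen by ε, its graph is definable: extensionality determines the value in
    either alternative of its specification. *)
Lemma DefF_setof (P Q : V -> (nat -> V) -> Prop) :
  Def (fun e => P (e 0) (fun i => e (S i))) -> Def (fun e => Q (e 0) (fun i => e (S i))) ->
  DefF (fun e => setof (fun z => P z e) (fun z => Q z e)).
Proof.
  intros HP HQ; unfold DefF.
  apply Def_iff with (fun e =>
    has_members (fun z => P z (fun i => e (S i))) (fun z => Q z (fun i => e (S i))) (e 0) \/
    ((~ exists y, has_members (fun z => P z (fun i => e (S i)))
        (fun z => Q z (fun i => e (S i))) y) /\
     has_members (fun _ => False) (fun _ => True) (e 0))).
  - intros e.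
    set (R := fun z => P z (fun i => e (S i))); set (R' := fun z => Q z (fun i => e (S i))).
    split.
    + intros H; destruct (setof_or_junk R R') as [K|[K K']].
      * destruct H as [H|[H _]]; [now apply has_members_unique with R R'|].
        destruct H; eauto.
      * destruct H as [H|[_ H]]; [destruct K; eauto|].
        now apply has_members_unique with (fun _ => False) (fun _ => True).
    + intros ->; apply setof_or_junk.
  - assert (A : forall k l, Def (fun e => P (e k) (fun i => e (l + i)))).
    { intros k l; apply (Def_subst (fun i => match i with 0 => k | S j => l + j end) HP). }
    assert (B : forall k l, Def (fun e => Q (e k) (fun i => e (l + i)))).
    { intros k l; apply (Def_subst (fun i => match i with 0 => k | S j => l + j end) HQ). }
    unfold has_members; apply Def_or; [|apply Def_and].
    (* The environment of [P] and [Q] starts behind the member and the set, at 2; in the next case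
       also behind [y], at 3. *)
    + defi; first [apply (A 0 2)|apply (B 0 2)].
    + apply Def_not; defi; first [apply (A 0 3)|apply (B 0 3)].
    + defi.
Qed.

Lemma DefF_csetof (P : V -> (nat -> V) -> Prop) :
  Def (fun e => P (e 0) (fun i => e (S i))) ->
  DefF (fun e => csetof (fun z => P z e)).
Proof.
  intros H; apply (DefF_setof P (fun z e => ~ P z e)); [|apply Def_not]; auto.
Qed.

Lemma crisp_csetof P : Def (fun e => P (e 0)) -> bounded P -> crisp (csetof P).
Proof. intros D B z; destruct (csetof_spec D B z); tauto. Qed.

Lemma emp_spec z : (z ∊ emp <-> False) /\ (z ∉- emp <-> True).
Proof.
  destruct (@csetof_spec (fun _ => False)) with z as [H K].
  - apply Def_cst.
  - exists emp; tauto.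
  - unfold emp; tauto.
Qed.

Lemma crisp_ext x y : crisp x -> crisp y -> (forall z, z ∊ x <-> z ∊ y) -> x = y.
Proof. intros X Y H; apply extensionality; intros z; [auto|]; now rewrite (X z), (Y z), H. Qed.

Lemma bounded_sub (P Q : V -> Prop) : (forall z, P z -> Q z) -> bounded Q -> bounded P.
Proof. intros H [u B]; exists u; auto. Qed.

Lemma bounded_set u : bounded (fun z => z ∊ u).
Proof. now exists u. Qed.

Lemma pairing a b : exists x, forall y, (y ∊ x <-> y = a \/ y = b) /\ (y ∉- x <-> ~ (y = a \/ y = b)).
Proof.
  pose proof (PZFC_at (fun _ => a) PZFC_pairing) as X; cbn in X.
  destruct (X a b) as [x H]; exists x; intros y; specialize (H y); tauto.
Qed.

Definition pr a b : V := csetof (fun y => y = a \/ y = b).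

Lemma pr_spec a b y : (y ∊ pr a b <-> y = a \/ y = b) /\ (y ∉- pr a b <-> ~ (y = a \/ y = b)).
Proof. apply (@setof_spec (fun y => y = a \/ y = b)), pairing. Qed.

Lemma bounded_or (P Q : V -> Prop) : bounded P -> bounded Q -> bounded (fun z => P z \/ Q z).
Proof.
  intros [u B] [v C].
  pose proof (PZFC_at (fun _ => u) PZFC_union) as X; cbn in X.
  destruct (X (pr u v)) as [x H]; exists x; intros z D; apply (H z).
  destruct D as [D|D]; [exists u|exists v]; split; auto; apply pr_spec; auto.
Qed.

Lemma bounded_eq a : bounded (fun z => z = a).
Proof. exists (pr a a); intros z ->; apply pr_spec; auto. Qed.

Lemma bounded_union (P : V -> Prop) : bounded P -> bounded (fun z => exists x, P x /\ z ∊ x).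
Proof.
  intros [u B]; pose proof (PZFC_at (fun _ => u) PZFC_union) as X; cbn in X.
  destruct (X u) as [y H]; exists y; intros z [x [K L]]; apply (H z); eauto.
Qed.

Lemma bounded_pow u : crisp u -> bounded (fun x => forall z, (z ∊ x -> z ∊ u) /\ (~ z ∊ u -> z ∉- x)).
Proof.
  intros C; pose proof (PZFC_at (fun _ => u) PZFC_power) as X; cbn in X.
  destruct (X u) as [v H]; exists v; intros x K; destruct (H x) as [[_ H1] _]; apply H1.
  split; [|easy]; intros z; specialize (C z); specialize (K z); tauto.
Qed.

Lemma bounded_img (G : V -> V) (P : V -> Prop) : DefF (fun e => G (e 0)) -> bounded P ->
  bounded (fun z => exists x, P x /\ z = G x).
Proof.
  intros [p [c H]] [u B].
  (* Replacement demands a classical formula, hence the [!]. Index 0 becomes the argument and index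
     1 the value, in the order of [inst2]. *)
  pose (q := FNot (FImp (rename (split_index (fun i => match i with 0 => 1 | _ => 0 end)
    (fun i => S (S i))) p) FBot)).
  assert (K : forall x y, truth V (scons x (scons y c)) q <-> y = G x).
  { intros x y; cbn; rewrite (@truth_rename_mix _ p _ _ (scons y (fun _ => x)) c).
    - rewrite (H (scons y (fun _ => x))); cbn; tauto.
    - now intros [|i].
    - now intros i. }
  assert (R : forall e r x y, (forall i, e (r i) = scons x (scons y c) i) ->
    (truth V e (rename r q) <-> y = G x) /\ (falsity V e (rename r q) <-> y <> G x)).
  { intros e r x y A; destruct (truth_rename V q r e) as [-> ->].
    replace (fun i => e (r i)) with (scons x (scons y c))
      by (apply functional_extensionality; auto).
    rewrite <- (K x y); cbn; tauto. }
  clearbody q; pose proof (PZFC_at c (PZFC_replacement q)) as X; cbn in X.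
  destruct X with u as [v Y].
  - split.
    + intros x y; destruct (R (scons y (scons x c)) (scons 1 (scons 0 (fun j => S (S j)))) x y)
        as [-> ->]; [now intros [|[|i]]|tauto].
    + intros x; exists (G x).
      destruct (R (scons (G x) (scons x c)) (scons 1 (scons 0 (fun j => S (S j)))) x (G x))
        as [-> _]; [now intros [|[|i]]|split; [easy|]].
      intros y; destruct (R (scons y (scons (G x) (scons x c)))
        (scons 2 (scons 0 (fun j => S (S (S j))))) x y) as [-> _]; [now intros [|[|i]]|auto].
  - exists v; intros z [x [Hx ->]]; apply Y; exists x; split; [auto|].
    apply (R (scons x (scons (G x) (scons v (scons u c))))
      (scons 0 (scons 1 (fun j => S (S (S (S j)))))) x (G x)); [now intros [|[|i]]|auto].
Qed.

(** Replacement handles one argument: for each [x] the values [G x y] form a set [I x], a second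
    replacement collects these sets, and Union flattens the result. *)
Lemma bounded_img2 (G : V -> V -> V) (P Q : V -> Prop) : DefF (fun e => G (e 0) (e 1)) ->
  bounded P -> bounded Q -> bounded (fun z => exists x y, P x /\ Q y /\ z = G x y).
Proof.
  intros D BP [v B].
  assert (D' : forall x, DefF (fun e => G x (e 0))).
  { intros x; apply (@DefF_fun2 V G (fun _ => x)); [exact D|apply DefF_cst|apply DefF_var]. }
  pose (I := fun x => csetof (fun z => exists y, y ∊ v /\ z = G x y)).
  assert (HI : forall x z, z ∊ I x <-> exists y, y ∊ v /\ z = G x y).
  { intros x z; apply csetof_spec.
    - defi; apply D'.
    - apply bounded_img; [apply D'|apply bounded_set]. }
  apply bounded_sub with (fun z => exists w, (exists x, P x /\ w = I x) /\ z ∊ w).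
  - intros z (x & y & Hx & Hy & ->); exists (I x); split; [eauto|apply HI; eauto].
  - apply bounded_union, bounded_img; [|auto].
    apply (DefF_csetof (fun z e => exists y, y ∊ v /\ z = G (e 0) y)); defi.
    apply (@DefF_fun2 V G); defi.
Qed.

Definition un x y : V := setof (fun z => z ∊ x \/ z ∊ y) (fun z => z ∉- x /\ z ∉- y).

Lemma un_exists x y :
  exists w, has_members (fun z => z ∊ x \/ z ∊ y) (fun z => z ∉- x /\ z ∉- y) w.
Proof.
  pose proof (PZFC_at (fun _ => x) PZFC_union) as X; cbn in X.
  destruct (X (pr x y)) as [w H]; exists w; intros z; destruct (H z) as [[H1 H2] [H3 H4]].
  split; split.
  - intros K; destruct (H1 K) as [v [A B]]; apply pr_spec in B; destruct B; subst; auto.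
  - intros [K|K]; apply H2; [exists x|exists y]; split; auto; apply pr_spec; auto.
  - intros K; specialize (H3 K); split; [specialize (H3 x)|specialize (H3 y)];
      destruct H3 as [H3|H3]; auto; apply pr_spec in H3; tauto.
  - intros [A B]; apply H4; intros v.
    destruct (classic (v = x \/ v = y)) as [[->| ->]|K]; auto.
    right; now apply pr_spec.
Qed.

End Universe.

Ltac defi_comprehension ::= first [apply DefF_csetof | apply DefF_setof].

(** * Denotations of class terms *)

Section Sets.
Context {V : universe}.
Implicit Types (e : nat -> V) (x y z u v w a b c d f g i n s : V).

(** [described] turns a class term into an existential over sets [a] guarded by [!(a = t)]. By
    extensionality the guard is true for [a = x] and false for every other [a], so the existential
    has both the truth and the falsity of its body at [x]. *)
Lemma mem_den k e t t' x (P Q : V -> Prop) : den k e t x -> cdn k e t' P Q ->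
  tr k e (mem t t') (P x) /\ fa k e (mem t t') (Q x).
Proof.
  destruct t as [j|h]; intros D C.
  - destruct D as [L <-]; apply (C k e j (extends_refl _ _) L).
  - assert (K : forall a, tr (S k) (scons a e) (fall (fun y : trm => match y with
        | Var j => fsiff (fun m => FIn (m - S j) (m - S k)) (h j) | Cls _ => fbot end))
        (a = x)).
    { intros a.
      apply tr_iff with (forall z, (z ∊ a <-> z ∊ x) /\ (z ∉- a <-> z ∉- x)).
      { split; [intros H; apply extensionality; intros z; apply H|intros ->; tauto]. }
      apply tr_all; intros b.
      assert (E : extends k e (S (S k)) (scons b (scons a e))) by now exists 2.
      destruct (D _ _ (S k) E) as [D1 D2]; [lia|].
      cbn [mem described] in D1, D2; rewrite Nat.sub_diag in D1, D2; cbn [scons] in D1, D2.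
      apply tr_siff; [..|exact D2]; [| |exact D1];
        unfold tr, fa; cbn [truth falsity]; rewrite Nat.sub_diag;
        replace (S (S k) - S k) with 1 by lia; cbn [scons]; tauto. }
    assert (E : forall a, tr (S k) (scons a e) (mem (Var k) t') (P a) /\
      fa (S k) (scons a e) (mem (Var k) t') (Q a)).
    { intros a; destruct (C _ _ k (extends_scons _ _ a)) as [C1 C2]; [lia|].
      rewrite Nat.sub_diag in C1, C2; auto. }
    split; split.
    + intros [a [H1 H2]]; apply (tr_bang (K a)) in H1; subst; now apply E.
    + intros H; exists x; split; [now apply (tr_bang (K x))|now apply E].
    + intros H; destruct (H x) as [A|A]; [now apply (fa_bang (K x)) in A|now apply E].
    + intros H a; destruct (classic (a = x)) as [->|N]; [right; now apply E|left].
      now apply (fa_bang (K a)).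
Qed.

Lemma tr_mem k e t t' x (P Q : V -> Prop) :
  den k e t x -> cdn k e t' P Q -> tr k e (mem t t') (P x).
Proof. intros D C; apply (mem_den _ _ D C). Qed.

Lemma fa_mem k e t t' x (P Q : V -> Prop) :
  den k e t x -> cdn k e t' P Q -> fa k e (mem t t') (Q x).
Proof. intros D C; apply (mem_den _ _ D C). Qed.

Lemma tr_eqt k e t t' x y : den k e t x -> den k e t' y -> tr k e (eqt t t') (x = y).
Proof.
  assert (G : den k e t x -> den k e t' y ->
    tr k e (fall (fun z : trm => fsiff (mem z t) (mem z t'))) (x = y)).
  { intros D D'.
    apply tr_iff with (forall z, (z ∊ x <-> z ∊ y) /\ (z ∉- x <-> z ∉- y)).
    { split; [intros H; apply extensionality; intros z; apply H|intros ->; tauto]. }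
    apply tr_all; intros b.
    pose proof (den_var k e b) as B.
    assert (C : cdn (S k) (scons b e) t (fun z => z ∊ x) (fun z => z ∉- x))
      by (apply den_cdn, den_scons, D).
    assert (C' : cdn (S k) (scons b e) t' (fun z => z ∊ y) (fun z => z ∉- y))
      by (apply den_cdn, den_scons, D').
    apply tr_siff; [eapply (tr_mem _ _ B C)|eapply (fa_mem _ _ B C)|
      eapply (tr_mem _ _ B C')|eapply (fa_mem _ _ B C')]. }
  destruct t as [j|h], t' as [j'|h']; auto.
  intros [L <-] [L' <-]; unfold tr; cbn; tauto.
Qed.

(** Serves for class terms not known to form a set. Two variables are excluded because their
    equation is atomic. *)
Lemma tr_eqt_cdn k e t t' (P Q P' Q' : V -> Prop) :
  match t, t' with Var _, Var _ => False | _, _ => True end ->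
  cdn k e t P Q -> cdn k e t' P' Q' ->
  tr k e (eqt t t') (forall z, (P z <-> P' z) /\ (Q z <-> Q' z)).
Proof.
  intros N C C'.
  assert (G : tr k e (fall (fun z : trm => fsiff (mem z t) (mem z t')))
    (forall z, (P z <-> P' z) /\ (Q z <-> Q' z))).
  { apply tr_all; intros b.
    pose proof (den_var k e b) as B.
    pose proof (cdn_extends (extends_scons _ _ b) C) as D;
    pose proof (cdn_extends (extends_scons _ _ b) C') as D'.
    apply tr_siff; [eapply (tr_mem _ _ B D)|eapply (fa_mem _ _ B D)|
      eapply (tr_mem _ _ B D')|eapply (fa_mem _ _ B D')]. }
  destruct t, t'; tauto.
Qed.

Lemma fa_eqt_var k e j j' x y : den k e (Var j) x -> den k e (Var j') y ->
  fa k e (eqt (Var j) (Var j')) (eq_neg V x y).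
Proof. intros [L <-] [L' <-]; unfold fa; cbn; tauto. Qed.

Lemma tr_conv k e A (T T' : Prop) : tr (V := V) k e A T -> T = T' -> tr k e A T'.
Proof. now intros H <-. Qed.

Lemma fa_conv k e A (T T' : Prop) : fa (V := V) k e A T -> T = T' -> fa k e A T'.
Proof. now intros H <-. Qed.

(** Comprehension needs a single formula with truth condition [P] and falsity condition [Q];
    membership in the class term [t] is such a formula. *)
Lemma cdn_setof k e t (P Q : V -> Prop) : cdn k e t P Q ->
  (exists u, (forall z, P z -> z ∊ u) /\ (forall z, ~ z ∊ u -> Q z)) ->
  has_members P Q (setof P Q).
Proof.
  intros C [u [BP BQ]]; apply setof_spec.
  assert (H : forall z, tr (S k) (scons z e) (mem (Var k) t) (P z) /\
    fa (S k) (scons z e) (mem (Var k) t) (Q z)).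
  { intros z; destruct (C _ _ k (extends_scons _ _ z)) as [C1 C2]; [lia|].
    rewrite Nat.sub_diag in C1, C2; auto. }
  apply (@fsep_exists V P Q (mem (Var k) t (S k)) e u); auto; intros z; apply H.
Qed.

End Sets.

(* Automated evaluation of formulas *)
Create HintDb den discriminated.
#[global] Hint Constants Opaque : den.
#[global] Hint Resolve den_var | 0 : den.
#[global] Hint Resolve den_scons cdn_scons | 2 : den.
#[global] Hint Extern 3 (den _ _ _ _) => eapply den_extends; [eassumption|] : den.
#[global] Hint Extern 3 (cdn _ _ _ _ _) => eapply cdn_extends; [eassumption|] : den.
#[global] Hint Resolve den_cdn | 4 : den.
Ltac den := solve [eauto 200 with den nocore].

(** The last argument of a goal is usually unknown and gets filled in by the lemmas on connectives.
    Equations are tried first with a denotation for each side, then coextensionally. *)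
Ltac sem := cbv beta; lazymatch goal with
  | |- tr _ _ (fall _) _ => eapply tr_all; intros ?; sem
  | |- fa _ _ (fall _) _ => eapply fa_all; intros ?; sem
  | |- tr _ _ (fex _) _ => eapply tr_ex; intros ?; sem
  | |- fa _ _ (fex _) _ => eapply fa_ex; intros ?; sem
  | |- tr _ _ (fconj _ _) _ => eapply tr_conj; [sem|intros ?; sem]
  | |- fa _ _ (fconj _ _) _ => eapply fa_conj; sem
  | |- tr _ _ (fdisj _ _) _ => eapply tr_disj; sem
  | |- fa _ _ (fdisj _ _) _ => eapply fa_disj; sem
  | |- tr _ _ (fimp _ _) _ => eapply tr_imp; [sem|intros ?; sem]
  | |- fa _ _ (fimp _ _) _ => eapply fa_imp; [sem|intros ?; sem]
  | |- tr _ _ (fiff _ _) _ => eapply tr_fiff; sem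
  | |- tr _ _ (fsiff _ _) _ => eapply tr_siff; sem
  | |- fa _ _ (fsiff _ _) _ => eapply fa_siff; sem
  | |- tr _ _ (fsimp _ _) _ => eapply tr_simp; sem
  | |- fa _ _ (fsimp _ _) _ => eapply fa_simp; sem
  | |- tr _ _ (fnot _) _ => eapply tr_not; sem
  | |- fa _ _ (fnot _) _ => eapply fa_not; sem
  | |- tr _ _ (fneg _) _ => eapply tr_neg; sem
  | |- fa _ _ (fneg _) _ => eapply fa_neg; sem
  | |- tr _ _ (bang _) _ => eapply tr_bang; sem
  | |- fa _ _ (bang _) _ => eapply fa_bang; sem
  | |- tr _ _ (quest _) _ => eapply tr_quest; sem
  | |- fa _ _ (quest _) _ => eapply fa_quest; sem
  | |- tr _ _ fbot _ => apply tr_bot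
  | |- fa _ _ fbot _ => apply fa_bot
  | |- tr _ _ ftop _ => apply tr_top
  | |- tr _ _ (mem _ _) _ => eapply tr_conv; [eapply tr_mem; [den|den]|cbv beta; reflexivity]
  | |- fa _ _ (mem _ _) _ => eapply fa_conv; [eapply fa_mem; [den|den]|cbv beta; reflexivity]
  | |- tr _ _ (eqt _ _) _ => first
      [ eapply tr_conv; [eapply tr_eqt; [den|den]|reflexivity]
      | eapply tr_conv; [eapply tr_eqt_cdn; [exact I|den|den]|cbv beta; reflexivity] ]
  | |- fa _ _ (eqt (Var _) (Var _)) _ => eapply fa_conv; [eapply fa_eqt_var; [den|den]|reflexivity]
  | |- _ => eauto 200 with den nocore
  end.

(** * Pairs, functions and ω *)

Section Terms.
Context {V : universe}.
Implicit Types (k : nat) (e : nat -> V) (t : trm) (x y z u v w a b c d f g i n s : V).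

Lemma den_class k e t (P Q : V -> Prop) x : has_members P Q x ->
  match t with Var _ => False | Cls _ => True end -> cdn k e t P Q -> den k e t x.
Proof.
  intros S; destruct t; [easy|]; intros _; apply cdn_iff; intros z; destruct (S z); tauto.
Qed.

Lemma cdn_bang_set k e t x : den k e t x ->
  cdn k e (bang_set t) (fun z => z ∊ x) (fun z => ~ z ∊ x).
Proof. intros D; apply cdn_cls; intros; sem. Qed.

Lemma cdn_quest_set k e t x : den k e t x ->
  cdn k e (quest_set t) (fun z => ~ z ∉- x) (fun z => z ∉- x).
Proof. intros D; apply cdn_cls; intros; sem. Qed.

Lemma cdn_union k e t t' (P Q P' Q' : V -> Prop) : cdn k e t P Q -> cdn k e t' P' Q' ->
  cdn k e (union t t') (fun z => P z \/ P' z) (fun z => Q z /\ Q' z).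
Proof. intros D D'; apply cdn_cls; intros; sem. Qed.

Lemma cdn_inter k e t t' (P Q P' Q' : V -> Prop) : cdn k e t P Q -> cdn k e t' P' Q' ->
  cdn k e (inter t t') (fun z => P z /\ P' z) (fun z => Q z \/ Q' z).
Proof. intros D D'; apply cdn_cls; intros; sem. Qed.
Hint Resolve cdn_bang_set cdn_quest_set cdn_union cdn_inter : den.

Lemma tr_classical k e t x : den k e t x -> tr k e (classical t) (crisp x).
Proof.
  intros D; apply tr_iff with (forall z, z ∊ x <-> ~ z ∉- x).
  - unfold crisp; split; intros H z; specialize (H z); tauto.
  - unfold classical; sem.
Qed.

Lemma tr_subset k e t t' (P Q P' Q' : V -> Prop) : cdn k e t P Q -> cdn k e t' P' Q' ->
  tr k e (subset t t') (forall z, (P z -> P' z) /\ (Q' z -> Q z)).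
Proof. intros C C'; unfold subset; sem. Qed.

Lemma has_members_emp : has_members (fun _ => False) (fun _ => True) (@emp V).
Proof. intros z; apply emp_spec. Qed.

Lemma den_emp k e : den k e empty emp.
Proof. apply (den_class (t := empty) has_members_emp I), cdn_cls; intros; sem. Qed.

Lemma den_sing k e t x : den k e t x -> den k e (sing t) (pr x x).
Proof.
  intros D; apply den_class with (fun z => z = x) (fun z => z <> x); [|exact I|].
  - intros z; destruct (pr_spec x x z); tauto.
  - apply cdn_cls; intros; sem.
Qed.

Lemma den_upair k e t t' x y : den k e t x -> den k e t' y -> den k e (upair t t') (pr x y).
Proof.
  intros D D'; apply den_class with (fun z => z = x \/ z = y) (fun z => z <> x /\ z <> y); [|exact I|].
  - intros z; destruct (pr_spec x y z); tauto.
  - apply cdn_cls; intros; sem.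
Qed.

Definition kp a b : V := pr (pr a a) (pr a b).

Lemma den_kpair k e t t' x y : den k e t x -> den k e t' y -> den k e (kpair t t') (kp x y).
Proof. intros D D'; apply den_upair; [apply den_sing|apply den_upair]; auto. Qed.

Lemma pr_in a b y : y ∊ pr a b <-> y = a \/ y = b.
Proof. apply pr_spec. Qed.

Lemma crisp_pr a b : crisp (pr a b).
Proof. intros z; destruct (pr_spec a b z) as [-> ->]; tauto. Qed.

Lemma kp_inj a b c d : kp a b = kp c d -> a = c /\ b = d.
Proof.
  unfold kp; intros H.
  assert (M : forall x y z w, pr x y = pr z w -> z = x \/ z = y).
  { intros x y z w E; rewrite <- pr_in, E, pr_in; auto. }
  assert (A : a = c).
  { assert (K : pr a a ∊ pr (pr c c) (pr c d)) by (rewrite <- H, pr_in; auto).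
    apply pr_in in K; destruct K as [K|K]; apply M in K; destruct K; auto. }
  subst c; split; [auto|].
  assert (K : pr a b ∊ pr (pr a a) (pr a d)) by (rewrite <- H, pr_in; auto).
  assert (L : pr a d ∊ pr (pr a a) (pr a b)) by (rewrite H, pr_in; auto).
  apply pr_in in K; apply pr_in in L.
  assert (B : b = a \/ b = d) by (destruct K as [K|K]; [left|]; [
    assert (X : b ∊ pr a a) by (rewrite <- K, pr_in; auto); apply pr_in in X; tauto|
    assert (X : b ∊ pr a d) by (rewrite <- K, pr_in; auto); apply pr_in in X; auto]).
  assert (D : d = a \/ d = b) by (destruct L as [L|L]; [left|]; [
    assert (X : d ∊ pr a a) by (rewrite <- L, pr_in; auto); apply pr_in in X; tauto|
    assert (X : d ∊ pr a b) by (rewrite <- L, pr_in; auto); apply pr_in in X; auto]).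
  destruct B, D; congruence.
Qed.

Lemma un_spec x y z : (z ∊ un x y <-> z ∊ x \/ z ∊ y) /\ (z ∉- un x y <-> z ∉- x /\ z ∉- y).
Proof. apply (@setof_spec V (fun z => z ∊ x \/ z ∊ y)), un_exists. Qed.

Lemma den_union k e t t' x y : den k e t x -> den k e t' y -> den k e (union t t') (un x y).
Proof.
  intros D D'; apply den_class with (fun z => z ∊ x \/ z ∊ y) (fun z => z ∉- x /\ z ∉- y); [|exact I|].
  - intros z; apply un_spec.
  - apply cdn_union; den.
Qed.

Definition suc x : V := un x (pr x x).

Lemma suc_in x z : z ∊ suc x <-> z ∊ x \/ z = x.
Proof. unfold suc; rewrite (proj1 (un_spec _ _ _)), pr_in; tauto. Qed.

Fixpoint nm j : V := match j with 0 => emp | S i => suc (nm i) end.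

Lemma den_num k e j : den k e (num j) (nm j).
Proof. induction j; [apply den_emp|cbn]. apply den_union; [|apply den_sing]; auto. Qed.

End Terms.
#[global] Hint Resolve cdn_bang_set cdn_quest_set cdn_union cdn_inter den_emp den_sing den_upair
  den_kpair den_num : den.
#[global] Hint Resolve den_union | 1 : den.

Section Definability.
Context {V : universe}.
Implicit Types (g h : (nat -> V) -> V).

Lemma DefF_pr g h : DefF g -> DefF h -> DefF (fun e => pr (g e) (h e)).
Proof. apply (@DefF_fun2 V pr); unfold pr; defi. Qed.

Lemma DefF_un g h : DefF g -> DefF h -> DefF (fun e => un (g e) (h e)).
Proof. apply (@DefF_fun2 V un); unfold un; defi. Qed.
Hint Resolve DefF_pr DefF_un : defi.

Lemma DefF_kp g h : DefF g -> DefF h -> DefF (fun e => kp (g e) (h e)).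
Proof. intros; unfold kp; defi. Qed.

Lemma DefF_suc g : DefF g -> DefF (fun e => suc (g e)).
Proof. intros; unfold suc; defi. Qed.

Lemma Def_crisp g : DefF g -> Def (fun e => crisp (g e)).
Proof. apply (@Def_pred V (@crisp V)); unfold crisp; defi. Qed.
End Definability.
#[global] Hint Resolve DefF_pr DefF_un DefF_kp DefF_suc Def_crisp : defi.

Section Functions.
Context {V : universe}.
Implicit Types (k : nat) (e : nat -> V) (t : trm) (x y z u v w a b c d f g i n s : V).

(* The four-valued ordered pair (a,b). *)
Definition op a b : V :=
  setof (fun z => (exists x, z = kp x emp /\ x ∊ a) \/ (exists y, z = kp y (pr emp emp) /\ y ∊ b))
        (fun z => (forall x, z <> kp x emp \/ x ∉- a) /\
                  (forall y, z <> kp y (pr emp emp) \/ y ∉- b)).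

Lemma cdn_opair k e t t' a b : den k e t a -> den k e t' b ->
  cdn k e (opair t t')
    (fun z => (exists x, z = kp x emp /\ x ∊ a) \/ (exists y, z = kp y (pr emp emp) /\ y ∊ b))
    (fun z => (forall x, z <> kp x emp \/ x ∉- a) /\
              (forall y, z <> kp y (pr emp emp) \/ y ∉- b)).
Proof. intros D D'; apply cdn_cls; intros; sem. Qed.

(** A concrete environment, through which facts on class terms apply to arbitrary sets [a] and
    [b]. *)
Lemma den_open2 a b (c : V) : den 2 (scons b (scons a (fun _ => c))) (Var 0) a /\
  den 2 (scons b (scons a (fun _ => c))) (Var 1) b.
Proof. cbn; auto. Qed.

Lemma op_spec a b : has_members
  (fun z => (exists x, z = kp x emp /\ x ∊ a) \/ (exists y, z = kp y (pr emp emp) /\ y ∊ b))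
  (fun z => (forall x, z <> kp x emp \/ x ∉- a) /\
            (forall y, z <> kp y (pr emp emp) \/ y ∉- b)) (op a b).
Proof.
  destruct (den_open2 a b a) as [A B].
  eapply cdn_setof; [eapply cdn_opair; [exact A|exact B]|].
  destruct (superset a) as [C [_ [CP CN]]], (superset b) as [D [_ [DP DN]]].
  destruct (@bounded_or V (fun z => exists x, x ∊ C /\ z = kp x emp)
    (fun z => exists y, y ∊ D /\ z = kp y (pr emp emp))) as [u U].
  - apply (bounded_img (fun x => kp x emp)); [defi|apply bounded_set].
  - apply (bounded_img (fun x => kp x (pr emp emp))); [defi|apply bounded_set].
  - exists u; split.
    + intros z [[x [-> X]]|[y [-> Y]]]; apply U; eauto.
    + intros z Z; split; [intros x|intros y].
      * destruct (classic (z = kp x emp)) as [->|]; auto; right; apply CN.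
        intros X; apply Z, U; eauto.
      * destruct (classic (z = kp y (pr emp emp))) as [->|]; auto; right; apply DN.
        intros X; apply Z, U; eauto.
Qed.

Lemma den_opair k e t t' a b : den k e t a -> den k e t' b -> den k e (opair t t') (op a b).
Proof. intros D D'; apply (den_class (t := opair t t') (op_spec a b) I), cdn_opair; auto. Qed.

Lemma emp_neq_one : emp <> pr emp emp :> V.
Proof. intros E; apply (emp_spec (V := V) emp); rewrite E; apply pr_in; auto. Qed.

Lemma op_left a b z : (kp z emp ∊ op a b <-> z ∊ a) /\ (kp z emp ∉- op a b <-> z ∉- a).
Proof.
  destruct (op_spec a b (kp z emp)) as [-> ->]; pose proof emp_neq_one.
  split; split.
  - intros [[x [E X]]|[y [E Y]]]; apply kp_inj in E; [|tauto]; now destruct E; subst.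
  - eauto.
  - intros [H1 _]; destruct (H1 z); tauto.
  - intros Z; split; intros x.
    + destruct (classic (z = x)) as [->|N]; auto; left; intros E; now apply kp_inj in E.
    + left; intros E; now apply kp_inj in E.
Qed.

Lemma op_right a b z :
  (kp z (pr emp emp) ∊ op a b <-> z ∊ b) /\ (kp z (pr emp emp) ∉- op a b <-> z ∉- b).
Proof.
  destruct (op_spec a b (kp z (pr emp emp))) as [-> ->]; pose proof emp_neq_one as Z0.
  split; split.
  - intros [[x [E X]]|[y [E Y]]]; apply kp_inj in E; [destruct E; congruence|].
    now destruct E; subst.
  - eauto.
  - intros [_ H1]; destruct (H1 z); tauto.
  - intros Z; split; intros x.
    + left; intros E; apply kp_inj in E; destruct E; congruence.
    + destruct (classic (z = x)) as [->|N]; auto; left; intros E; now apply kp_inj in E.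
Qed.

Lemma op_inj a b c d : op a b = op c d -> a = c /\ b = d.
Proof.
  intros H; split; apply extensionality; intros z.
  - now rewrite <- (proj1 (op_left a b z)), H, (proj1 (op_left c d z)).
  - now rewrite <- (proj2 (op_left a b z)), H, (proj2 (op_left c d z)).
  - now rewrite <- (proj1 (op_right a b z)), H, (proj1 (op_right c d z)).
  - now rewrite <- (proj2 (op_right a b z)), H, (proj2 (op_right c d z)).
Qed.
End Functions.
#[global] Hint Resolve den_opair : den.

Unset Strict Implicit.

Section Functions.
Context {V : universe}.
Implicit Types (k : nat) (e : nat -> V) (t : trm) (x y z u v w a b c d f g i n s A : V).

Lemma DefF_op (g h : (nat -> V) -> V) : DefF g -> DefF h -> DefF (fun e => op (g e) (h e)).
Proof. apply (@DefF_fun2 V op); unfold op; defi. Qed.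
Hint Resolve DefF_op : defi.

(* f(x), and the empty set when f is not defined at x *)
Definition ap f x : V := setof (fun z => exists y, op x y ∊ f /\ z ∊ y)
  (fun z => forall y, op x y ∉- f \/ z ∉- y).

Lemma DefF_ap (g h : (nat -> V) -> V) : DefF g -> DefF h -> DefF (fun e => ap (g e) (h e)).
Proof. apply (@DefF_fun2 V ap); unfold ap; defi. Qed.
Hint Resolve DefF_ap : defi.

Lemma cdn_app k e t t' f x : den k e t f -> den k e t' x ->
  cdn k e (app t t') (fun z => exists y, op x y ∊ f /\ z ∊ y)
    (fun z => forall y, op x y ∉- f \/ z ∉- y).
Proof. intros D D'; apply cdn_cls; intros; sem. Qed.

Lemma csetof_in (P : V -> Prop) : Def (fun e => P (e 0)) -> bounded P ->
  forall z, z ∊ csetof P <-> P z.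
Proof. intros D B z; apply csetof_spec; auto. Qed.

(** The four-valued pair [op x y] has the tagged elements of [y] as members, not [y] itself, so
    Union does not reach the values of [f]. Instead [G] recovers [y], with its negative members,
    from the pair, and Replacement applies to [G]. *)
Lemma bounded_values f : bounded (fun y => exists x, op x y ∊ f).
Proof.
  pose (G := fun w => setof (fun z => exists x y, w = op x y /\ z ∊ y)
    (fun z => forall x y, w <> op x y \/ z ∉- y)).
  assert (GE : forall x y, G (op x y) = y).
  { intros x y; apply setof_unique; intros z; split; split.
    - intros Z; eauto.
    - intros (x' & y' & E & Z); apply op_inj in E; destruct E; subst; auto.
    - intros Z x' y'; destruct (classic (op x y = op x' y')) as [E|E]; auto.
      apply op_inj in E; destruct E; subst; auto.
    - intros H; destruct (H x y); tauto. }
  apply bounded_sub with (fun y => exists w, w ∊ f /\ y = G w).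
  - intros y [x H]; exists (op x y); split; [auto|]; now rewrite GE.
  - apply (bounded_img G); [unfold G; defi|apply bounded_set].
Qed.

Lemma ap_spec f x : has_members (fun z => exists y, op x y ∊ f /\ z ∊ y)
  (fun z => forall y, op x y ∉- f \/ z ∉- y) (ap f x).
Proof.
  destruct (den_open2 f x f) as [F X]; eapply cdn_setof; [eapply cdn_app; [exact F|exact X]|].
  destruct (superset f) as [C [CC [CP CN]]].
  destruct (bounded_values C) as [Y HY]; destruct (superset Y) as [Y' [CY [YP YN]]].
  pose proof (PZFC_at (fun _ => f) PZFC_union) as U; cbn in U; destruct (U Y') as [u HU].
  (* For [z] outside [D]: if [y] is in [Y'], falsity of membership in the union gives [z ∉- y];
     otherwise [op x y] is outside [C], hence a negative member of [f]. *)
  destruct (superset u) as [D [CD [DP DN]]]; exists D; split.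
  - intros z [y [H Z]]; apply DP, HU; exists y; split; [auto|]; apply YP, HY; eauto.
  - intros z Z y; destruct (classic (y ∊ Y')) as [H|H].
    + apply DN in Z; destruct (HU z) as [_ [K _]]; destruct (K Z y) as [L|L]; auto.
      now apply CY in L.
    + left; apply CN; intros L; apply H, YP, HY; eauto.
Qed.

Lemma den_app k e t t' f x : den k e t f -> den k e t' x -> den k e (app t t') (ap f x).
Proof. intros D D'; apply (den_class (t := app t t') (ap_spec f x) I), cdn_app; auto. Qed.

Definition functional f : Prop := forall x y z, op x y ∊ f -> op x z ∊ f -> y = z.

Lemma ap_eq f x y : crisp f -> functional f -> op x y ∊ f -> ap f x = y.
Proof.
  intros C F H; apply setof_unique; intros z; split; split.
  - eauto.
  - intros [y' [K Z]]; now rewrite (F x y y').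
  - intros Z y'; destruct (classic (op x y' ∊ f)) as [K|K].
    + right; now rewrite (F x y' y).
    + left; now apply C.
  - intros K; destruct (K y) as [L|L]; auto; now apply C in L.
Qed.

Definition isfun f A (B : V -> Prop) : Prop :=
  crisp f /\ crisp A /\ (forall w, w ∊ f -> exists x y, w = op x y /\ x ∊ A /\ B y) /\
  (forall x, x ∊ A -> exists y, op x y ∊ f) /\ functional f.

Lemma cdn_cprod k e t t' (P Q P' Q' : V -> Prop) : cdn k e t P Q -> cdn k e t' P' Q' ->
  cdn k e (cprod t t') (fun z => exists a b, z = op a b /\ P a /\ P' b)
    (fun z => forall a b, z <> op a b \/ Q a \/ Q' b).
Proof. intros D D'; apply cdn_cls; intros; sem. Qed.

Lemma cdn_dom k e t f : den k e t f ->
  cdn k e (dom_of t) (fun x => exists y, op x y ∊ f) (fun x => forall y, op x y ∉- f).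
Proof. intros D; apply cdn_cls; intros; sem. Qed.
Hint Resolve den_app cdn_cprod cdn_dom : den.

(** The inclusion of [f] in the product is strong, so a value must be a positive and may not be a
    negative member of the target. The strong equation for the domain makes [A] as crisp as [f]. *)
Lemma tr_cfun k e t t' t'' f A (P Q : V -> Prop) :
  den k e t f -> den k e t' A -> cdn k e t'' P Q ->
  tr k e (cfun t t' t'') (isfun f A (fun b => P b /\ ~ Q b)).
Proof.
  intros D D' C; eapply tr_iff; [|unfold cfun; apply tr_conj; [|intros _; apply tr_conj;
    [|intros _; apply tr_conj; [|intros _]]]].
  2: eapply tr_classical; den.
  2: eapply tr_subset; den.
  2: eapply tr_eqt_cdn; [exact I|den|den].
  2: sem.
  unfold isfun, functional; split.
  - intros (F & S & Dm & U).
    assert (CA : crisp A).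
    { intros x; destruct (Dm x) as [<- <-]; split; [intros H [y Y]|intros H y].
      - now apply (F (op x y)).
      - apply F; intros Y; eauto. }
    split; [auto|split; [auto|split; [|split]]].
    + intros w W; destruct (S w) as [S1 S2]; destruct (S1 W) as (a & b & -> & Ha & Hb).
      exists a, b; split; [auto|split; [auto|split; [auto|]]].
      intros N; apply (F (op a b)) in W; [auto|]; apply S2; intros a' b'.
      destruct (classic (op a b = op a' b')) as [E|E]; auto.
      apply op_inj in E; destruct E; subst; auto.
    + intros x X; now apply Dm.
    + intros x y z; specialize (U x y z); tauto.
  - intros (F & CA & S & Dm & U); split; [auto|split; [|split]].
    + intros w; split.
      * intros W; destruct (S w W) as (x & y & E & X & Y & _); eauto.
      * intros N; apply F; intros W; destruct (S w W) as (x & y & E & X & Y & Z).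
        destruct (N x y) as [K|[K|K]]; auto; now apply CA in K.
    + intros x.
      assert (E : (exists y, op x y ∊ f) <-> x ∊ A).
      { split; [|auto]; intros [y H]; destruct (S _ H) as (x' & y' & E & X & _).
        apply op_inj in E; destruct E; now subst. }
      split; [auto|]; rewrite (CA x), <- E; split.
      * intros N [y Y]; now apply (F (op x y)).
      * intros N y; apply F; eauto.
    + intros x y z [K L]; eauto.
Qed.

Lemma isfun_ap f A (B : V -> Prop) x : isfun f A B -> x ∊ A -> op x (ap f x) ∊ f /\ B (ap f x).
Proof.
  intros (C & _ & S & D & F) X; destruct (D x X) as [y Y]; rewrite (ap_eq C F Y).
  split; [auto|]; destruct (S _ Y) as (x' & y' & E & _ & K).
  apply op_inj in E; destruct E; now subst.
Qed.

Lemma isfun_in f A (B : V -> Prop) x y : isfun f A B ->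
  (op x y ∊ f <-> x ∊ A /\ y = ap f x).
Proof.
  intros H; split.
  - intros K; pose proof H as (C & _ & S & D & F); rewrite (ap_eq C F K); split; [|auto].
    destruct (S _ K) as (x' & y' & E & X & _); apply op_inj in E; destruct E; now subst.
  - intros [X ->]; now apply (isfun_ap H).
Qed.

Lemma isfun_ext f g A (B B' : V -> Prop) : isfun f A B -> isfun g A B' ->
  (forall x, x ∊ A -> ap f x = ap g x) -> f = g.
Proof.
  intros F G H; apply crisp_ext; [apply F|apply G|intros w; split; intros W].
  - assert (K := W); apply F in W; destruct W as (x & y & -> & _).
    apply (isfun_in _ _ F) in K; apply (isfun_in _ _ G); destruct K as [X ->]; auto.
  - assert (K := W); apply G in W; destruct W as (x & y & -> & _).
    apply (isfun_in _ _ G) in K; apply (isfun_in _ _ F); destruct K as [X ->]; auto.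
    now rewrite H.
Qed.

Definition lam (G : V -> V) A : V := csetof (fun w => exists x, x ∊ A /\ w = op x (G x)).

Lemma DefF_at (G : V -> V) (g : (nat -> V) -> V) : DefF (fun e => G (e 0)) -> DefF g -> DefF (fun e => G (g e)).
Proof. apply DefF_fun. Qed.

Lemma lam_in (G : V -> V) A w : DefF (fun e => G (e 0)) ->
  (w ∊ lam G A <-> exists x, x ∊ A /\ w = op x (G x)).
Proof.
  intros D; assert (D' := fun h => @DefF_at G h D); apply csetof_in; [defi|].
  apply (bounded_img (fun x => op x (G x))); [defi|apply bounded_set].
Qed.

Lemma crisp_lam (G : V -> V) A : DefF (fun e => G (e 0)) -> crisp (lam G A).
Proof.
  intros D; assert (D' := fun h => @DefF_at G h D); apply crisp_csetof; [defi|].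
  apply (bounded_img (fun x => op x (G x))); [defi|apply bounded_set].
Qed.

Lemma isfun_lam (G : V -> V) A (B : V -> Prop) : crisp A -> DefF (fun e => G (e 0)) ->
  (forall x, x ∊ A -> B (G x)) -> isfun (lam G A) A B.
Proof.
  intros C D H; split; [now apply crisp_lam|split; [auto|split; [|split]]].
  - intros w W; apply lam_in in W; auto; destruct W as (x & X & ->); eauto 6.
  - intros x X; exists (G x); apply lam_in; eauto.
  - intros x y z Y Z; apply lam_in in Y; auto; apply lam_in in Z; auto.
    destruct Y as (x' & _ & Y), Z as (x'' & _ & Z); apply op_inj in Y; apply op_inj in Z.
    destruct Y, Z; congruence.
Qed.

Lemma ap_lam (G : V -> V) A x : DefF (fun e => G (e 0)) -> x ∊ A -> ap (lam G A) x = G x.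
Proof.
  intros D X; apply ap_eq; [now apply crisp_lam| |apply lam_in; eauto].
  intros x' y z Y Z; apply lam_in in Y; auto; apply lam_in in Z; auto.
  destruct Y as (? & _ & Y), Z as (? & _ & Z); apply op_inj in Y; apply op_inj in Z.
  destruct Y, Z; congruence.
Qed.

Lemma isfun_sub f A (B B' : V -> Prop) : (forall y, B y -> B' y) -> isfun f A B -> isfun f A B'.
Proof.
  intros H (K1 & K2 & K3 & K4); split; [auto|split; [auto|split; [|auto]]].
  intros w W; destruct (K3 w W) as (x & y & E & X & Y); eauto 6.
Qed.

Lemma isfun_iff f A (B B' : V -> Prop) : (forall y, B y <-> B' y) -> isfun f A B <-> isfun f A B'.
Proof. intros H; split; apply isfun_sub; intros y; apply H. Qed.

Definition inductive_set x : Prop := emp ∊ x /\ forall y, y ∊ x -> suc y ∊ x.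

Lemma tr_inductive k e t x : den k e t x -> tr k e (inductive t) (inductive_set x).
Proof. intros D; unfold inductive, inductive_set; sem. Qed.

Definition om : V := csetof (fun n => forall I, crisp I /\ inductive_set I -> n ∊ I).

Lemma om_aux : Def (fun e => forall I, crisp I /\ inductive_set I -> e 0 ∊ I) /\
  bounded (fun n => forall I, crisp I /\ inductive_set I -> n ∊ I).
Proof.
  split; [unfold inductive_set; defi|].
  assert (X : exists x, inductive_set x).
  { destruct (dom_inhabited V) as [a].
    apply (fun H => proj1 (@tr_ex V 0 (fun _ => a) (fun t => inductive t) inductive_set H)
      (PZFC_at (fun _ => a) PZFC_infinity)).
    intros x; apply tr_inductive; den. }
  (* The positive part of a set given by Infinity is crisp and still inductive. *)
  destruct X as [x X]; exists (csetof (fun y => y ∊ x)); intros n H; apply H.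
  assert (K := csetof_in (P := fun y => y ∊ x) ltac:(defi) (bounded_set x)).
  split; [apply crisp_csetof; [defi|apply bounded_set]|].
  split; [apply K, X|]; intros y; rewrite !K; apply X.
Qed.

Lemma om_in n : n ∊ om <-> forall I, crisp I /\ inductive_set I -> n ∊ I.
Proof. apply csetof_in; apply om_aux. Qed.

Lemma crisp_om : crisp om.
Proof. apply crisp_csetof; apply om_aux. Qed.

Lemma om_0 : emp ∊ om.
Proof. apply om_in; intros I [_ [H _]]; auto. Qed.

Lemma om_suc n : n ∊ om -> suc n ∊ om.
Proof. rewrite !om_in; intros H I [C K]; apply K, H; auto. Qed.

(** Definability of [P] makes its instances in ω a set of [V], which is then one of the sets [I]
    that ω intersects. *)
Lemma om_ind (P : V -> Prop) : Def (fun e => P (e 0)) -> P emp ->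
  (forall n, n ∊ om -> P n -> P (suc n)) -> forall n, n ∊ om -> P n.
Proof.
  intros D H0 HS n N.
  assert (K := @csetof_in (fun n => n ∊ om /\ P n)); cbv beta in K.
  assert (B : bounded (fun n => n ∊ om /\ P n)) by (exists om; tauto).
  assert (D' : Def (fun e => e 0 ∊ om /\ P (e 0))) by (apply Def_and; [defi|auto]).
  specialize (K D' B).
  assert (n ∊ csetof (fun n => n ∊ om /\ P n)) as H; [|now apply K in H].
  apply (om_in n); [auto|]; split; [now apply crisp_csetof|split].
  - apply K; split; [apply om_0|auto].
  - intros y Y; apply K in Y; apply K; destruct Y; split; [apply om_suc|]; auto.
Qed.

Lemma cdn_omega k e : cdn k e omega (fun n => n ∊ om) (fun n => n ∉- om).
Proof.
  apply cdn_iff with (fun n => forall I, crisp I /\ inductive_set I -> n ∊ I)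
    (fun n => exists I, (crisp I /\ inductive_set I) /\ n ∉- I).
  - intros n; now rewrite om_in.
  - intros n; rewrite (crisp_om n), om_in; split.
    + intros (I & [C K] & N) H; apply (C n) in N; auto.
    + intros H; apply not_all_ex_not in H; destruct H as [I H]; exists I.
      apply imply_to_and in H; destruct H as [[C K] H]; split; [auto|now apply C].
  - apply cdn_cls; intros; sem; apply tr_classical || apply tr_inductive; den.
Qed.

Lemma den_omega k e : den k e omega om.
Proof. apply cdn_omega. Qed.

Lemma nm_om j : nm j ∊ om.
Proof. induction j; [apply om_0|now apply om_suc]. Qed.

Lemma nm_in j n : n ∊ nm j <-> exists i : nat, i < j /\ n = nm i.
Proof.
  induction j; cbn [nm].
  - rewrite (proj1 (emp_spec n)); split; [easy|]; intros [i [H _]]; lia.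
  - rewrite suc_in, IHj; split.
    + intros [[i [H ->]]| ->]; [exists i|exists j]; auto with arith.
    + intros [i [H ->]]; destruct (Nat.eq_dec i j) as [->|]; auto.
      left; exists i; split; auto; lia.
Qed.

Lemma nm_irrefl j : forall i : nat, i <= j -> ~ nm (V := V) j ∊ nm i.
Proof.
  induction j as [|j IH]; intros i L H; apply nm_in in H; destruct H as [l [Hl E]]; [lia|].
  apply (IH l); [lia|]; rewrite <- E; apply nm_in; exists j; auto.
Qed.

(** Keeps the tags of different kinds of codes apart. *)
Lemma nm_inj (i j : nat) : nm (V := V) i = nm j -> i = j.
Proof.
  assert (H : forall i j : nat, i < j -> nm (V := V) i <> nm j).
  { intros l m L E; apply (@nm_irrefl l l); auto; rewrite E at 2; apply nm_in; eauto. }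
  intros E; destruct (Nat.lt_trichotomy i j) as [L|[L|L]]; auto; exfalso; apply H in L; auto.
Qed.

End Functions.
#[global] Hint Resolve DefF_op DefF_ap : defi.
#[global] Hint Resolve den_app cdn_cprod cdn_dom den_omega : den.

(** * Closure under pairing *)

Ltac om_induction := match goal with
  | |- forall n, n ∊ om -> @?P n => apply (@om_ind _ P); cbv beta
  end.

Section Iteration.
Context {V : universe}.
Implicit Types (x y z u v w a b n m X Y Z W U : V).

(** One induction for both properties, since irreflexivity at a successor uses transitivity. *)
Lemma om_trans n : n ∊ om -> (forall m, m ∊ n -> forall l : V, l ∊ m -> l ∊ n) /\ ~ n ∊ n.
Proof.
  revert n; om_induction.
  - defi.
  - split; [intros m H|intros H]; now apply emp_spec in H.
  - intros n N [T I]; split.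
    + intros m M l L; apply suc_in; apply suc_in in M; destruct M as [M| ->]; eauto.
    + intros H; apply suc_in in H; destruct H as [H|H].
      * apply I, (T _ H), suc_in; auto.
      * apply I; rewrite <- H at 2; apply suc_in; auto.
Qed.

Lemma suc_inj n m : n ∊ om -> suc n = suc m -> n = m.
Proof.
  intros N E; destruct (om_trans N) as [T I].
  assert (H : m ∊ suc n) by (rewrite E; apply suc_in; auto).
  assert (K : n ∊ suc m) by (rewrite <- E; apply suc_in; auto).
  apply suc_in in H; apply suc_in in K; destruct H as [H|H], K as [K|K]; auto.
  now destruct I; apply (T m).
Qed.

Lemma emp_neq_suc n : emp <> suc n.
Proof. intros E; apply (emp_spec n); rewrite E; apply suc_in; auto. Qed.

Variables (St : V -> V) (A0 : V).
Hypothesis DefF_St : forall h, DefF h -> DefF (fun e => St (h e)).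
Hypothesis St_incr : forall X x, x ∊ X -> x ∊ St X.
Hypothesis St_mono : forall X Y, (forall x, x ∊ X -> x ∊ Y) -> forall x, x ∊ St X -> x ∊ St Y.

(* W records a run of the iteration; stage n X says that X is its n-th stage. *)
Definition run W : Prop := forall w, w ∊ W -> w = kp emp A0 \/
  exists n X, n ∊ om /\ w = kp (suc n) (St X) /\ kp n X ∊ W.
Definition stage n X : Prop := exists W, run W /\ kp n X ∊ W.

Lemma stage_0 : stage emp A0.
Proof.
  exists (pr (kp emp A0) (kp emp A0)); split; [|apply pr_in; auto].
  intros w W; apply pr_in in W; tauto.
Qed.

Lemma stage_suc n X : n ∊ om -> stage n X -> stage (suc n) (St X).
Proof.
  intros N [W [R H]]; exists (un W (pr (kp (suc n) (St X)) (kp (suc n) (St X)))).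
  split; [|apply un_spec; right; apply pr_in; auto].
  intros w K; apply un_spec in K; destruct K as [K|K].
  - destruct (R w K) as [|(m & Y & M & E & L)]; auto; right; exists m, Y.
    repeat split; auto; apply un_spec; auto.
  - apply pr_in in K; right; exists n, X; repeat split; auto; [tauto|apply un_spec; auto].
Qed.

Lemma stage_inv n X : stage n X -> (n = emp /\ X = A0) \/
  exists m Y, m ∊ om /\ n = suc m /\ X = St Y /\ stage m Y.
Proof.
  intros [W [R H]]; destruct (R _ H) as [E|(m & Y & M & E & L)]; apply kp_inj in E; auto.
  right; exists m, Y; repeat split; try apply E; auto; now exists W.
Qed.

Lemma stage_suc_inv n X : n ∊ om -> stage (suc n) X -> exists Y, X = St Y /\ stage n Y.
Proof.
  intros N H; apply stage_inv in H; destruct H as [[E _]|(m & Y & M & E & -> & H)].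
  - now destruct (@emp_neq_suc n).
  - apply suc_inj in E; auto; subst; eauto.
Qed.

Lemma stage_0_inv X : stage emp X -> X = A0.
Proof.
  intros H; apply stage_inv in H; destruct H as [H|(m & Y & M & E & _)]; [tauto|].
  now apply emp_neq_suc in E.
Qed.

Lemma Def_stage g h : DefF g -> DefF h -> Def (fun e => stage (g e) (h e)).
Proof. apply (@Def_atom V stage); unfold stage, run; defi. Qed.
Hint Resolve Def_stage : defi.

Lemma stage_unique n : n ∊ om -> forall X Y, stage n X -> stage n Y -> X = Y.
Proof.
  revert n; om_induction; [defi| |].
  - intros X Y H K; apply stage_0_inv in H; apply stage_0_inv in K; congruence.
  - intros n N IH X Y H K; apply stage_suc_inv in H; auto; apply stage_suc_inv in K; auto.
    destruct H as [X' [-> H]], K as [Y' [-> K]]; f_equal; auto.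
Qed.

Lemma stage_contains n : n ∊ om -> forall X, stage n X -> forall x, x ∊ A0 -> x ∊ X.
Proof.
  revert n; om_induction; [defi| |].
  - intros X H; apply stage_0_inv in H; now subst.
  - intros n N IH X H x Hx; apply stage_suc_inv in H; auto; destruct H as [Y [-> H]]; eauto.
Qed.

(** Induction on [m] avoids comparing stage numbers: a stage [Z] above [X] and [Y'] is followed by
    [St Z], which contains [X] as [St] is increasing and [St Y'] as it is monotone. *)
Lemma stage_directed m : m ∊ om -> forall Y, stage m Y -> forall n X, n ∊ om -> stage n X ->
  exists l Z, l ∊ om /\ stage l Z /\ (forall x, x ∊ X -> x ∊ Z) /\ (forall y, y ∊ Y -> y ∊ Z).
Proof.
  revert m; om_induction; [defi| |].
  - intros Y H n X N K; apply stage_0_inv in H; subst; exists n, X; repeat split; auto.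
    now apply stage_contains with n.
  - intros m M IH Y H n X N K; apply stage_suc_inv in H; auto; destruct H as [Y' [-> H]].
    destruct (IH Y' H n X N K) as (l & Z & L & SZ & HX & HY).
    exists (suc l), (St Z); repeat split; eauto using om_suc, stage_suc.
Qed.

(** [U] collects the stages of the iteration along the ω of [V]. By directedness any two of its
    elements occur in a common stage [X], and the stage after [X] is still included in [U]. *)
Lemma iteration : exists U, (forall x, x ∊ A0 -> x ∊ U) /\
  forall x y, x ∊ U -> y ∊ U -> exists X, x ∊ X /\ y ∊ X /\ forall z, z ∊ St X -> z ∊ U.
Proof.
  (* [G n] has the positive members of the n-th stage and is empty off ω: a function defined on all
     of [V], as Replacement needs. *)
  pose (G := fun n => csetof (fun z => n ∊ om /\ exists X, stage n X /\ z ∊ X)).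
  assert (HG : forall n z, z ∊ G n <-> n ∊ om /\ exists X, stage n X /\ z ∊ X).
  { intros n; apply csetof_in; [defi|].
    destruct (classic (n ∊ om /\ exists X, stage n X)) as [[N [X H]]|H].
    - exists X; intros z [_ [Y [K Z]]]; now rewrite (stage_unique N H K).
    - exists emp; intros z [N [X [K _]]]; destruct H; eauto. }
  pose (U := csetof (fun z => exists n, n ∊ om /\ exists X, stage n X /\ z ∊ X)).
  assert (HU : forall z, z ∊ U <-> exists n, n ∊ om /\ exists X, stage n X /\ z ∊ X).
  { apply csetof_in; [defi|].
    apply bounded_sub with (fun z => exists w, (exists n, n ∊ om /\ w = G n) /\ z ∊ w).
    - intros z (n & N & X & K & Z); exists (G n); split; [eauto|]; apply HG; eauto.
    - apply bounded_union, (bounded_img G); [unfold G; defi|apply bounded_set]. }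
  exists U; split.
  - intros x H; apply HU; eauto using om_0, stage_0.
  - intros x y Hx Hy; apply HU in Hx; apply HU in Hy.
    destruct Hx as (n & N & X & KX & Hx), Hy as (m & M & Y & KY & Hy).
    destruct (stage_directed M KY N KX) as (l & Z & L & KZ & XZ & YZ).
    exists Z; repeat split; auto; intros z Hz; apply HU; exists (suc l).
    split; [now apply om_suc|]; exists (St Z); split; [now apply stage_suc|auto].
Qed.
End Iteration.

Section PairClosure.
Context {V : universe}.

(** Provides a bound for the codes of formulas, which are iterated Kuratowski pairs over a set. *)
Lemma pair_closure (A0 : V) : exists U : V, crisp U /\ (forall x, x ∊ A0 -> x ∊ U) /\
  forall x y, x ∊ U -> y ∊ U -> kp x y ∊ U.
Proof.
  pose (St := fun X : V => csetof (fun z => z ∊ X \/ exists a b, a ∊ X /\ b ∊ X /\ z = kp a b)).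
  assert (HS : forall X z, z ∊ St X <-> z ∊ X \/ exists a b, a ∊ X /\ b ∊ X /\ z = kp a b).
  { intros X; apply csetof_in; [defi|].
    apply bounded_or; [apply bounded_set|].
    apply (bounded_img2 kp); [defi| |]; apply bounded_set. }
  destruct (@iteration V St A0) as [U [H K]].
  - intros h H; unfold St; apply (@DefF_fun V (fun X => csetof (fun z => z ∊ X \/
      exists a b, a ∊ X /\ b ∊ X /\ z = kp a b))); [defi|auto].
  - intros X x Hx; apply HS; auto.
  - intros X Y L x Hx; apply HS; apply HS in Hx; destruct Hx as [Hx|(a & b & A & B & E)]; auto.
    right; exists a, b; auto.
  - exists (csetof (fun z => z ∊ U)).
    assert (E : forall z, z ∊ csetof (fun z => z ∊ U) <-> z ∊ U)
      by (apply csetof_in; [defi|apply bounded_set]).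
    split; [apply crisp_csetof; [defi|apply bounded_set]|split].
    + intros x Hx; apply E; auto.
    + intros x y Hx Hy; apply E; apply E in Hx; apply E in Hy.
      destruct (K x y Hx Hy) as (X & XX & XY & L); apply L, HS; right; eauto.
Qed.
End PairClosure.

(** * The sets coding the syntax *)

Section Syntax.
Context {V : universe}.
Implicit Types (k : nat) (e : nat -> V) (t : trm) (x y z u v w a b c d f i n s p q r A B C P M F : V)
  (g h j : (nat -> V) -> V).

Lemma tr_cfun_crisp k e t t' t'' f A B : den k e t f -> den k e t' A -> den k e t'' B ->
  crisp B -> tr k e (cfun t t' t'') (isfun f A (fun y => y ∊ B)).
Proof.
  intros D D' D'' CB; eapply tr_iff; [|eapply tr_cfun; den].
  apply isfun_iff; intros y; specialize (CB y); tauto.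
Qed.

Lemma csetof_crisp (R : V -> Prop) : Def (fun e => R (e 0)) -> bounded R ->
  has_members R (fun z => ~ R z) (csetof R).
Proof. intros D B z; apply csetof_spec; auto. Qed.

Lemma cdn_crisp k e t (R Q : V -> Prop) : (forall z, Q z <-> ~ R z) ->
  cdn k e t R Q -> cdn k e t R (fun z => ~ R z).
Proof. intros H; apply cdn_iff; intros z; [tauto|apply H]. Qed.

Lemma Def_isfun g h j : DefF g -> DefF h -> DefF j ->
  Def (fun e => isfun (g e) (h e) (fun y => y ∊ j e)).
Proof.
  apply (@Def_atom3 V (fun f A B => isfun f A (fun y => y ∊ B))).
  unfold isfun, functional; defi.
Qed.
Hint Resolve Def_isfun : defi.

Definition pw M n : V := csetof (fun s => isfun s n (fun y => y ∊ M)).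

Lemma bounded_isfun M n : bounded (fun s => isfun s n (fun y => y ∊ M)).
Proof.
  destruct (@bounded_img2 V op (fun x => x ∊ n) (fun y => y ∊ M)) as [u U];
    [defi|apply bounded_set|apply bounded_set|].
  destruct (superset u) as [D [CD [DP _]]].
  apply bounded_sub with (fun x => forall z, (z ∊ x -> z ∊ D) /\ (~ z ∊ D -> z ∉- x)).
  - intros s (Cs & _ & S & _).
    assert (K : forall z, z ∊ s -> z ∊ D)
      by (intros z Z; destruct (S z Z) as (x & y & -> & X & Y); apply DP, U; eauto 6).
    intros z; split; [auto|]; intros N; apply Cs; auto.
  - now apply bounded_pow.
Qed.

Lemma pw_spec M n : has_members (fun s => isfun s n (fun y => y ∊ M))
  (fun s => ~ isfun s n (fun y => y ∊ M)) (pw M n).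
Proof. apply csetof_crisp; [defi|apply bounded_isfun]. Qed.

Lemma pw_in M n s : s ∊ pw M n <-> isfun s n (fun y => y ∊ M).
Proof. apply pw_spec. Qed.

Lemma crisp_pw M n : crisp (pw M n).
Proof. intros s; destruct (pw_spec M n s) as [-> ->]; tauto. Qed.

Lemma DefF_pw g h : DefF g -> DefF h -> DefF (fun e => pw (g e) (h e)).
Proof. apply (@DefF_fun2 V pw); unfold pw; defi. Qed.

Lemma den_power k e t t' M n : den k e t M -> den k e t' n -> crisp M ->
  den k e (power t t') (pw M n).
Proof.
  intros D D' CM; apply (den_class (t := power t t') (pw_spec M n) I).
  apply cdn_cls; intros; [apply tr_bang|apply fa_bang]; apply tr_cfun_crisp; den.
Qed.

Definition vc n : V := kp (nm 0) n.
Definition cc c : V := kp (nm 1) c.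

Lemma den_var_code k e t n : den k e t n -> den k e (var_code t) (vc n).
Proof. intros; apply den_kpair; den. Qed.
Lemma den_const_code k e t c : den k e t c -> den k e (const_code t) (cc c).
Proof. intros; apply den_kpair; den. Qed.
Hint Resolve den_var_code den_const_code : den.

Lemma vc_neq_cc n c : vc n <> cc c.
Proof. intros E; apply kp_inj in E; destruct E as [E _]; now apply nm_inj in E. Qed.

Definition tm C : V :=
  csetof (fun x => (exists n, n ∊ om /\ x = vc n) \/ (exists c, c ∊ C /\ x = cc c)).

Lemma DefF_vc g : DefF g -> DefF (fun e => vc (g e)).
Proof. intros; unfold vc; defi. Qed.
Lemma DefF_cc g : DefF g -> DefF (fun e => cc (g e)).
Proof. intros; unfold cc; defi. Qed.
Hint Resolve DefF_vc DefF_cc : defi.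

Lemma tm_spec C : has_members
  (fun x => (exists n, n ∊ om /\ x = vc n) \/ (exists c, c ∊ C /\ x = cc c))
  (fun x => ~ ((exists n, n ∊ om /\ x = vc n) \/ (exists c, c ∊ C /\ x = cc c))) (tm C).
Proof.
  apply csetof_crisp; [defi|]; apply bounded_or.
  - apply (bounded_img vc); [defi|apply bounded_set].
  - apply (bounded_img cc); [defi|apply bounded_set].
Qed.

Lemma tm_in C x : x ∊ tm C <-> (exists n, n ∊ om /\ x = vc n) \/ (exists c, c ∊ C /\ x = cc c).
Proof. apply tm_spec. Qed.

Lemma crisp_tm C : crisp (tm C).
Proof. intros s; destruct (tm_spec C s) as [-> ->]; tauto. Qed.

Lemma den_Term k e t C : den k e t C -> crisp C -> den k e (Term t) (tm C).
Proof.
  intros D CC; apply (den_class (t := Term t) (tm_spec C) I).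
  eapply cdn_crisp; [|apply cdn_cls; intros; sem].
  intros z; cbv beta; split.
  - intros [H1 H2] [[n [N ->]]|[c [N ->]]].
    + destruct (H1 n) as [K|K]; [now apply (crisp_om n) in K|auto].
    + destruct (H2 c) as [K|K]; [now apply (CC c) in K|auto].
  - intros N; split; intros x.
    + destruct (classic (x ∊ om)) as [K|K]; [right; intros ->; apply N; eauto|].
      left; now apply crisp_om.
    + destruct (classic (x ∊ C)) as [K|K]; [right; intros ->; apply N; eauto|].
      left; now apply CC.
Qed.

Definition vl f s x : V := setof
  (fun z => (exists n, x = vc n /\ z ∊ ap s n) \/ (exists c, x = cc c /\ z ∊ ap f c))
  (fun z => (forall n, x <> vc n \/ z ∉- ap s n) /\ (forall c, x <> cc c \/ z ∉- ap f c)).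

(** At most one disjunct can hold, since codes of variables and of constants differ and pairing is
    injective. So the class is [ap s n], [ap f c] or empty, in each case a set. *)
Lemma vl_cases f s x : has_members
  (fun z => (exists n, x = vc n /\ z ∊ ap s n) \/ (exists c, x = cc c /\ z ∊ ap f c))
  (fun z => (forall n, x <> vc n \/ z ∉- ap s n) /\ (forall c, x <> cc c \/ z ∉- ap f c))
  (vl f s x) /\ (forall n, x = vc n -> vl f s x = ap s n) /\ (forall c, x = cc c -> vl f s x = ap f c).
Proof.
  set (R := fun z => (exists n, x = vc n /\ z ∊ ap s n) \/ (exists c, x = cc c /\ z ∊ ap f c)).
  set (Q := fun z => (forall n, x <> vc n \/ z ∉- ap s n) /\ (forall c, x <> cc c \/ z ∉- ap f c)).
  assert (HV : forall n, x = vc n -> has_members R Q (ap s n)).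
  { intros n -> z; split; split.
    - intros Z; left; eauto.
    - intros [[m [E Z]]|[c [E Z]]]; [apply kp_inj in E; destruct E; now subst|].
      now apply vc_neq_cc in E.
    - intros Z; split; [intros m|intros c; left; apply vc_neq_cc].
      destruct (classic (n = m)) as [->|N]; auto; left; intros E; now apply kp_inj in E.
    - intros [H _]; destruct (H n); tauto. }
  assert (HC : forall c, x = cc c -> has_members R Q (ap f c)).
  { intros c -> z; split; split.
    - intros Z; right; eauto.
    - intros [[m [E Z]]|[m [E Z]]]; [symmetry in E; now apply vc_neq_cc in E|].
      apply kp_inj in E; destruct E; now subst.
    - intros Z; split; intros m; [left; intros E; symmetry in E; now apply vc_neq_cc in E|].
      destruct (classic (c = m)) as [->|N]; auto; left; intros E; now apply kp_inj in E.
    - intros [_ H]; destruct (H c); tauto. }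
  split; [|split; intros m E; apply setof_unique; auto].
  apply setof_spec.
  destruct (classic (exists n, x = vc n)) as [[n E]|H1]; [eauto|].
  destruct (classic (exists c, x = cc c)) as [[c E]|H2]; [eauto|].
  exists emp; intros z; destruct (emp_spec z) as [-> ->]; split; split; try easy.
  - intros [[n [E _]]|[c [E _]]]; eauto.
  - intros _; split; intros m; left; eauto.
Qed.

Lemma vl_vc f s n : vl f s (vc n) = ap s n.
Proof. now apply vl_cases. Qed.
Lemma vl_cc f s c : vl f s (cc c) = ap f c.
Proof. now apply vl_cases. Qed.

Lemma den_val k e t t' t'' f s x : den k e t f -> den k e t' s -> den k e t'' x ->
  den k e (val t t' t'') (vl f s x).
Proof.
  intros D D' D''; destruct (vl_cases f s x) as [H _].
  apply (den_class (t := val t t' t'') H I), cdn_cls; intros; sem.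
Qed.
Hint Resolve den_val : den.

Lemma DefF_vl g h j : DefF g -> DefF h -> DefF j -> DefF (fun e => vl (g e) (h e) (j e)).
Proof. apply (@DefF_fun3 V vl); unfold vl; defi. Qed.
Hint Resolve DefF_vl : defi.

Definition vls f s n x : V := lam (fun i => vl f s (ap x i)) n.

Lemma DefF_vls g h j l : DefF g -> DefF h -> DefF j -> DefF l ->
  DefF (fun e => vls (g e) (h e) (j e) (l e)).
Proof.
  intros; unfold DefF.
  apply (@Def_let V (fun a e => e 0 = vls a (h (fun i : nat => e (S i))) (j (fun i : nat => e (S i)))
    (l (fun i : nat => e (S i))))); [|now apply DefF_subst].
  apply (@Def_let V (fun a e => e 1 = vls (e 0) a (j (fun i : nat => e (S (S i))))
    (l (fun i : nat => e (S (S i)))))); [|now apply (@DefF_subst V (fun i : nat => S (S i)))].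
  apply (@Def_let V (fun a e => e 2 = vls (e 1) (e 0) a
    (l (fun i : nat => e (S (S (S i))))))); [|now apply (@DefF_subst V (fun i : nat => S (S (S i))))].
  apply (@Def_let V (fun a e => e 3 = vls (e 2) (e 1) (e 0) a));
    [|now apply (@DefF_subst V (fun i : nat => S (S (S (S i)))))].
  unfold vls, lam; defi.
Qed.

Lemma den_vals k e t t' t'' t''' f s n x : den k e t f -> den k e t' s -> den k e t'' n ->
  den k e t''' x -> crisp n -> den k e (vals t t' t'' t''') (vls f s n x).
Proof.
  intros D D' D'' D''' Cn.
  assert (DG : DefF (fun e => vl f s (ap x (e 0)))) by defi.
  apply (@den_class V k e (vals t t' t'' t''') (fun w => exists i, i ∊ n /\ w = op i (vl f s (ap x i)))
    (fun w => ~ exists i, i ∊ n /\ w = op i (vl f s (ap x i)))); [|exact I|].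
  { intros w; pose proof (crisp_lam (G := fun i => vl f s (ap x i)) n DG w) as H1; pose proof (lam_in (G := fun i => vl f s (ap x i)) n w DG) as H2.
    unfold vls; tauto. }
  eapply cdn_iff; [| |apply cdn_cls; intros; sem].
  - intros w; split.
    + intros (i & b & H & -> & ->); eauto.
    + intros (i & H & ->); eauto 6.
  - intros w; cbv beta; split.
    + intros H (i & Hi & E); destruct (H i (vl f s (ap x i))) as [K|[K|K]]; auto.
      now apply (Cn i) in K.
    + intros N i b; destruct (classic (i ∊ n)) as [Hi|Hi]; [right|left; now apply Cn].
      destruct (classic (b = vl f s (ap x i))) as [->|]; auto.
      right; intros ->; apply N; eauto.
Qed.

Definition up s n a : V := setof (fun w => (w ∊ s /\ ~ (exists b, w = op n b)) \/ w = op n a)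
  (fun w => (w ∉- s \/ (exists b, w = op n b)) /\ w <> op n a).

Lemma cdn_upd k e t t' t'' s n a : den k e t s -> den k e t' n -> den k e t'' a ->
  cdn k e (upd t t' t'') (fun w => (w ∊ s /\ ~ (exists b, w = op n b)) \/ w = op n a)
    (fun w => (w ∉- s \/ (exists b, w = op n b)) /\ w <> op n a).
Proof. intros D D' D''; apply cdn_cls; intros; sem. Qed.

Lemma up_spec s n a : has_members (fun w => (w ∊ s /\ ~ (exists b, w = op n b)) \/ w = op n a)
  (fun w => (w ∉- s \/ (exists b, w = op n b)) /\ w <> op n a) (up s n a).
Proof.
  assert (D : den 3 (scons s (scons n (scons a (fun _ => a)))) (Var 2) s /\
    den 3 (scons s (scons n (scons a (fun _ => a)))) (Var 1) n /\
    den 3 (scons s (scons n (scons a (fun _ => a)))) (Var 0) a) by (cbn; auto 10).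
  destruct D as (D1 & D2 & D3); eapply cdn_setof; [eapply cdn_upd; [exact D1|exact D2|exact D3]|].
  destruct (superset s) as [D [_ [DP DN]]].
  destruct (bounded_or (bounded_set D) (bounded_eq (op n a))) as [u U].
  exists u; split.
  - intros z [[Z _]|Z]; apply U; auto.
  - intros z Z; split; [left; apply DN; intros K|intros K]; apply Z, U; auto.
Qed.

Lemma den_upd k e t t' t'' s n a : den k e t s -> den k e t' n -> den k e t'' a ->
  den k e (upd t t' t'') (up s n a).
Proof. intros D D' D''; apply (den_class (t := upd t t' t'') (up_spec s n a) I), cdn_upd; auto. Qed.

Lemma DefF_up g h j : DefF g -> DefF h -> DefF j -> DefF (fun e => up (g e) (h e) (j e)).
Proof. apply (@DefF_fun3 V up); unfold up; defi. Qed.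

Lemma up_isfun s n a A (B : V -> Prop) : isfun s A B -> n ∊ A -> B a -> isfun (up s n a) A B.
Proof.
  intros F N Ha; pose proof F as (C & CA & S & D & U); pose proof (up_spec s n a) as H.
  assert (E : forall w, w ∊ up s n a <-> (w ∊ s /\ ~ (exists b, w = op n b)) \/ w = op n a)
    by (intros w; apply H).
  split; [|split; [auto|split; [|split]]].
  - intros w; destruct (H w) as [-> ->]; rewrite (C w).
    destruct (classic (exists b, w = op n b)), (classic (w ∊ s)); tauto.
  - intros w W; apply E in W; destruct W as [[W _]| ->]; eauto.
  - intros x X; destruct (classic (x = n)) as [->|K]; [exists a; apply E; auto|].
    destruct (D x X) as [y Y]; exists y; apply E; left; split; auto.
    intros [b L]; now apply op_inj in L.
  - intros x y z Y Z; apply E in Y; apply E in Z.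
    destruct Y as [[Y NY]|Y], Z as [[Z NZ]|Z].
    + eauto.
    + apply op_inj in Z; destruct Z; subst; destruct NY; eauto.
    + apply op_inj in Y; destruct Y; subst; destruct NZ; eauto.
    + apply op_inj in Y; apply op_inj in Z; destruct Y, Z; congruence.
Qed.

Lemma ap_up s n a A (B : V -> Prop) i : isfun s A B -> n ∊ A -> B a -> i ∊ A ->
  (i = n -> ap (up s n a) i = a) /\ (i <> n -> ap (up s n a) i = ap s i).
Proof.
  intros F N Ha Hi; pose proof (up_isfun F N Ha) as K; split; intros E.
  - subst; apply ap_eq; [apply K|apply K|apply up_spec; auto].
  - apply ap_eq; [apply K|apply K|apply up_spec; left].
    split; [now apply (isfun_ap F)|intros [b L]; now apply op_inj in L].
Qed.

End Syntax.
#[global] Hint Resolve Def_isfun DefF_pw DefF_vc DefF_cc DefF_vl DefF_vls DefF_up : defi.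
#[global] Hint Resolve tr_cfun_crisp den_power den_var_code den_const_code den_Term den_val den_vals
  den_upd crisp_tm crisp_om crisp_pw : den.

(** * Codes of formulas and induction on them *)

Section Formulas.
Context {V : universe}.
Implicit Types (k : nat) (e : nat -> V) (t : trm) (x y z u v w a b c d f i n s p q r A B C P M : V)
  (g h : (nat -> V) -> V).

Definition vocab C P : Prop := crisp C /\ crisp P /\
  forall r, r ∊ P -> exists x n, n ∊ om /\ r = kp x n.

Lemma tr_vocabulary k e t t' C P : den k e t C -> den k e t' P ->
  tr k e (vocabulary t t') (vocab C P).
Proof.
  intros D D'; unfold vocabulary, vocab; apply tr_conj; [now apply tr_classical|intros _].
  apply tr_conj; [now apply tr_classical|intros _]; sem.
Qed.

Definition eqc x y : V := kp (nm 0) (kp x y).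
Definition relc r x : V := kp (nm 1) (kp r x).
Definition notc p : V := kp (nm 2) p.
Definition andc p q : V := kp (nm 3) (kp p q).
Definition orc p q : V := kp (nm 4) (kp p q).
Definition impc p q : V := kp (nm 5) (kp p q).
Definition botc : V := kp (nm 6) emp.
Definition exc n p : V := kp (nm 7) (kp n p).
Definition allc n p : V := kp (nm 8) (kp n p).

Lemma den_eq_code k e t t' x y : den k e t x -> den k e t' y -> den k e (eq_code t t') (eqc x y).
Proof. intros; unfold eq_code, eqc; den. Qed.
Lemma den_rel_code k e t t' x y : den k e t x -> den k e t' y -> den k e (rel_code t t') (relc x y).
Proof. intros; unfold rel_code, relc; den. Qed.
Lemma den_not_code k e t x : den k e t x -> den k e (not_code t) (notc x).
Proof. intros; unfold not_code, notc; den. Qed.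
Lemma den_and_code k e t t' x y : den k e t x -> den k e t' y -> den k e (and_code t t') (andc x y).
Proof. intros; unfold and_code, andc; den. Qed.
Lemma den_or_code k e t t' x y : den k e t x -> den k e t' y -> den k e (or_code t t') (orc x y).
Proof. intros; unfold or_code, orc; den. Qed.
Lemma den_imp_code k e t t' x y : den k e t x -> den k e t' y -> den k e (imp_code t t') (impc x y).
Proof. intros; unfold imp_code, impc; den. Qed.
Lemma den_bot_code k e : den k e bot_code botc.
Proof. intros; unfold bot_code, botc; den. Qed.
Lemma den_ex_code k e t t' x y : den k e t x -> den k e t' y -> den k e (ex_code t t') (exc x y).
Proof. intros; unfold ex_code, exc; den. Qed.
Lemma den_all_code k e t t' x y : den k e t x -> den k e t' y -> den k e (all_code t t') (allc x y).
Proof. intros; unfold all_code, allc; den. Qed.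
Hint Resolve den_eq_code den_rel_code den_not_code den_and_code den_or_code den_imp_code
  den_bot_code den_ex_code den_all_code : den.

Definition fclosed (full : bool) C P (F : V -> Prop) : Prop :=
  (forall x y, x ∊ tm C /\ y ∊ tm C -> F (eqc x y)) /\
  (forall r x n f, r ∊ P /\ r = kp x n /\ isfun f n (fun y => y ∊ tm C) -> F (relc r f)) /\
  (forall p, F p -> F (notc p)) /\
  (forall p q, F p /\ F q -> F (andc p q)) /\
  (forall p q, F p /\ F q -> F (orc p q)) /\
  (forall n p, n ∊ om /\ F p -> F (exc n p)) /\
  (forall n p, n ∊ om /\ F p -> F (allc n p)) /\
  (if full then (forall p q, F p /\ F q -> F (impc p q)) /\ F botc else True).

Lemma tr_formula_closed full k e t t' t'' C P F : den k e t C -> den k e t' P -> den k e t'' F ->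
  crisp C -> tr k e (formula_closed full t t' t'') (fclosed full C P (fun p => p ∊ F)).
Proof.
  intros D D' D'' CC; unfold formula_closed, fclosed; destruct full; sem.
Qed.

Definition Fm full C P : V := csetof (fun p => forall F, crisp F /\ fclosed full C P (fun q => q ∊ F) -> p ∊ F).

(** The intersection defining [Fm] must not be vacuous. A set closed under pairs is closed under the
    formation of formulas once it contains ω, the terms, the relation symbols and the argument
    lists. *)
Lemma fclosed_exists full C P : vocab C P ->
  exists F, crisp F /\ fclosed full C P (fun q => q ∊ F).
Proof.
  intros (CC & CP & HP).
  (* The argument lists of all arities together; arities lie in ω by [vocab]. *)
  assert (B : bounded (fun f => exists n, n ∊ om /\ f ∊ pw (tm C) n)).
  { apply bounded_sub with (fun f => exists w, (exists n, n ∊ om /\ w = pw (tm C) n) /\ f ∊ w).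
    - intros f (n & N & H); eauto.
    - apply bounded_union, (bounded_img (pw (tm C))); [defi|apply bounded_set]. }
  destruct (bounded_or (bounded_or (bounded_set om) (bounded_set (tm C)))
    (bounded_or (bounded_set P) B)) as [A0 H0].
  destruct (pair_closure A0) as (U & CU & HU & K); exists U; split; [auto|].
  assert (N : forall l, nm l ∊ U) by (intros l; apply HU, H0; left; left; apply nm_om).
  assert (O : forall n, n ∊ om -> n ∊ U) by (intros n Hn; apply HU, H0; left; left; auto).
  unfold fclosed; splits.
  - intros x y [X Y]; apply K; [apply N|apply K]; apply HU, H0; auto.
  - intros r x n f (R & E & Hf); apply K; [apply N|apply K]; apply HU, H0; [auto|].
    right; right; exists n; split; [|now apply pw_in].
    destruct (HP r R) as (x' & n' & N' & E'); rewrite E in E'; apply kp_inj in E'.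
    destruct E'; now subst.
  - intros p Hp; apply K; auto.
  - intros p q [Hp Hq]; apply K; auto.
  - intros p q [Hp Hq]; apply K; auto.
  - intros n p [Hn Hp]; apply K; auto.
  - intros n p [Hn Hp]; apply K; auto.
  - destruct full; [split; [intros p q [Hp Hq]|]; apply K; auto; apply (N 0)|easy].
Qed.

Lemma Def_fclosed full C P g : DefF g -> Def (fun e => fclosed full C P (fun q => q ∊ g e)).
Proof.
  apply (@Def_pred V (fun F => fclosed full C P (fun q => q ∊ F))).
  unfold fclosed, eqc, relc, notc, andc, orc, impc, botc, exc, allc; destruct full; defi.
Qed.
Hint Resolve Def_fclosed : defi.

Lemma Fm_spec full C P : vocab C P -> has_members
  (fun p => forall F, crisp F /\ fclosed full C P (fun q => q ∊ F) -> p ∊ F)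
  (fun p => ~ forall F, crisp F /\ fclosed full C P (fun q => q ∊ F) -> p ∊ F) (Fm full C P).
Proof.
  intros H; apply csetof_crisp; [defi|].
  destruct (fclosed_exists full H) as [F K]; exists F; auto.
Qed.

Lemma crisp_Fm full C P : vocab C P -> crisp (Fm full C P).
Proof. intros H s; destruct (Fm_spec full H s) as [-> ->]; tauto. Qed.

Lemma den_Formula full k e t t' C P : den k e t C -> den k e t' P -> vocab C P ->
  den k e (Formula full t t') (Fm full C P).
Proof.
  intros D D' H.
  apply (den_class (t := Formula full t t') (Fm_spec full H) I), cdn_crisp with
    (fun p => exists F, (crisp F /\ fclosed full C P (fun q => q ∊ F)) /\ p ∉- F).
  - intros p; split.
    + intros (F & [CF K] & N) L; apply (CF p) in N; auto.
    + intros L; apply not_all_ex_not in L; destruct L as [F L]; exists F.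
      apply imply_to_and in L; destruct L as [[CF K] L]; split; [auto|now apply CF].
  - apply cdn_cls; intros; sem; solve [apply tr_classical; den|
      apply tr_formula_closed; try den; apply H].
Qed.

Lemma Fm_closed full C P : vocab C P -> fclosed full C P (fun q => q ∊ Fm full C P).
Proof.
  intros H; assert (E : forall p, p ∊ Fm full C P <->
    forall F, crisp F /\ fclosed full C P (fun q => q ∊ F) -> p ∊ F) by (intros p; apply Fm_spec, H).
  unfold fclosed; splits;
    [..|destruct full; [split|exact I]].
  all: intros; repeat match goal with K : _ /\ _ |- _ => destruct K end;
    repeat match goal with K : _ ∊ Fm _ _ _ |- _ => rewrite E in K end; apply E; intros F L;
    pose proof L as (_ & L1 & L2 & L3 & L4 & L5 & L6 & L7 & L8).
  - apply L1; auto.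
  - eapply L2; eauto.
  - apply L3; auto.
  - apply L4; auto.
  - apply L5; auto.
  - apply L6; auto.
  - apply L7; auto.
  - apply (proj1 L8); auto.
  - apply (proj2 L8).
Qed.

(** Definability of [R] turns the formulas satisfying it into a crisp closed set [F] of [V], one of
    those intersected in [Fm]. *)
Lemma Fm_ind full C P (R : V -> Prop) : vocab C P -> Def (fun e => R (e 0)) ->
  fclosed full C P (fun p => p ∊ Fm full C P /\ R p) -> forall p, p ∊ Fm full C P -> R p.
Proof.
  intros H D K p Hp.
  assert (X : exists F, crisp F /\ forall p, p ∊ F <-> p ∊ Fm full C P /\ R p).
  { assert (DD : Def (fun e => e 0 ∊ Fm full C P /\ R (e 0))) by (apply Def_and; [defi|auto]).
    assert (B : bounded (fun p => p ∊ Fm full C P /\ R p)) by (exists (Fm full C P); tauto).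
    eexists; split; [apply (crisp_csetof DD B)|apply (csetof_in DD B)]. }
  destruct X as (F & CF & E); apply (E p), (Fm_spec full H p); [auto|]; split; [auto|].
  revert K; clear -E; intros (K1 & K2 & K3 & K4 & K5 & K6 & K7 & K8).
  unfold fclosed; splits;
    [..|destruct full; [split|exact I]].
  all: intros; repeat match goal with K : _ /\ _ |- _ => destruct K end; apply E;
    repeat match goal with L : forall p, p ∊ ?F <-> _, K : _ ∊ ?F |- _ => apply L in K end.
  - apply K1; auto.
  - eapply K2; eauto.
  - apply K3; auto.
  - apply K4; auto.
  - apply K5; auto.
  - apply K6; auto.
  - apply K7; auto.
  - match goal with K : forall p q, _ -> _ |- _ => apply K; auto end.
  - auto.
Qed.

Lemma Fm_false_true C P p : vocab C P -> p ∊ Fm false C P -> p ∊ Fm true C P.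
Proof.
  intros H; apply (Fm_ind (R := fun p => p ∊ Fm true C P) H); [defi|].
  destruct (Fm_closed false H) as (A1 & A2 & A3 & A4 & A5 & A6 & A7 & _).
  destruct (Fm_closed true H) as (B1 & B2 & B3 & B4 & B5 & B6 & B7 & _).
  unfold fclosed; splits; [..|exact I];
    intros; repeat match goal with H : _ /\ _ |- _ => destruct H end; split.
  - apply A1; auto.
  - apply B1; auto.
  - eapply A2; eauto.
  - eapply B2; eauto.
  - apply A3; auto.
  - apply B3; auto.
  - apply A4; auto.
  - apply B4; auto.
  - apply A5; auto.
  - apply B5; auto.
  - apply A6; auto.
  - apply B6; auto.
  - apply A7; auto.
  - apply B7; auto.
Qed.

End Formulas.
#[global] Hint Resolve den_eq_code den_rel_code den_not_code den_and_code den_or_code den_imp_code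
  den_bot_code den_ex_code den_all_code den_Formula crisp_Fm : den.

(** * Satisfaction *)

Opaque nm kp op.

Section Satisfaction.
Context {V : universe}.
Implicit Types (k : nat) (e : nat -> V) (t : trm) (x y z u v w a b c d f i n s p q r S X Y : V).

(* T p s and F p s: the formula p is true, resp. false, under the assignment s. *)
Record sat_spec (C P M cI : V) (eqp eqn Rp Rn T F : V -> V -> Prop) : Prop := {
  sat_eq : forall s x y, s ∊ pw M om -> x ∊ tm C -> y ∊ tm C ->
    (T (eqc x y) s <-> eqp (vl cI s x) (vl cI s y)) /\
    (F (eqc x y) s <-> eqn (vl cI s x) (vl cI s y));
  sat_rel : forall s r x n f, s ∊ pw M om -> r ∊ P -> r = kp x n ->
    isfun f n (fun y => y ∊ tm C) ->
    (T (relc r f) s <-> Rp r (vls cI s n f)) /\ (F (relc r f) s <-> Rn r (vls cI s n f));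
  sat_not : forall s p, s ∊ pw M om -> p ∊ Fm true C P ->
    (T (notc p) s <-> F p s) /\ (F (notc p) s <-> T p s);
  sat_and : forall s p q, s ∊ pw M om -> p ∊ Fm true C P -> q ∊ Fm true C P ->
    (T (andc p q) s <-> T p s /\ T q s) /\ (F (andc p q) s <-> F p s \/ F q s);
  sat_or : forall s p q, s ∊ pw M om -> p ∊ Fm true C P -> q ∊ Fm true C P ->
    (T (orc p q) s <-> T p s \/ T q s) /\ (F (orc p q) s <-> F p s /\ F q s);
  sat_imp : forall s p q, s ∊ pw M om -> p ∊ Fm true C P -> q ∊ Fm true C P ->
    (T (impc p q) s <-> (T p s -> T q s)) /\ (F (impc p q) s <-> T p s /\ F q s);
  sat_bot : forall s, s ∊ pw M om -> ~ T botc s /\ F botc s;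
  sat_ex : forall s n p, s ∊ pw M om -> n ∊ om -> p ∊ Fm true C P ->
    (T (exc n p) s <-> exists a, a ∊ M /\ T p (up s n a)) /\
    (F (exc n p) s <-> forall a, a ∊ M -> F p (up s n a));
  sat_all : forall s n p, s ∊ pw M om -> n ∊ om -> p ∊ Fm true C P ->
    (T (allc n p) s <-> forall a, a ∊ M -> T p (up s n a)) /\
    (F (allc n p) s <-> exists a, a ∊ M /\ F p (up s n a)) }.

Definition posin S p s : Prop := kp p s ∊ S.
Definition negin S p s : Prop := kp p s ∉- S.

Variables (k : nat) (e : nat -> V) (tC tP tM tI : trm) (C P M cI : V).
Hypothesis HV : vocab C P.
Hypothesis CM : crisp M.
Hypothesis (DC : den k e tC C) (DP : den k e tP P) (DM : den k e tM M) (DI : den k e tI cI).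
Hint Extern 1 (crisp C) => apply HV : den.
Hint Extern 1 (crisp P) => apply HV : den.

Lemma isfun_crisp f n (B : V -> Prop) : isfun f n B -> crisp n.
Proof. intros H; apply H. Qed.
Hint Resolve isfun_crisp : den.

(** The left side is the form in which the falsity of an existential bounded by [M] arises. *)
Lemma crisp_forall (Q : V -> Prop) : (forall a, a ∉- M \/ Q a) <-> (forall a, a ∊ M -> Q a).
Proof.
  split; intros H a; specialize (H a).
  - intros A; destruct H as [H|H]; auto; now apply CM in H.
  - destruct (classic (a ∊ M)); auto; left; now apply CM.
Qed.

(** Each strong equivalence splits into a truth half on [posin S] and a falsity half on [negin S].
    Tarski satisfaction thus becomes an instance of the same [sat_spec] that describes
    T/F-satisfaction. *)
Lemma tr_sat_clauses tR tS rI S : den k e tR rI -> den k e tS S ->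
  tr k e (sat_clauses fsiff fnot eqt tC tP tM tI tR tS)
    (sat_spec C P M cI eq (eq_neg V) (fun r w => w ∊ ap rI r) (fun r w => w ∉- ap rI r)
      (posin S) (negin S)).
Proof.
  intros DR DS; eapply tr_iff; [|unfold sat_clauses; cbv zeta; sem].
  cbv beta; split; unfold posin, negin.
  - intros H; constructor; intros s; intros;
      match goal with Hs : s ∊ _ |- _ => destruct (H s Hs) as (K1 & K2 & K3 & K4 & K5 & K6 & K7 & K8 & K9) end; clear H.
    + apply (K1 x y _ _); auto.
    + apply (K2 r x n f _); auto.
    + apply K3; auto.
    + apply K4; auto.
    + apply K5; auto.
    + apply K6; auto.
    + tauto.
    + rewrite <- crisp_forall; now apply K8.
    + apply K9; auto.
  - intros [H1 H2 H3 H4 H5 H6 H7 H8 H9] s Hs; splits.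
    + intros x y a b (X & Y & -> & ->); now apply H1.
    + intros r x n f a (R & E & F & ->); now apply (H2 s r x n f).
    + intros p K; now apply H3.
    + intros p q [K L]; now apply H4.
    + intros p q [K L]; now apply H5.
    + intros p q [K L]; now apply H6.
    + specialize (H7 s Hs); tauto.
    + specialize (H7 s Hs); tauto.
    + intros n p [K L]; rewrite crisp_forall; now apply H8.
    + intros n p [K L]; now apply H9.
Qed.

(** These clauses speak of truth only; with falsity read as absence of truth, the falsity half of
    [sat_spec] follows classically. *)
Lemma tr_FOL_clauses tR tS rI S : den k e tR rI -> den k e tS S ->
  tr k e (sat_clauses fiff fneg (fun a b : trm => bang (eqt a b)) tC tP tM tI tR tS)
    (sat_spec C P M cI eq (fun a b => a <> b) (fun r w => w ∊ ap rI r) (fun r w => ~ w ∊ ap rI r)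
      (posin S) (fun p s => ~ posin S p s)).
Proof.
  intros DR DS; eapply tr_iff; [|unfold sat_clauses; cbv zeta; sem].
  cbv beta; split; unfold posin.
  - intros H; constructor; intros s; intros;
      match goal with Hs : s ∊ _ |- _ => destruct (H s Hs) as (K1 & K2 & K3 & K4 & K5 & K6 & K7 & K8 & K9) end; clear H.
    + rewrite (K1 x y (vl cI s x) (vl cI s y)) by auto; tauto.
    + rewrite (K2 r x n f (vls cI s n f)) by auto; tauto.
    + rewrite K3 by auto; tauto.
    + rewrite K4 by auto; tauto.
    + rewrite K5 by auto; tauto.
    + rewrite K6 by auto; tauto.
    + tauto.
    + rewrite K8 by auto; split; [tauto|]; split; [intros H a A B; apply H; eauto|].
      intros H [a [A B]]; now apply (H a).
    + rewrite K9 by auto; split; [tauto|]; split; [|intros [a [A B]] H; now apply B, H].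
      intros H; apply not_all_ex_not in H; destruct H as [a H]; exists a; tauto.
  - intros [H1 H2 H3 H4 H5 H6 H7 H8 H9] s Hs; splits.
    + intros x y a b (X & Y & -> & ->); now apply H1.
    + intros r x n f a (R & E & F & ->); now apply (H2 s r x n f).
    + intros p K; now apply H3.
    + intros p q [K L]; now apply H4.
    + intros p q [K L]; now apply H5.
    + intros p q [K L]; now apply H6.
    + specialize (H7 s Hs); tauto.
    + intros n p [K L]; now apply H8.
    + intros n p [K L]; now apply H9.
Qed.

Lemma tr_TF_clauses tp tn tep ten tX tY rp rn ep en X Y : den k e tp rp -> den k e tn rn ->
  den k e tep ep -> den k e ten en -> den k e tX X -> den k e tY Y ->
  tr k e (TF_clauses tC tP tM tI tp tn tep ten tX tY)
    (sat_spec C P M cI (fun a b => op a b ∊ ep) (fun a b => op a b ∊ en)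
      (fun r w => w ∊ ap rp r) (fun r w => w ∊ ap rn r) (posin X) (posin Y)).
Proof.
  intros D1 D2 D3 D4 D5 D6; eapply tr_iff; [|unfold TF_clauses; cbv zeta; sem].
  cbv beta; split; unfold posin.
  - intros H; constructor; intros s; intros;
      match goal with Hs : s ∊ _ |- _ => destruct (H s Hs) as (K1 & K2 & K3 & K4 & K5 & K6 & K7 & K8 & K9) end; clear H.
    + apply (K1 x y _ _); auto.
    + apply (K2 r x n f _); auto.
    + apply K3; auto.
    + apply K4; auto.
    + apply K5; auto.
    + apply K6; auto.
    + tauto.
    + apply K8; auto.
    + apply K9; auto.
  - intros [H1 H2 H3 H4 H5 H6 H7 H8 H9] s Hs; splits.
    + intros x y a b (X' & Y' & -> & ->); now apply H1.
    + intros r x n f a (R & E & F & ->); now apply (H2 s r x n f).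
    + intros p K; now apply H3.
    + intros p q [K L]; now apply H4.
    + intros p q [K L]; now apply H5.
    + intros p q [K L]; now apply H6.
    + specialize (H7 s Hs); tauto.
    + specialize (H7 s Hs); tauto.
    + intros n p [K L]; now apply H8.
    + intros n p [K L]; now apply H9.
Qed.
End Satisfaction.

(** * Models and consequence relations *)

Section Consequence.
Context {V : universe}.
Implicit Types (k : nat) (e : nat -> V) (t : trm).
Variables (C P : V).
Implicit Types (x y z u v w a b c d f i n s p q r S X Y M : V).

Definition tarski_str M cI rI : Prop :=
  crisp M /\ (exists a, a ∊ M) /\ isfun cI C (fun y => y ∊ M) /\
  (exists B, isfun rI P (fun y => y ∊ B /\ ~ y ∉- B)) /\
  (forall r x n, r ∊ P /\ r = kp x n ->
    forall z, (z ∊ ap rI r -> z ∊ pw M n) /\ (z ∉- pw M n -> z ∉- ap rI r)).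

Definition tarski_spec M cI rI S : Prop :=
  sat_spec C P M cI eq (eq_neg V) (fun r w => w ∊ ap rI r) (fun r w => w ∉- ap rI r)
    (posin S) (negin S).

Definition tarski_true M cI rI p s : Prop := exists S, tarski_spec M cI rI S /\ kp p s ∊ S.

Definition tarski_entails Sigma p : Prop :=
  forall M cI rI, tarski_str M cI rI -> forall s, s ∊ pw M om ->
  (forall q, q ∊ Sigma -> tarski_true M cI rI q s) -> tarski_true M cI rI p s.

Definition fol_true M cI rI p s : Prop := exists S, (crisp S /\
  sat_spec C P M cI eq (fun a b => a <> b) (fun r w => w ∊ ap rI r) (fun r w => ~ w ∊ ap rI r)
    (posin S) (fun p s => ~ posin S p s)) /\ kp p s ∊ S.

Definition fol_str M cI rI : Prop :=
  tarski_str M cI rI /\ forall r, r ∊ P -> crisp (ap rI r).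

Definition fol_entails Sigma p : Prop :=
  forall M cI rI, fol_str M cI rI -> forall s, s ∊ pw M om ->
  (forall q, q ∊ Sigma -> fol_true M cI rI q s) -> fol_true M cI rI p s.

Definition is_rel_on M ep : Prop :=
  forall z, (z ∊ ep -> exists a b, z = op a b /\ a ∊ M /\ b ∊ M) /\
    ((forall a b, z <> op a b \/ a ∉- M \/ b ∉- M) -> z ∉- ep).

Definition tf_str M cI rp rn ep en : Prop :=
  crisp M /\ (exists a, a ∊ M) /\ isfun cI C (fun y => y ∊ M) /\
  (exists B, isfun rp P (fun y => y ∊ B /\ ~ y ∉- B)) /\
  (exists B, isfun rn P (fun y => y ∊ B /\ ~ y ∉- B)) /\
  (forall r x n, r ∊ P /\ r = kp x n ->
    crisp (ap rp r) /\
    (forall z, (z ∊ ap rp r -> z ∊ pw M n) /\ (z ∉- pw M n -> z ∉- ap rp r)) /\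
    crisp (ap rn r) /\
    (forall z, (z ∊ ap rn r -> z ∊ pw M n) /\ (z ∉- pw M n -> z ∉- ap rn r))) /\
  crisp ep /\ is_rel_on M ep /\ crisp en /\ is_rel_on M en /\
  (forall a b, op a b ∊ en -> op b a ∊ en) /\
  (forall a b, a ∊ M /\ b ∊ M -> (op a b ∊ ep <-> a = b)).

Definition tf_spec M cI rp rn ep en X Y : Prop :=
  sat_spec C P M cI (fun a b => op a b ∊ ep) (fun a b => op a b ∊ en)
    (fun r w => w ∊ ap rp r) (fun r w => w ∊ ap rn r) (posin X) (posin Y).

Definition tf_true M cI rp rn ep en p s : Prop :=
  exists X, (exists Y, crisp X /\ crisp Y /\ tf_spec M cI rp rn ep en X Y) /\ kp p s ∊ X.

Definition tf_entails (restr : V -> V -> V -> V -> V -> Prop) Sigma p : Prop :=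
  forall M cI rp rn ep en, tf_str M cI rp rn ep en /\ restr M rp rn ep en ->
  forall s, s ∊ pw M om ->
  (forall q, q ∊ Sigma -> tf_true M cI rp rn ep en q s) -> tf_true M cI rp rn ep en p s.

Definition consistent M rp rn ep en : Prop :=
  (forall r, r ∊ P -> forall w, ~ (w ∊ ap rp r /\ w ∊ ap rn r)) /\
  forall w, ~ (w ∊ ep /\ w ∊ en).

Definition complete M rp rn ep en : Prop :=
  (forall r x n, r ∊ P -> r = kp x n -> forall w, w ∊ pw M n -> w ∊ ap rp r \/ w ∊ ap rn r) /\
  forall a b, a ∊ M -> b ∊ M -> op a b ∊ ep \/ op a b ∊ en.

Hint Extern 1 (crisp ?x) => match goal with
  | H : vocab x _ |- _ => exact (proj1 H)
  | H : vocab _ x |- _ => exact (proj1 (proj2 H))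
  | H : tarski_str x _ _ |- _ => exact (proj1 H)
  | H : fol_str x _ _ |- _ => exact (proj1 (proj1 H))
  | H : tf_str x _ _ _ _ _ |- _ => exact (proj1 H)
  | H : tf_str x _ _ _ _ _ /\ _ |- _ => exact (proj1 (proj1 H))
  end : den.
Hint Resolve isfun_crisp tr_classical tr_subset tr_sat_clauses tr_FOL_clauses tr_TF_clauses : den.
Hint Resolve tr_cfun | 10 : den.

Section Structure.
Variables (k : nat) (e : nat -> V) (tC tP tM tI : trm) (M cI : V).
Hypothesis HV : vocab C P.
Hypothesis (DC : den k e tC C) (DP : den k e tP P) (DM : den k e tM M) (DI : den k e tI cI).

Lemma tr_tarski_model tR rI : den k e tR rI ->
  tr k e (tarski_model tC tP tM tI tR) (tarski_str M cI rI).
Proof. intros DR; unfold tarski_model, tarski_str; sem. Qed.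

Lemma tr_tarski_sat tR tp ts rI p s : crisp M ->
  den k e tR rI -> den k e tp p -> den k e ts s ->
  tr k e (tarski_sat tC tP tM tI tR tp ts) (tarski_true M cI rI p s).
Proof. intros CM DR D D'; unfold tarski_sat, tarski_true, tarski_spec; sem. Qed.

Lemma tr_classical_model tR rI : den k e tR rI ->
  tr k e (classical_model tC tP tM tI tR) (fol_str M cI rI).
Proof.
  intros DR; unfold classical_model, fol_str; apply tr_conj; [now apply tr_tarski_model|].
  intros; sem.
Qed.

Lemma tr_FOL_sat tR tp ts rI p s : crisp M ->
  den k e tR rI -> den k e tp p -> den k e ts s ->
  tr k e (FOL_sat tC tP tM tI tR tp ts) (fol_true M cI rI p s).
Proof. intros CM DR D D'; unfold FOL_sat, fol_true; sem. Qed.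

Section TF.
Variables (tp tn tep ten : trm) (rp rn ep en : V).
Hypothesis (Dp : den k e tp rp) (Dn : den k e tn rn) (Dep : den k e tep ep) (Den : den k e ten en).

Lemma tr_TF_model :
  tr k e (TF_model tC tP tM tI tp tn tep ten) (tf_str M cI rp rn ep en).
Proof. unfold TF_model, tf_str, is_rel_on; sem. Qed.

Lemma tr_TF_true tq ts p s : crisp M -> den k e tq p -> den k e ts s ->
  tr k e (TF_true tC tP tM tI tp tn tep ten tq ts) (tf_true M cI rp rn ep en p s).
Proof. intros CM D D'; unfold TF_true, tf_true, tf_spec; sem. Qed.
End TF.
End Structure.
Hint Resolve tr_tarski_model tr_tarski_sat tr_classical_model tr_FOL_sat tr_TF_model tr_TF_true : den.

Section Entailment.
Variables (k : nat) (e : nat -> V) (tC tP tS tp : trm) (Sigma p : V).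
Hypothesis HV : vocab C P.
Hypothesis (DC : den k e tC C) (DP : den k e tP P) (DS : den k e tS Sigma) (Dp : den k e tp p).

Lemma tr_tarski_conseq : tr k e (tarski_conseq tC tP tS tp) (tarski_entails Sigma p).
Proof. unfold tarski_conseq, tarski_entails; sem. Qed.

Lemma tr_FOL_conseq : tr k e (FOL_conseq tC tP tS tp) (fol_entails Sigma p).
Proof. unfold FOL_conseq, fol_entails; sem. Qed.

(** The restriction is evaluated for actual T/F-models only, because its strong equations reduce to
    statements on positive members only when the interpretations are crisp. *)
Lemma tr_TF_conseq restr (R : V -> V -> V -> V -> V -> Prop) :
  (forall l h tM tp tn tep ten M cI rp rn ep en, extends k e l h -> tf_str M cI rp rn ep en ->
    den l h tM M -> den l h tp rp -> den l h tn rn -> den l h tep ep -> den l h ten en ->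
    tr l h (restr tP tM tp tn tep ten) (R M rp rn ep en)) ->
  tr k e (TF_conseq restr tC tP tS tp) (tf_entails R Sigma p).
Proof.
  intros H; unfold TF_conseq, tf_entails; do 6 (apply tr_all; intros).
  apply tr_imp; [apply tr_conj; [sem|intros]|intros; sem].
  eapply H; eauto 100 with den nocore; try now exists 6.
Qed.

Lemma tr_BS4_conseq :
  tr k e (BS4_conseq tC tP tS tp) (tf_entails (fun _ _ _ _ _ => True) Sigma p).
Proof. apply tr_TF_conseq; intros; apply tr_top. Qed.

(** The left side is the strong equation of the intersection with ∅; for crisp sets its falsity half
    says the same as its truth half. *)
Lemma disjoint_iff x y : crisp x -> crisp y ->
  (forall z, (z ∊ x /\ z ∊ y <-> z ∊ emp) /\ (z ∉- x \/ z ∉- y <-> z ∉- emp)) <->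
  forall z, ~ (z ∊ x /\ z ∊ y).
Proof.
  intros X Y; split; intros H z; specialize (H z); specialize (X z); specialize (Y z);
    pose proof (emp_spec z); tauto.
Qed.

Lemma tf_str_rel M cI rp rn ep en r : tf_str M cI rp rn ep en -> r ∊ P ->
  exists x n, n ∊ om /\ r = kp x n /\ crisp (ap rp r) /\ crisp (ap rn r) /\
  (forall w, w ∊ ap rp r -> w ∊ pw M n) /\ (forall w, w ∊ ap rn r -> w ∊ pw M n).
Proof.
  intros (_ & _ & _ & _ & _ & H & _) R.
  destruct HV as (_ & _ & HP); destruct (HP r R) as (x & n & N & E).
  destruct (H r x n (conj R E)) as (Cp & Sp & Cn & Sn); exists x, n; splits; auto; intros w; [apply Sp|apply Sn].
Qed.

Lemma tr_K3imp_conseq : tr k e (K3imp_conseq tC tP tS tp) (tf_entails consistent Sigma p).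
Proof.
  apply tr_TF_conseq; intros; eapply tr_iff; [|sem]; cbv beta.
  match goal with H : tf_str _ _ _ _ _ _ |- _ => rename H into HS end.
  pose proof (fun r => @tf_str_rel M cI rp rn ep en r HS) as HR.
  destruct HS as (_ & _ & _ & _ & _ & _ & Cp & _ & Cn & _).
  unfold consistent; rewrite (disjoint_iff Cp Cn); split; intros [K1 K2]; split; auto; intros r R;
    specialize (K1 r R); destruct (HR r R) as (x & n & _ & _ & C1 & C2 & _);
    now apply (disjoint_iff C1 C2).
Qed.

Lemma un_eq_iff x y z : crisp x -> crisp y -> crisp z ->
  un x y = z <-> forall w, w ∊ z <-> w ∊ x \/ w ∊ y.
Proof.
  intros X Y Z; split.
  - intros <- w; apply un_spec.
  - intros H; apply crisp_ext; auto; intros w; [|rewrite H; apply un_spec].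
    destruct (un_spec x y w) as [-> ->]; rewrite (X w), (Y w); tauto.
Qed.

Lemma tr_LFI1_conseq : tr k e (LFI1_conseq tC tP tS tp) (tf_entails complete Sigma p).
Proof.
  apply tr_TF_conseq; intros; eapply tr_iff; [|sem]; cbv beta.
  match goal with H : tf_str _ _ _ _ _ _ |- _ => rename H into HS end.
  pose proof (fun r => @tf_str_rel M cI rp rn ep en r HS) as HR.
  destruct HS as (CM & _ & _ & _ & _ & HS & Cp & Sp & Cn & Sn & _).
  assert (E : forall r x n, r ∊ P -> r = kp x n ->
    (un (ap rp r) (ap rn r) = pw M n <-> forall w, w ∊ pw M n -> w ∊ ap rp r \/ w ∊ ap rn r)).
  { intros r x n R E; destruct (HS r x n (conj R E)) as (C1 & S1 & C2 & S2).
    rewrite (un_eq_iff C1 C2 (@crisp_pw V M n)); split; intros K w; [apply K|].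
    split; [apply K|]; intros [L|L]; [now apply S1|now apply S2]. }
  split; intros [K1 K2]; split.
  - intros r x n R E'; rewrite <- (E r x n R E'); eauto.
  - intros a b A B; apply K2; eauto.
  - intros r x n [R E']; rewrite (E r x n R E'); eauto.
  - intros z; split; split.
    + intros [Z|Z]; [now apply Sp|now apply Sn].
    + intros (a & b & -> & A & B); auto.
    + intros [L1 L2] a b; apply Cp in L1; apply Cn in L2.
      destruct (classic (z = op a b)) as [->|]; auto; right.
      destruct (classic (a ∊ M)) as [A|A]; [|left; now apply CM].
      destruct (classic (b ∊ M)) as [B|B]; [|right; now apply CM].
      destruct (K2 a b A B); tauto.
    + intros L; split; [apply Cp|apply Cn]; intros Z;
        [apply Sp in Z|apply Sn in Z]; destruct Z as (a & b & -> & A & B);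
        destruct (L a b) as [L'|[L'|L']]; auto; now apply CM in L'.
Qed.
End Entailment.

Definition coincides (entails : V -> V -> Prop) : Prop := forall Sigma p,
  (forall z, (z ∊ Sigma -> z ∊ Fm false C P) /\ (z ∉- Fm false C P -> z ∉- Sigma)) /\
  p ∊ Fm false C P -> (tarski_entails Sigma p <-> entails Sigma p).

Lemma tr_coincide k e tC tP conseq (entails : V -> V -> Prop) : vocab C P ->
  den k e tC C -> den k e tP P ->
  (forall l h tS tp Sigma p, den l h tC C -> den l h tP P -> den l h tS Sigma -> den l h tp p ->
    tr l h (conseq tC tP tS tp) (entails Sigma p)) ->
  tr k e (coincide conseq tC tP) (coincides entails).
Proof.
  intros HV DC DP H; unfold coincide, coincides; do 2 (apply tr_all; intros).
  apply tr_imp; [sem|intros _]; apply tr_fiff; [apply tr_tarski_conseq|apply H]; den.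
Qed.
End Consequence.

(** * Sets and relations with prescribed positive and negative members *)

Section Sets.
Context {V : universe}.
Implicit Types (e : nat -> V) (x y z u v w a b c d f i n s p q r S X Y M D U W : V).

Definition glut (V : universe) : Prop := exists x z : V, z ∊ x /\ z ∉- x.
Definition gap (V : universe) : Prop := exists x z : V, ~ z ∊ x /\ ~ z ∉- x.

(** A single glut of [V], taken as a parameter, gives an atomic formula that is both true and false,
    and a single gap one that is neither. They are switched on exactly where [A] and [B] overlap or
    both fail. *)
Lemma four_valued_separation D (A B : V -> Prop) : crisp D ->
  Def (fun e => A (e 0)) -> Def (fun e => B (e 0)) ->
  (forall z, z ∊ D -> A z -> B z -> glut V) -> (forall z, z ∊ D -> ~ A z -> ~ B z -> gap V) ->
  exists x, forall z, (z ∊ x <-> z ∊ D /\ A z) /\ (z ∉- x <-> ~ z ∊ D \/ B z).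
Proof.
  intros CD DA DB HG HP; destruct (Def_pair DA DB) as (p & q & c & H).
  (* Without gluts any sets may serve as [u] and [v], for then by [HG] no element of [D] satisfies
     both [A] and [B]. *)
  assert (G : exists u v : V, glut V -> u ∊ v /\ u ∉- v).
  { destruct (classic (glut V)) as [(x & z & K)|K]; [exists z, x; auto|exists D, D; tauto]. }
  assert (G' : exists u v : V, gap V -> ~ u ∊ v /\ ~ u ∉- v).
  { destruct (classic (gap V)) as [(x & z & K)|K]; [exists z, x; auto|exists D, D; tauto]. }
  destruct G as (u1 & v1 & G), G' as (u2 & v2 & G').
  pose (e := scons u1 (scons v1 (scons u2 (scons v2 c)))).
  pose (shift := rename (split_index (fun _ => 0) (fun i : nat => Datatypes.S (4 + i)))).
  assert (R : forall y phi, truth V (scons y e) (shift phi) <-> truth V (mix (fun _ => y) c) phi).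
  { intros y phi; apply truth_rename_mix; intros j; auto. }
  (* A is the truth and B the falsity of (A ∧ ¬B) ∨ (A ∧ B ∧ γ) ∨ (¬A ∧ ¬B ∧ κ), for a glut γ
     and a gap κ. *)
  pose (a := FNot (FImp (shift p) FBot)); pose (b := FNot (FImp (shift q) FBot)).
  pose (na := FImp (shift p) FBot); pose (nb := FImp (shift q) FBot).
  destruct (comprehension (FOr (FAnd a nb) (FOr (FAnd a (FAnd b (FIn 1 2)))
    (FAnd na (FAnd nb (FIn 3 4))))) e D) as [x K]; exists x; intros y.
  destruct (K y) as [K1 K2]; clear K; destruct (H (fun _ => y)) as [HA HB].
  unfold a, b, na, nb in K1, K2; cbn -[shift e] in K1, K2.
  rewrite !R, HA, HB in K1, K2; cbn in K1, K2.
  specialize (HG y); specialize (HP y); specialize (CD y); clear R H HA HB DA DB.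
  rewrite K1, K2; clear K1 K2.
  destruct (classic (y ∊ D)), (classic (A y)), (classic (B y)); tauto.
Qed.

(** Knaster and Tarski: [U] is the union of all sets [W] whose elements lie in [D] and satisfy
    [Phi W]. *)
Lemma greatest_fixpoint D (Phi : V -> V -> Prop) : Def (fun e => Phi (e 0) (e 1)) ->
  (forall W W' w, (forall z, z ∊ W -> z ∊ W') -> Phi W w -> Phi W' w) ->
  exists U, crisp U /\ forall w, w ∊ U <-> w ∊ D /\ Phi U w.
Proof.
  intros DPhi Mono.
  assert (HD : forall g h, DefF g -> DefF h -> Def (fun e => Phi (g e) (h e)))
    by (intros g h; now apply Def_atom).
  pose (R := fun w => w ∊ D /\ exists W, (forall z, z ∊ W -> z ∊ D /\ Phi W z) /\ w ∊ W).
  assert (DR : Def (fun e => R (e 0))) by (unfold R; defi).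
  assert (BR : bounded R) by (exists D; unfold R; tauto).
  exists (csetof R); split; [now apply crisp_csetof|].
  assert (E := csetof_in DR BR); set (U := csetof R) in *.
  assert (F : forall w, w ∊ U -> w ∊ D /\ Phi U w).
  { intros w Hw; apply E in Hw; destruct Hw as (HwD & W & HW & K); split; [auto|].
    apply (Mono W U); [|now apply HW].
    intros z Hz; apply E; split; [now apply HW|exists W; auto]. }
  intros w; split; [apply F|]; intros [HwD HwP]; apply E; split; [auto|].
  (* Adding [w] to [U] gives another post-fixed set, by monotonicity, so [w] was already in [U]. *)
  exists (un U (pr w w)); split; [|apply un_spec; right; apply pr_in; auto].
  assert (I : forall z, z ∊ U -> z ∊ un U (pr w w)) by (intros z Hz; apply un_spec; auto).
  intros z Hz; apply un_spec in Hz; destruct Hz as [Hz|Hz].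
  - apply F in Hz; destruct Hz as [H1 H2]; split; [auto|now apply (Mono U)].
  - apply pr_in in Hz; assert (z = w) as -> by tauto; split; [auto|now apply (Mono U)].
Qed.

Section Pairs.
Variables A B : V.

Definition pairs : V := csetof (fun w => exists p s, p ∊ A /\ s ∊ B /\ w = kp p s).

Lemma pairs_aux : Def (fun e => exists p s, p ∊ A /\ s ∊ B /\ e 0 = kp p s) /\
  bounded (fun w => exists p s, p ∊ A /\ s ∊ B /\ w = kp p s).
Proof.
  split; [defi|]; apply (bounded_img2 kp); [defi| |]; apply bounded_set.
Qed.

Lemma pairs_in p s : kp p s ∊ pairs <-> p ∊ A /\ s ∊ B.
Proof.
  unfold pairs; rewrite (csetof_in (proj1 pairs_aux) (proj2 pairs_aux)); split.
  - intros (p' & s' & Hp & Hs & E); apply kp_inj in E; destruct E; now subst.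
  - intros [Hp Hs]; eauto.
Qed.

Lemma crisp_pairs : crisp pairs.
Proof. apply crisp_csetof; apply pairs_aux. Qed.

Lemma pairs_inv w : w ∊ pairs -> exists p s, p ∊ A /\ s ∊ B /\ w = kp p s.
Proof. apply (csetof_in (proj1 pairs_aux) (proj2 pairs_aux)). Qed.

Lemma four_valued_relation (R Q : V -> V -> Prop) :
  Def (fun e => R (e 0) (e 1)) -> Def (fun e => Q (e 0) (e 1)) ->
  (forall p s, p ∊ A -> s ∊ B -> R p s -> Q p s -> glut V) ->
  (forall p s, p ∊ A -> s ∊ B -> ~ R p s -> ~ Q p s -> gap V) ->
  exists S, forall p s, p ∊ A -> s ∊ B -> (posin S p s <-> R p s) /\ (negin S p s <-> Q p s).
Proof.
  intros DR DQ HG HP.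
  assert (DR' := fun g h => @Def_atom V R g h DR).
  assert (DQ' := fun g h => @Def_atom V Q g h DQ).
  assert (E : forall (R : V -> V -> Prop) p s,
    (exists p' s', kp p s = kp p' s' /\ R p' s') <-> R p s).
  { intros R' p s; split; [|eauto]; intros (p' & s' & E & K); apply kp_inj in E.
    destruct E; now subst. }
  destruct (@four_valued_separation pairs (fun w => exists p s, w = kp p s /\ R p s)
    (fun w => exists p s, w = kp p s /\ Q p s)) as [S HS].
  - apply crisp_pairs.
  - defi.
  - defi.
  - intros z Z K L; apply pairs_inv in Z; destruct Z as (p & s & Hp & Hs & ->).
    apply E in K; apply E in L; eauto.
  - intros z Z K L; apply pairs_inv in Z; destruct Z as (p & s & Hp & Hs & ->).
    rewrite E in K, L; eauto.
  - exists S; intros p s Hp Hs; unfold posin, negin; destruct (HS (kp p s)) as [-> ->].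
    rewrite !E, pairs_in; tauto.
Qed.

Lemma crisp_relation (R : V -> V -> Prop) : Def (fun e => R (e 0) (e 1)) ->
  exists X, crisp X /\ forall p s, p ∊ A -> s ∊ B -> (posin X p s <-> R p s).
Proof.
  intros DR; assert (DR' := fun g h => @Def_atom V R g h DR).
  pose (Q := fun w => w ∊ pairs /\ exists p s, w = kp p s /\ R p s).
  assert (DQ : Def (fun e => Q (e 0))) by (unfold Q; defi).
  assert (BQ : bounded Q) by (exists pairs; unfold Q; tauto).
  exists (csetof Q); split; [now apply crisp_csetof|].
  intros p s Hp Hs; unfold posin; rewrite (csetof_in DQ BQ); unfold Q; rewrite pairs_in; split.
  - intros [_ (p' & s' & E & K)]; apply kp_inj in E; destruct E; now subst.
  - intros K; split; [auto|eauto].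
Qed.
End Pairs.
End Sets.

(** * Existence of satisfaction relations *)

Section Existence.
Context {V : universe}.
Implicit Types (e : nat -> V) (x y z u v w a b c d f i n s p q r S X Y D U W : V).

Section Conditions.
Variables (M : V) (Eq Rel : V -> V -> V -> Prop) (same neg ant : V -> V -> Prop).

(* With same = T, neg = F and ant = "not T" this is the condition for the truth of p, with F, T
   and T in these places [ncond] is the condition for its falsity.  The conditions for "not T"
   and "not F" have the same two shapes, and all four are positive in same, neg and ant. *)
Definition pcond p s : Prop :=
  (exists x y, p = eqc x y /\ Eq x y s) \/ (exists r f, p = relc r f /\ Rel r f s) \/
  (exists q, p = notc q /\ neg q s) \/
  (exists q r, p = andc q r /\ same q s /\ same r s) \/
  (exists q r, p = orc q r /\ (same q s \/ same r s)) \/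
  (exists q r, p = impc q r /\ (ant q s \/ same r s)) \/
  (exists n q, p = exc n q /\ exists a, a ∊ M /\ same q (up s n a)) \/
  (exists n q, p = allc n q /\ forall a, a ∊ M -> same q (up s n a)).

Definition ncond p s : Prop :=
  (exists x y, p = eqc x y /\ Eq x y s) \/ (exists r f, p = relc r f /\ Rel r f s) \/
  (exists q, p = notc q /\ neg q s) \/
  (exists q r, p = andc q r /\ (same q s \/ same r s)) \/
  (exists q r, p = orc q r /\ same q s /\ same r s) \/
  (exists q r, p = impc q r /\ ant q s /\ same r s) \/ p = botc \/
  (exists n q, p = exc n q /\ forall a, a ∊ M -> same q (up s n a)) \/
  (exists n q, p = allc n q /\ exists a, a ∊ M /\ same q (up s n a)).

Ltac code_cases H :=
  unfold eqc, relc, notc, andc, orc, impc, botc, exc, allc in H;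
  repeat match type of H with
  | _ \/ _ => destruct H as [H|H]
  | ex _ => destruct H as [? H]
  end;
  let E := fresh in
  match type of H with
  | _ = _ => rename H into E
  | _ /\ _ => destruct H as [E H]
  end;
  apply kp_inj in E; destruct E as [E ?]; apply nm_inj in E; try discriminate E; clear E;
  repeat match goal with
  | E : kp _ _ = kp _ _ |- _ => apply kp_inj in E; destruct E as [? ?]
  end; subst.

Ltac cond_intro H := lazymatch goal with
  | |- (exists x y, ?f _ _ = ?f x y /\ _) \/ _ => left; do 2 eexists; split; [reflexivity|exact H]
  | |- (exists x, ?f _ = ?f x /\ _) \/ _ => left; eexists; split; [reflexivity|exact H]
  | |- ?c = ?c \/ _ => left; reflexivity
  | |- _ \/ _ => right; cond_intro H
  | |- _ => do 2 eexists; split; [reflexivity|exact H]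
  end.
Ltac cond_code := split; [intros H; code_cases H; first [exact H|exact I]|intros H; cond_intro H].

Lemma pcond_eq x y s : pcond (eqc x y) s <-> Eq x y s.
Proof. unfold pcond; cond_code. Qed.
Lemma ncond_eq x y s : ncond (eqc x y) s <-> Eq x y s.
Proof. unfold ncond; cond_code. Qed.
Lemma pcond_rel r f s : pcond (relc r f) s <-> Rel r f s.
Proof. unfold pcond; cond_code. Qed.
Lemma ncond_rel r f s : ncond (relc r f) s <-> Rel r f s.
Proof. unfold ncond; cond_code. Qed.
Lemma pcond_not q s : pcond (notc q) s <-> neg q s.
Proof. unfold pcond; cond_code. Qed.
Lemma ncond_not q s : ncond (notc q) s <-> neg q s.
Proof. unfold ncond; cond_code. Qed.
Lemma pcond_and q r s : pcond (andc q r) s <-> same q s /\ same r s.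
Proof. unfold pcond; cond_code. Qed.
Lemma ncond_and q r s : ncond (andc q r) s <-> same q s \/ same r s.
Proof. unfold ncond; cond_code. Qed.
Lemma pcond_or q r s : pcond (orc q r) s <-> same q s \/ same r s.
Proof. unfold pcond; cond_code. Qed.
Lemma ncond_or q r s : ncond (orc q r) s <-> same q s /\ same r s.
Proof. unfold ncond; cond_code. Qed.
Lemma pcond_imp q r s : pcond (impc q r) s <-> ant q s \/ same r s.
Proof. unfold pcond; cond_code. Qed.
Lemma ncond_imp q r s : ncond (impc q r) s <-> ant q s /\ same r s.
Proof. unfold ncond; cond_code. Qed.
Lemma pcond_bot s : pcond botc s <-> False.
Proof. unfold pcond; split; [intros H; code_cases H|easy]. Qed.
Lemma ncond_bot s : ncond botc s <-> True.
Proof. unfold ncond; cond_code. Qed.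
Lemma pcond_ex n q s : pcond (exc n q) s <-> exists a, a ∊ M /\ same q (up s n a).
Proof. unfold pcond; cond_code. Qed.
Lemma ncond_ex n q s : ncond (exc n q) s <-> forall a, a ∊ M -> same q (up s n a).
Proof. unfold ncond; cond_code. Qed.
Lemma pcond_all n q s : pcond (allc n q) s <-> forall a, a ∊ M -> same q (up s n a).
Proof. unfold pcond; cond_code. Qed.
Lemma ncond_all n q s : ncond (allc n q) s <-> exists a, a ∊ M /\ same q (up s n a).
Proof. unfold ncond; cond_code. Qed.
End Conditions.

Lemma pcond_mono M Eq Rel (same neg ant same' neg' ant' : V -> V -> Prop) p s :
  (forall q s, same q s -> same' q s) -> (forall q s, neg q s -> neg' q s) ->
  (forall q s, ant q s -> ant' q s) ->
  pcond M Eq Rel same neg ant p s -> pcond M Eq Rel same' neg' ant' p s.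
Proof.
  intros H1 H2 H3; unfold pcond; intros H.
  repeat match type of H with _ \/ _ => destruct H as [H|H] end.
  - now left.
  - now right; left.
  - do 2 right; left; destruct H as (q & E & H); exists q; auto.
  - do 3 right; left; destruct H as (q & r & E & H & H'); exists q, r; auto.
  - do 4 right; left; destruct H as (q & r & E & [H|H]); exists q, r; auto.
  - do 5 right; left; destruct H as (q & r & E & [H|H]); exists q, r; auto.
  - do 6 right; left; destruct H as (n & q & E & a & A & H); exists n, q; eauto.
  - do 7 right; destruct H as (n & q & E & H); exists n, q; auto.
Qed.

Lemma ncond_mono M Eq Rel (same neg ant same' neg' ant' : V -> V -> Prop) p s :
  (forall q s, same q s -> same' q s) -> (forall q s, neg q s -> neg' q s) ->
  (forall q s, ant q s -> ant' q s) ->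
  ncond M Eq Rel same neg ant p s -> ncond M Eq Rel same' neg' ant' p s.
Proof.
  intros H1 H2 H3; unfold ncond; intros H.
  repeat match type of H with _ \/ _ => destruct H as [H|H] end.
  - now left.
  - now right; left.
  - do 2 right; left; destruct H as (q & E & H); exists q; auto.
  - do 3 right; left; destruct H as (q & r & E & [H|H]); exists q, r; auto.
  - do 4 right; left; destruct H as (q & r & E & H & H'); exists q, r; auto.
  - do 5 right; left; destruct H as (q & r & E & H & H'); exists q, r; auto.
  - now do 6 right; left.
  - do 7 right; left; destruct H as (n & q & E & H); exists n, q; auto.
  - do 8 right; destruct H as (n & q & E & a & A & H); exists n, q; eauto.
Qed.
End Existence.

Lemma not_and_dual (A B : Prop) : ~ A \/ ~ B <-> ~ (A /\ B).
Proof. destruct (classic A), (classic B); tauto. Qed.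
Lemma not_or_dual (A B : Prop) : ~ A /\ ~ B <-> ~ (A \/ B).
Proof. tauto. Qed.
Lemma not_imp_dual (A B : Prop) : A /\ ~ B <-> ~ (~ A \/ B).
Proof. destruct (classic A), (classic B); tauto. Qed.

Lemma not_ex_dual (T : Type) (D A B : T -> Prop) : (forall a, D a -> (B a <-> ~ A a)) ->
  (forall a, D a -> B a) <-> ~ (exists a, D a /\ A a).
Proof.
  intros E; split; [intros H [a [Da Aa]]; exact (proj1 (E a Da) (H a Da) Aa)|].
  intros H a Da; apply (E a Da); intros Aa; apply H; exists a; auto.
Qed.
Lemma not_all_dual (T : Type) (D A B : T -> Prop) : (forall a, D a -> (B a <-> ~ A a)) ->
  (exists a, D a /\ B a) <-> ~ (forall a, D a -> A a).
Proof.
  intros E; split; [intros [a [Da Ba]] H; exact (proj1 (E a Da) Ba (H a Da))|].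
  intros H; apply NNPP; intros N; apply H; intros a Da; apply NNPP; intros K.
  apply N; exists a; split; [exact Da|now apply E].
Qed.

Section Existence.
Context {V : universe}.
Implicit Types (e : nat -> V) (x y z u v w a b c d f i n s p q r S X Y D U W : V).
Variables (C P M cI : V) (eqp eqn Rp Rn : V -> V -> Prop).
Hypothesis HV : vocab C P.
Hypothesis (Deqp : Def (fun e => eqp (e 0) (e 1))) (Deqn : Def (fun e => eqn (e 0) (e 1)))
  (DRp : Def (fun e => Rp (e 0) (e 1))) (DRn : Def (fun e => Rn (e 0) (e 1))).

Lemma up_pw s n a : s ∊ pw M om -> n ∊ om -> a ∊ M -> up s n a ∊ pw M om.
Proof. rewrite !pw_in; intros; now apply up_isfun. Qed.

(** One set [W] codes four relations, distinguished by a tag: 0 for truth, 1 for falsity, 2 and 3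
    for their intended complements. *)
Let lv (j : nat) W p s : Prop := kp (nm j) (kp p s) ∊ W.
Let Eq (R : V -> V -> Prop) x y s : Prop := R (vl cI s x) (vl cI s y).
Let Rel (R : V -> V -> Prop) r f s : Prop := exists x n, r = kp x n /\ R r (vls cI s n f).

(** In the truth condition of an implication (level 0) the failure of the antecedent is expressed by
    level 2, and level 3 uses level 2 in the same way. Hence all levels occur positively. *)
Let Phi W w : Prop := exists p s,
  (w = kp (nm 0) (kp p s) /\ pcond M (Eq eqp) (Rel Rp) (lv 0 W) (lv 1 W) (lv 2 W) p s) \/
  (w = kp (nm 1) (kp p s) /\ ncond M (Eq eqn) (Rel Rn) (lv 1 W) (lv 0 W) (lv 0 W) p s) \/
  (w = kp (nm 2) (kp p s) /\ ncond M (Eq (fun a b => ~ eqp a b))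
    (Rel (fun a b => ~ Rp a b)) (lv 2 W) (lv 3 W) (lv 0 W) p s) \/
  (w = kp (nm 3) (kp p s) /\ pcond M (Eq (fun a b => ~ eqn a b))
    (Rel (fun a b => ~ Rn a b)) (lv 3 W) (lv 2 W) (lv 2 W) p s).

Lemma RelE (R : V -> V -> Prop) r x n f s : r = kp x n -> (Rel R r f s <-> R r (vls cI s n f)).
Proof.
  intros E; split; [|intros L; exists x, n; auto]; intros (x' & n' & E' & L).
  rewrite E in E'; apply kp_inj in E'; destruct E'; now subst.
Qed.

Lemma satisfaction_fixpoint : exists U, forall p s, p ∊ Fm true C P -> s ∊ pw M om ->
  (lv 0 U p s <-> pcond M (Eq eqp) (Rel Rp) (lv 0 U) (lv 1 U) (lv 2 U) p s) /\
  (lv 1 U p s <-> ncond M (Eq eqn) (Rel Rn) (lv 1 U) (lv 0 U) (lv 0 U) p s) /\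
  (lv 2 U p s <-> ncond M (Eq (fun a b => ~ eqp a b)) (Rel (fun a b => ~ Rp a b))
    (lv 2 U) (lv 3 U) (lv 0 U) p s) /\
  (lv 3 U p s <-> pcond M (Eq (fun a b => ~ eqn a b)) (Rel (fun a b => ~ Rn a b))
    (lv 3 U) (lv 2 U) (lv 2 U) p s).
Proof.
  destruct (@greatest_fixpoint V (pairs om (pairs (Fm true C P) (pw M om))) Phi) as (U & _ & HU).
  - assert (D1 := fun g h => @Def_atom V _ g h Deqp); assert (D2 := fun g h => @Def_atom V _ g h Deqn).
    assert (D3 := fun g h => @Def_atom V _ g h DRp); assert (D4 := fun g h => @Def_atom V _ g h DRn).
    unfold Phi, pcond, ncond, lv, Eq, Rel, eqc, relc, notc, andc, orc, impc, botc, exc, allc; defi.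
  - intros W W' w Sub (p & s & H); exists p, s.
    assert (L : forall j q s, lv j W q s -> lv j W' q s) by (intros j q t; apply Sub).
    destruct H as [[E H]|[[E H]|[[E H]|[E H]]]].
    + left; split; [auto|]; eapply pcond_mono; [..|exact H]; apply L.
    + right; left; split; [auto|]; eapply ncond_mono; [..|exact H]; apply L.
    + do 2 right; left; split; [auto|]; eapply ncond_mono; [..|exact H]; apply L.
    + do 3 right; split; [auto|]; eapply pcond_mono; [..|exact H]; apply L.
  - exists U; intros p s Hp Hs.
    assert (HD : forall j : nat, kp (nm j) (kp p s) ∊ pairs om (pairs (Fm true C P) (pw M om))).
    { intros j; apply pairs_in; split; [apply nm_om|now apply pairs_in]. }
    splits; unfold lv at 1; rewrite HU; unfold Phi; split.
    2: intros H; split; [apply HD|exists p, s; left; split; [reflexivity|exact H]].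
    3: intros H; split; [apply HD|exists p, s; right; left; split; [reflexivity|exact H]].
    4: intros H; split; [apply HD|exists p, s; do 2 right; left; split; [reflexivity|exact H]].
    5: intros H; split; [apply HD|exists p, s; do 3 right; split; [reflexivity|exact H]].
    all: intros (_ & p' & s' & H); repeat match type of H with _ \/ _ => destruct H as [H|H] end;
      destruct H as [E H]; apply kp_inj in E; destruct E as [E E'];
      apply nm_inj in E; try discriminate E; apply kp_inj in E'; destruct E' as [-> ->]; exact H.
Qed.

(** The fixed point equations do not say that levels 2 and 3 are complements of levels 0 and 1.
    Induction on formulas shows it, each clause being dual to its counterpart, and then the equation
    for implications at level 0 becomes the required clause. *)
Lemma sat_exists : exists X Y, crisp X /\ crisp Y /\
  sat_spec C P M cI eqp eqn Rp Rn (posin X) (posin Y).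
Proof.
  destruct satisfaction_fixpoint as [U HU].
  pose proof (Fm_closed true HV) as (F1 & F2 & F3 & F4 & F5 & F6 & F7 & F8 & F9).
  assert (H0 : forall p s, p ∊ Fm true C P -> s ∊ pw M om ->
    (lv 0 U p s <-> pcond M (Eq eqp) (Rel Rp) (lv 0 U) (lv 1 U) (lv 2 U) p s)) by apply HU.
  assert (H1 : forall p s, p ∊ Fm true C P -> s ∊ pw M om ->
    (lv 1 U p s <-> ncond M (Eq eqn) (Rel Rn) (lv 1 U) (lv 0 U) (lv 0 U) p s)) by apply HU.
  assert (H2 : forall p s, p ∊ Fm true C P -> s ∊ pw M om ->
    (lv 2 U p s <-> ncond M (Eq (fun a b => ~ eqp a b)) (Rel (fun a b => ~ Rp a b))
    (lv 2 U) (lv 3 U) (lv 0 U) p s)) by apply HU.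
  assert (H3 : forall p s, p ∊ Fm true C P -> s ∊ pw M om ->
    (lv 3 U p s <-> pcond M (Eq (fun a b => ~ eqn a b)) (Rel (fun a b => ~ Rn a b))
    (lv 3 U) (lv 2 U) (lv 2 U) p s)) by apply HU.
  clear HU.
  pose (Q := fun p => forall s, s ∊ pw M om ->
    (lv 2 U p s <-> ~ lv 0 U p s) /\ (lv 3 U p s <-> ~ lv 1 U p s)).
  assert (N : forall p, p ∊ Fm true C P -> Q p).
  { assert (DN : Def (fun e => Q (e 0))) by (unfold Q, lv; defi).
    assert (J : forall s, s ∊ pw M om -> forall p, p ∊ Fm true C P ->
      (ncond M (Eq (fun a b => ~ eqp a b)) (Rel (fun a b => ~ Rp a b)) (lv 2 U) (lv 3 U) (lv 0 U) p s
        <-> ~ pcond M (Eq eqp) (Rel Rp) (lv 0 U) (lv 1 U) (lv 2 U) p s) /\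
      (pcond M (Eq (fun a b => ~ eqn a b)) (Rel (fun a b => ~ Rn a b)) (lv 3 U) (lv 2 U) (lv 2 U) p s
        <-> ~ ncond M (Eq eqn) (Rel Rn) (lv 1 U) (lv 0 U) (lv 0 U) p s) ->
      (lv 2 U p s <-> ~ lv 0 U p s) /\ (lv 3 U p s <-> ~ lv 1 U p s)).
    { intros s Hs p Hp; now rewrite <- H0, <- H1, <- H2, <- H3. }
    apply (@Fm_ind V true C P Q HV DN); unfold fclosed; splits; cbv beta.
    - intros x y K; pose proof (F1 x y K) as A; split; [exact A|]; intros s Hs; apply J; auto.
      rewrite !pcond_eq, !ncond_eq; unfold Eq; clear; tauto.
    - intros r x n f K; pose proof (F2 r x n f K) as A; split; [exact A|]; intros s Hs; apply J; auto.
      rewrite !pcond_rel, !ncond_rel, !(RelE _ _ _ (proj1 (proj2 K))); clear; tauto.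
    - intros p [K L]; pose proof (F3 p K) as A; split; [exact A|]; intros s Hs; apply J; auto.
      rewrite !pcond_not, !ncond_not; exact (conj (proj2 (L s Hs)) (proj1 (L s Hs))).
    - intros p q [[Kp Lp] [Kq Lq]]; pose proof (F4 p q (conj Kp Kq)) as A; split; [exact A|].
      intros s Hs; apply J; auto; rewrite !pcond_and, !ncond_and.
      destruct (Lp s Hs) as [-> ->], (Lq s Hs) as [-> ->]; clear.
      split; [apply not_and_dual|apply not_or_dual].
    - intros p q [[Kp Lp] [Kq Lq]]; pose proof (F5 p q (conj Kp Kq)) as A; split; [exact A|].
      intros s Hs; apply J; auto; rewrite !pcond_or, !ncond_or.
      destruct (Lp s Hs) as [-> ->], (Lq s Hs) as [-> ->]; clear.
      split; [apply not_or_dual|apply not_and_dual].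
    - intros n p [Hn [K L]]; pose proof (F6 n p (conj Hn K)) as A; split; [exact A|].
      intros s Hs; apply J; auto; rewrite !pcond_ex, !ncond_ex.
      assert (LL := fun a Ha => L (up s n a) (up_pw Hs Hn Ha)); clear -LL; split.
      + apply not_ex_dual; intros a Ha; exact (proj1 (LL a Ha)).
      + apply not_all_dual; intros a Ha; exact (proj2 (LL a Ha)).
    - intros n p [Hn [K L]]; pose proof (F7 n p (conj Hn K)) as A; split; [exact A|].
      intros s Hs; apply J; auto; rewrite !pcond_all, !ncond_all.
      assert (LL := fun a Ha => L (up s n a) (up_pw Hs Hn Ha)); clear -LL; split.
      + apply not_all_dual; intros a Ha; exact (proj1 (LL a Ha)).
      + apply not_ex_dual; intros a Ha; exact (proj2 (LL a Ha)).
    - intros p q [[Kp Lp] [Kq Lq]]; pose proof (F8 p q (conj Kp Kq)) as A; split; [exact A|].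
      intros s Hs; apply J; auto; rewrite !pcond_imp, !ncond_imp.
      destruct (Lp s Hs) as [-> _], (Lq s Hs) as [-> ->]; clear.
      split; [apply not_imp_dual|apply not_and_dual].
    - exact F9.
    - intros s Hs; apply J; auto; rewrite !pcond_bot, !ncond_bot; clear; tauto. }
  assert (NT : forall p s, p ∊ Fm true C P -> s ∊ pw M om -> (lv 2 U p s <-> ~ lv 0 U p s))
    by (intros p s Hp Hs; apply (N p Hp s Hs)).
  destruct (@crisp_relation V (Fm true C P) (pw M om) (lv 0 U)) as (X & CX & HX);
    [unfold lv; defi|].
  destruct (@crisp_relation V (Fm true C P) (pw M om) (lv 1 U)) as (Y & CY & HY);
    [unfold lv; defi|].
  exists X, Y; splits; auto; clear N H2 H3; constructor.
  - intros s x y Hs Hx Hy; pose proof (F1 x y (conj Hx Hy)) as A.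
    rewrite HX, HY, H0, H1, pcond_eq, ncond_eq by assumption; split; reflexivity.
  - intros s r x n f Hs Hr E Hf; pose proof (F2 r x n f (conj Hr (conj E Hf))) as A.
    rewrite HX, HY, H0, H1, pcond_rel, ncond_rel, !(RelE _ _ _ E) by assumption; split; reflexivity.
  - intros s p Hs Hp; pose proof (F3 p Hp) as A.
    rewrite !HX, !HY, (H0 (notc p)), (H1 (notc p)), pcond_not, ncond_not by assumption.
    split; reflexivity.
  - intros s p q Hs Hp Hq; pose proof (F4 p q (conj Hp Hq)) as A.
    rewrite !HX, !HY, (H0 (andc p q)), (H1 (andc p q)), pcond_and, ncond_and by assumption.
    split; reflexivity.
  - intros s p q Hs Hp Hq; pose proof (F5 p q (conj Hp Hq)) as A.
    rewrite !HX, !HY, (H0 (orc p q)), (H1 (orc p q)), pcond_or, ncond_or by assumption.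
    split; reflexivity.
  - intros s p q Hs Hp Hq; pose proof (F8 p q (conj Hp Hq)) as A.
    rewrite !HX, !HY, (H0 (impc p q)), (H1 (impc p q)), pcond_imp, ncond_imp, NT by assumption.
    split; [|reflexivity]; destruct (classic (lv 0 U p s)); tauto.
  - intros s Hs; rewrite HX, HY, H0, H1, pcond_bot, ncond_bot by assumption; split; auto.
  - intros s n p Hs Hn Hp; pose proof (F6 n p (conj Hn Hp)) as A.
    assert (L : forall a, a ∊ M -> up s n a ∊ pw M om) by (intros a Ha; now apply up_pw).
    rewrite HX, HY, H0, H1, pcond_ex, ncond_ex by assumption; split.
    + split; intros [a [Ha K]]; exists a; (split; [exact Ha|]); apply (HX p _ Hp (L a Ha)), K.
    + split; intros K a Ha; apply (HY p _ Hp (L a Ha)), (K a Ha).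
  - intros s n p Hs Hn Hp; pose proof (F7 n p (conj Hn Hp)) as A.
    assert (L : forall a, a ∊ M -> up s n a ∊ pw M om) by (intros a Ha; now apply up_pw).
    rewrite HX, HY, H0, H1, pcond_all, ncond_all by assumption; split.
    + split; intros K a Ha; apply (HX p _ Hp (L a Ha)), (K a Ha).
    + split; intros [a [Ha K]]; exists a; (split; [exact Ha|]); apply (HY p _ Hp (L a Ha)), K.
Qed.
End Existence.

(** * Transfer between structures *)

Section Transfer.
Context {V : universe}.
Implicit Types (e : nat -> V) (x y z u v w a b c d f i n s p q r S X Y D U W M : V).
Variables (C P : V).
Hypothesis HV : vocab C P.

Lemma vl_in M cI s x : isfun cI C (fun y => y ∊ M) -> s ∊ pw M om -> x ∊ tm C -> vl cI s x ∊ M.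
Proof.
  intros HI Hs Hx; apply pw_in in Hs; apply tm_in in Hx; destruct Hx as [[n [N ->]]|[c [Hc ->]]].
  - rewrite vl_vc; now apply (isfun_ap Hs).
  - rewrite vl_cc; now apply (isfun_ap HI).
Qed.

Lemma vls_in M cI s n f : isfun cI C (fun y => y ∊ M) -> s ∊ pw M om ->
  isfun f n (fun y => y ∊ tm C) -> vls cI s n f ∊ pw M n.
Proof.
  intros HI Hs Hf; apply pw_in, isfun_lam; [apply Hf|defi|].
  intros i Hi; apply vl_in; auto; now apply (isfun_ap Hf).
Qed.

Lemma ap_vls M cI s n f i : i ∊ n -> ap (vls cI s n f) i = vl cI s (ap f i).
Proof. intros Hi; apply (@ap_lam V (fun i => vl cI s (ap f i))); [defi|auto]. Qed.

(** Pulls satisfaction back along a surjection [g] of domains, with [sigma] its action on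
    assignments. With identities it exchanges different representations of one satisfaction
    relation; with the inverse of an isomorphism it moves satisfaction to another model. *)
Lemma sat_transfer M cI M' cI' (g sigma : V -> V)
    (eqp eqn Rp Rn T F eqp' eqn' Rp' Rn' T' F' : V -> V -> Prop) :
  (forall s, s ∊ pw M' om -> sigma s ∊ pw M om) ->
  (forall a, a ∊ M' -> g a ∊ M) -> (forall b, b ∊ M -> exists a, a ∊ M' /\ g a = b) ->
  (forall s n a, s ∊ pw M' om -> n ∊ om -> a ∊ M' -> sigma (up s n a) = up (sigma s) n (g a)) ->
  (forall s x y, s ∊ pw M' om -> x ∊ tm C -> y ∊ tm C ->
    (eqp (vl cI (sigma s) x) (vl cI (sigma s) y) <-> eqp' (vl cI' s x) (vl cI' s y)) /\
    (eqn (vl cI (sigma s) x) (vl cI (sigma s) y) <-> eqn' (vl cI' s x) (vl cI' s y))) ->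
  (forall s r x n f, s ∊ pw M' om -> r ∊ P -> r = kp x n -> isfun f n (fun y => y ∊ tm C) ->
    (Rp r (vls cI (sigma s) n f) <-> Rp' r (vls cI' s n f)) /\
    (Rn r (vls cI (sigma s) n f) <-> Rn' r (vls cI' s n f))) ->
  (forall p s, p ∊ Fm true C P -> s ∊ pw M' om ->
    (T' p s <-> T p (sigma s)) /\ (F' p s <-> F p (sigma s))) ->
  sat_spec C P M cI eqp eqn Rp Rn T F -> sat_spec C P M' cI' eqp' eqn' Rp' Rn' T' F'.
Proof.
  intros Hsigma Hg Hsurj Hup Heq Hrel HTF [H1 H2 H3 H4 H5 H6 H7 H8 H9].
  pose proof (Fm_closed true HV) as (F1 & F2 & F3 & F4 & F5 & F6 & F7 & F8 & F9).
  assert (HT : forall p s, p ∊ Fm true C P -> s ∊ pw M' om -> (T' p s <-> T p (sigma s)))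
    by (intros p s Hp Hs; apply (HTF p s Hp Hs)).
  assert (HF : forall p s, p ∊ Fm true C P -> s ∊ pw M' om -> (F' p s <-> F p (sigma s)))
    by (intros p s Hp Hs; apply (HTF p s Hp Hs)).
  clear HTF.
  assert (Q1 : forall (R' R : V -> V -> Prop) s n p, p ∊ Fm true C P -> s ∊ pw M' om -> n ∊ om ->
    (forall p s, p ∊ Fm true C P -> s ∊ pw M' om -> (R' p s <-> R p (sigma s))) ->
    ((forall a, a ∊ M' -> R' p (up s n a)) <-> (forall b, b ∊ M -> R p (up (sigma s) n b)))).
  { intros R' R s n p Hp Hs Hn HR; split; intros K.
    - intros b Hb; destruct (Hsurj b Hb) as [a [Ha <-]]; rewrite <- (Hup s n a Hs Hn Ha).
      apply (HR p _ Hp (up_pw Hs Hn Ha)), (K a Ha).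
    - intros a Ha; apply (HR p _ Hp (up_pw Hs Hn Ha)).
      rewrite (Hup s n a Hs Hn Ha); apply (K _ (Hg a Ha)). }
  assert (Q2 : forall (R' R : V -> V -> Prop) s n p, p ∊ Fm true C P -> s ∊ pw M' om -> n ∊ om ->
    (forall p s, p ∊ Fm true C P -> s ∊ pw M' om -> (R' p s <-> R p (sigma s))) ->
    ((exists a, a ∊ M' /\ R' p (up s n a)) <-> (exists b, b ∊ M /\ R p (up (sigma s) n b)))).
  { intros R' R s n p Hp Hs Hn HR; split.
    - intros [a [Ha K]]; exists (g a); split; [now apply Hg|].
      rewrite <- (Hup s n a Hs Hn Ha); apply (HR p _ Hp (up_pw Hs Hn Ha)), K.
    - intros [b [Hb K]]; destruct (Hsurj b Hb) as [a [Ha <-]]; exists a; split; [exact Ha|].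
      apply (HR p _ Hp (up_pw Hs Hn Ha)); rewrite (Hup s n a Hs Hn Ha); exact K. }
  constructor.
  - intros s x y Hs Hx Hy; pose proof (F1 x y (conj Hx Hy)) as A.
    rewrite HT, HF by assumption; destruct (Heq s x y Hs Hx Hy) as [<- <-].
    exact (H1 (sigma s) x y (Hsigma s Hs) Hx Hy).
  - intros s r x n f Hs Hr E Hf; pose proof (F2 r x n f (conj Hr (conj E Hf))) as A.
    rewrite HT, HF by assumption; destruct (Hrel s r x n f Hs Hr E Hf) as [<- <-].
    exact (H2 (sigma s) r x n f (Hsigma s Hs) Hr E Hf).
  - intros s p Hs Hp; pose proof (F3 p Hp) as A.
    rewrite !HT, !HF by assumption; exact (H3 (sigma s) p (Hsigma s Hs) Hp).
  - intros s p q Hs Hp Hq; pose proof (F4 p q (conj Hp Hq)) as A.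
    rewrite !HT, !HF by assumption; exact (H4 (sigma s) p q (Hsigma s Hs) Hp Hq).
  - intros s p q Hs Hp Hq; pose proof (F5 p q (conj Hp Hq)) as A.
    rewrite !HT, !HF by assumption; exact (H5 (sigma s) p q (Hsigma s Hs) Hp Hq).
  - intros s p q Hs Hp Hq; pose proof (F8 p q (conj Hp Hq)) as A.
    rewrite !HT, !HF by assumption; exact (H6 (sigma s) p q (Hsigma s Hs) Hp Hq).
  - intros s Hs; rewrite HT, HF by assumption; exact (H7 (sigma s) (Hsigma s Hs)).
  - intros s n p Hs Hn Hp; pose proof (F6 n p (conj Hn Hp)) as A.
    rewrite HT, HF, (Q1 F' F), (Q2 T' T) by assumption.
    exact (H8 (sigma s) n p (Hsigma s Hs) Hn Hp).
  - intros s n p Hs Hn Hp; pose proof (F7 n p (conj Hn Hp)) as A.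
    rewrite HT, HF, (Q1 T' T), (Q2 F' F) by assumption.
    exact (H9 (sigma s) n p (Hsigma s Hs) Hn Hp).
Qed.

Section Induction.
Variables (M cI : V) (eqp eqn Rp Rn T F : V -> V -> Prop).
Hypothesis HI : isfun cI C (fun y => y ∊ M).
Hypothesis (DT : Def (fun e => T (e 0) (e 1))) (DF : Def (fun e => F (e 0) (e 1))).
Hypothesis HS : sat_spec C P M cI eqp eqn Rp Rn T F.

Lemma sat_consistent :
  (forall a b, a ∊ M -> b ∊ M -> ~ (eqp a b /\ eqn a b)) ->
  (forall r w, r ∊ P -> ~ (Rp r w /\ Rn r w)) ->
  forall p, p ∊ Fm true C P -> forall s, s ∊ pw M om -> ~ (T p s /\ F p s).
Proof.
  intros Heq Hrel; destruct HS as [H1 H2 H3 H4 H5 H6 H7 H8 H9].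
  pose proof (Fm_closed true HV) as (F1 & F2 & F3 & F4 & F5 & F6 & F7 & F8 & F9).
  assert (D : Def (fun e => forall s, s ∊ pw M om -> ~ (T (e 0) s /\ F (e 0) s))).
  { assert (D1 := fun g h => @Def_atom V _ g h DT); assert (D2 := fun g h => @Def_atom V _ g h DF).
    defi. }
  apply (@Fm_ind V true C P (fun p => forall s, s ∊ pw M om -> ~ (T p s /\ F p s)) HV D).
  unfold fclosed; splits.
  - intros x y K; split; [exact (F1 x y K)|]; intros s Hs; destruct K as [Hx Hy].
    destruct (H1 s x y Hs Hx Hy) as [-> ->]; apply Heq; now apply vl_in.
  - intros r x n f K; split; [exact (F2 r x n f K)|]; intros s Hs; destruct K as (Hr & E & Hf).
    destruct (H2 s r x n f Hs Hr E Hf) as [-> ->]; now apply Hrel.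
  - intros p [K L]; split; [exact (F3 p K)|]; intros s Hs.
    destruct (H3 s p Hs K) as [-> ->]; specialize (L s Hs); clear -L; tauto.
  - intros p q [[Kp Lp] [Kq Lq]]; split; [exact (F4 p q (conj Kp Kq))|]; intros s Hs.
    destruct (H4 s p q Hs Kp Kq) as [-> ->]; specialize (Lp s Hs); specialize (Lq s Hs).
    clear -Lp Lq; tauto.
  - intros p q [[Kp Lp] [Kq Lq]]; split; [exact (F5 p q (conj Kp Kq))|]; intros s Hs.
    destruct (H5 s p q Hs Kp Kq) as [-> ->]; specialize (Lp s Hs); specialize (Lq s Hs).
    clear -Lp Lq; tauto.
  - intros n p [Hn [K L]]; split; [exact (F6 n p (conj Hn K))|]; intros s Hs.
    destruct (H8 s n p Hs Hn K) as [-> ->]; intros [[a [Ha Ta]] G].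
    exact (L _ (up_pw Hs Hn Ha) (conj Ta (G a Ha))).
  - intros n p [Hn [K L]]; split; [exact (F7 n p (conj Hn K))|]; intros s Hs.
    destruct (H9 s n p Hs Hn K) as [-> ->]; intros [G [a [Ha Ta]]].
    exact (L _ (up_pw Hs Hn Ha) (conj (G a Ha) Ta)).
  - intros p q [[Kp Lp] [Kq Lq]]; split; [exact (F8 p q (conj Kp Kq))|]; intros s Hs.
    destruct (H6 s p q Hs Kp Kq) as [-> ->]; specialize (Lp s Hs); specialize (Lq s Hs).
    clear -Lp Lq; tauto.
  - exact F9.
  - intros s Hs [K _]; now apply (H7 s Hs).
Qed.

Lemma sat_complete :
  (forall a b, a ∊ M -> b ∊ M -> eqp a b \/ eqn a b) ->
  (forall r x n w, r ∊ P -> r = kp x n -> w ∊ pw M n -> Rp r w \/ Rn r w) ->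
  forall p, p ∊ Fm true C P -> forall s, s ∊ pw M om -> T p s \/ F p s.
Proof.
  intros Heq Hrel; destruct HS as [H1 H2 H3 H4 H5 H6 H7 H8 H9].
  pose proof (Fm_closed true HV) as (F1 & F2 & F3 & F4 & F5 & F6 & F7 & F8 & F9).
  assert (D : Def (fun e => forall s, s ∊ pw M om -> T (e 0) s \/ F (e 0) s)).
  { assert (D1 := fun g h => @Def_atom V _ g h DT); assert (D2 := fun g h => @Def_atom V _ g h DF).
    defi. }
  apply (@Fm_ind V true C P (fun p => forall s, s ∊ pw M om -> T p s \/ F p s) HV D).
  unfold fclosed; splits.
  - intros x y K; split; [exact (F1 x y K)|]; intros s Hs; destruct K as [Hx Hy].
    destruct (H1 s x y Hs Hx Hy) as [-> ->]; apply Heq; now apply vl_in.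
  - intros r x n f K; split; [exact (F2 r x n f K)|]; intros s Hs; destruct K as (Hr & E & Hf).
    destruct (H2 s r x n f Hs Hr E Hf) as [-> ->]; apply (Hrel r x n); auto.
    now apply vls_in.
  - intros p [K L]; split; [exact (F3 p K)|]; intros s Hs.
    destruct (H3 s p Hs K) as [-> ->]; specialize (L s Hs); clear -L; tauto.
  - intros p q [[Kp Lp] [Kq Lq]]; split; [exact (F4 p q (conj Kp Kq))|]; intros s Hs.
    destruct (H4 s p q Hs Kp Kq) as [-> ->]; specialize (Lp s Hs); specialize (Lq s Hs).
    clear -Lp Lq; tauto.
  - intros p q [[Kp Lp] [Kq Lq]]; split; [exact (F5 p q (conj Kp Kq))|]; intros s Hs.
    destruct (H5 s p q Hs Kp Kq) as [-> ->]; specialize (Lp s Hs); specialize (Lq s Hs).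
    clear -Lp Lq; tauto.
  - intros n p [Hn [K L]]; split; [exact (F6 n p (conj Hn K))|]; intros s Hs.
    destruct (H8 s n p Hs Hn K) as [-> ->].
    destruct (classic (exists a, a ∊ M /\ T p (up s n a))) as [G|G]; [now left|right].
    intros a Ha; destruct (L _ (up_pw Hs Hn Ha)) as [Ta|Fa]; [|exact Fa].
    destruct G; exists a; exact (conj Ha Ta).
  - intros n p [Hn [K L]]; split; [exact (F7 n p (conj Hn K))|]; intros s Hs.
    destruct (H9 s n p Hs Hn K) as [-> ->].
    destruct (classic (exists a, a ∊ M /\ F p (up s n a))) as [G|G]; [now right|left].
    intros a Ha; destruct (L _ (up_pw Hs Hn Ha)) as [Ta|Fa]; [exact Ta|].
    destruct G; exists a; exact (conj Ha Fa).
  - intros p q [[Kp Lp] [Kq Lq]]; split; [exact (F8 p q (conj Kp Kq))|]; intros s Hs.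
    destruct (H6 s p q Hs Kp Kq) as [-> ->]; specialize (Lp s Hs); specialize (Lq s Hs).
    clear -Lp Lq; destruct (classic (T p s)); tauto.
  - exact F9.
  - intros s Hs; right; now apply (H7 s Hs).
Qed.
End Induction.
End Transfer.

(** * From Tarski models to T/F-models *)

Section TarskiAsTF.
Context {V : universe}.
Implicit Types (e : nat -> V) (x y z u v w a b c d f i n s p q r S X Y D U W M : V).

Lemma isfun_lam_strong (G : V -> V) A : crisp A -> DefF (fun e => G (e 0)) ->
  exists B, isfun (lam G A) A (fun y => y ∊ B /\ ~ y ∉- B).
Proof.
  intros CA DG; destruct (bounded_img G DG (bounded_set A)) as [u U].
  destruct (superset u) as [B [CB [HB _]]]; exists B; apply isfun_lam; auto.
  intros x Hx; assert (K : G x ∊ B) by (apply HB, U; exists x; auto).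
  split; [exact K|]; intros N; now apply CB in N.
Qed.

Section RelationSet.
Variables (M : V) (R : V -> V -> Prop).
Hypothesis DR : Def (fun e => R (e 0) (e 1)).

Definition rel_set : V := csetof (fun w => exists a b, a ∊ M /\ b ∊ M /\ R a b /\ w = op a b).

Lemma rel_set_aux : Def (fun e => exists a b, a ∊ M /\ b ∊ M /\ R a b /\ e 0 = op a b) /\
  bounded (fun w => exists a b, a ∊ M /\ b ∊ M /\ R a b /\ w = op a b).
Proof.
  split.
  - assert (D := fun g h => @Def_atom V R g h DR); defi.
  - apply bounded_sub with (fun w => exists a b, a ∊ M /\ b ∊ M /\ w = op a b).
    + intros w (a & b & A & B & _ & E); eauto.
    + apply (bounded_img2 op); [defi| |]; apply bounded_set.
Qed.

Lemma rel_set_in a b : op a b ∊ rel_set <-> a ∊ M /\ b ∊ M /\ R a b.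
Proof.
  unfold rel_set; rewrite (csetof_in (proj1 rel_set_aux) (proj2 rel_set_aux)); split.
  - intros (a' & b' & A & B & K & E); apply op_inj in E; destruct E; now subst.
  - intros (A & B & K); exists a, b; auto.
Qed.

Lemma rel_set_inv w : w ∊ rel_set -> exists a b, w = op a b /\ a ∊ M /\ b ∊ M.
Proof.
  intros H; apply (csetof_in (proj1 rel_set_aux) (proj2 rel_set_aux)) in H.
  destruct H as (a & b & A & B & _ & E); exists a, b; auto.
Qed.

Lemma crisp_rel_set : crisp rel_set.
Proof. apply crisp_csetof; apply rel_set_aux. Qed.

Lemma rel_set_on : crisp M -> is_rel_on M rel_set.
Proof.
  intros CM z; split; [apply rel_set_inv|]; intros H; apply crisp_rel_set; intros K.
  apply rel_set_inv in K; destruct K as (a & b & -> & A & B).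
  destruct (H a b) as [N|[N|N]]; [now apply N|now apply (CM a)|now apply (CM b)].
Qed.
End RelationSet.

(** By [eq_neg_iff] the falsity of [a = b], written through membership so that it is visibly
    definable. *)
Definition neq a b : Prop := exists z, (z ∊ a /\ z ∉- b) \/ (z ∊ b /\ z ∉- a).

Lemma neq_glut a : neq a a -> glut V.
Proof. intros [z [K|K]]; exists a, z; tauto. Qed.

Lemma eq_or_neq a b : ~ gap V -> a = b \/ neq a b.
Proof.
  intros NG; destruct (classic (neq a b)) as [N|N]; [now right|left].
  assert (G : forall x z, z ∊ x \/ z ∉- x).
  { intros x z; apply NNPP; intros K; apply NG; exists x, z; tauto. }
  assert (K : forall z, ~ (z ∊ a /\ z ∉- b) /\ ~ (z ∊ b /\ z ∉- a)).
  { intros z; split; intros K; apply N; exists z; auto. }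
  apply extensionality; intros z; destruct (K z) as [K1 K2];
    destruct (G a z), (G b z); tauto.
Qed.

Variables (C P : V).
Hypothesis HV : vocab C P.

Lemma tf_spec_consistent M cI rp rn ep en X Y : isfun cI C (fun y => y ∊ M) ->
  consistent P M rp rn ep en -> tf_spec C P M cI rp rn ep en X Y ->
  forall p s, p ∊ Fm true C P -> s ∊ pw M om -> ~ (posin X p s /\ posin Y p s).
Proof.
  intros HI [N1 N2] HS p s Hp Hs.
  refine (sat_consistent HV HI _ _ HS _ _ Hp Hs).
  - unfold posin; defi.
  - unfold posin; defi.
  - intros a b _ _; apply N2.
  - intros r w Hr; now apply N1.
Qed.

Lemma tf_spec_complete M cI rp rn ep en X Y : isfun cI C (fun y => y ∊ M) ->
  complete P M rp rn ep en -> tf_spec C P M cI rp rn ep en X Y ->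
  forall p s, p ∊ Fm true C P -> s ∊ pw M om -> posin X p s \/ posin Y p s.
Proof.
  intros HI [N1 N2] HS p s Hp Hs.
  refine (sat_complete HV HI _ _ HS N2 _ Hp Hs).
  - unfold posin; defi.
  - unfold posin; defi.
  - intros r x n w Hr E; now apply N1 with x.
Qed.

Section Model.
Variables (M cI rI : V).
Hypothesis HT : tarski_str C P M cI rI.

Let posr r : V := csetof (fun w => w ∊ ap rI r).
(** Everything outside [M^n] is a negative member of the interpretation of [r], so the negative part
    has to be cut down to [M^n]; the arity is read off the symbol. *)
Let negr r : V := csetof (fun w => w ∉- ap rI r /\ exists x n, r = kp x n /\ w ∊ pw M n).

Lemma posr_spec r w : (w ∊ posr r <-> w ∊ ap rI r) /\ (w ∉- posr r <-> ~ w ∊ ap rI r).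
Proof. apply (csetof_spec (P := fun w => w ∊ ap rI r)); [defi|apply bounded_set]. Qed.

Lemma negr_spec r w :
  (w ∊ negr r <-> w ∉- ap rI r /\ exists x n, r = kp x n /\ w ∊ pw M n) /\
  (w ∉- negr r <-> ~ (w ∉- ap rI r /\ exists x n, r = kp x n /\ w ∊ pw M n)).
Proof.
  apply (csetof_spec (P := fun w => w ∉- ap rI r /\ exists x n, r = kp x n /\ w ∊ pw M n)); [defi|].
  destruct (classic (exists x n, r = kp x n)) as [(x & n & E)|N].
  - exists (pw M n); intros z (_ & x' & n' & E' & K); rewrite E in E'; apply kp_inj in E'.
    destruct E'; now subst.
  (* If [r] is not a pair, the class is empty and any set bounds it. *)
  - exists M; intros z (_ & x' & n' & E' & K); destruct N; eauto.
Qed.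

Let rp : V := lam posr P.
Let rn : V := lam negr P.

Lemma ap_rp r : r ∊ P -> ap rp r = posr r.
Proof. apply ap_lam; unfold posr; defi. Qed.

Lemma ap_rn r : r ∊ P -> ap rn r = negr r.
Proof. apply ap_lam; unfold negr; defi. Qed.

Lemma ap_rn_in r x n w : r ∊ P -> r = kp x n -> w ∊ pw M n ->
  (w ∊ ap rn r <-> w ∉- ap rI r).
Proof.
  intros Hr E Hw; rewrite (ap_rn Hr), (proj1 (negr_spec r w)); split; [tauto|].
  intros K; split; [exact K|]; exists x, n; auto.
Qed.

(** The clauses on [en], [rp] and [rn] describe the T/F-model closely enough to recognise a given
    T/F-model as isomorphic to it, which [tf_as_tarski] requires. *)
Lemma tarski_as_tf : exists rp rn ep en, tf_str C P M cI rp rn ep en /\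
  (~ glut V -> consistent P M rp rn ep en) /\ (~ gap V -> complete P M rp rn ep en) /\
  (forall a b, a ∊ M -> b ∊ M -> (op a b ∊ en <-> neq a b)) /\
  (forall r x n w, r ∊ P -> r = kp x n -> w ∊ pw M n ->
    (w ∊ ap rp r <-> w ∊ ap rI r) /\ (w ∊ ap rn r <-> w ∉- ap rI r)) /\
  forall p s, p ∊ Fm true C P -> s ∊ pw M om ->
  (tarski_true C P M cI rI p s <-> tf_true C P M cI rp rn ep en p s).
Proof.
  pose proof HT as (CM & NM & HI & _ & HR).
  assert (Deq : Def (fun e : nat -> V => e 0 = e 1)) by defi.
  assert (Dneq : Def (fun e : nat -> V => neq (e 0) (e 1))) by (unfold neq; defi).
  pose (ep := rel_set M eq); pose (en := rel_set M neq).
  assert (Hep : forall a b, op a b ∊ ep <-> a ∊ M /\ b ∊ M /\ a = b)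
    by (intros a b; apply (rel_set_in M Deq)).
  assert (Hen : forall a b, op a b ∊ en <-> a ∊ M /\ b ∊ M /\ neq a b)
    by (intros a b; apply (rel_set_in M Dneq)).
  assert (HP : forall r w, r ∊ P -> (w ∊ ap rp r <-> w ∊ ap rI r)).
  { intros r w Hr; rewrite (ap_rp Hr); apply posr_spec. }
  assert (cons : ~ glut V -> consistent P M rp rn ep en).
  { intros NG; split.
    - intros r Hr w [K1 K2]; apply (HP r w Hr) in K1; rewrite (ap_rn Hr) in K2.
      apply (negr_spec r w) in K2; apply NG; exists (ap rI r), w; tauto.
    - intros w [K1 K2]; assert (K := K1); apply (rel_set_inv Deq) in K.
      destruct K as (a & b & -> & _); apply Hep in K1; apply Hen in K2.
      destruct K1 as (_ & _ & <-), K2 as (_ & _ & K2); now apply NG, neq_glut with a. }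
  assert (comp : ~ gap V -> complete P M rp rn ep en).
  { intros NG; split.
    - intros r x n Hr E w Hw; rewrite (HP r w Hr), (ap_rn_in Hr E Hw).
      apply NNPP; intros K; apply NG; exists (ap rI r), w; tauto.
    - intros a b Ha Hb; rewrite Hep, Hen; destruct (eq_or_neq a b NG); tauto. }
  exists rp, rn, ep, en; splits; auto.
  - unfold tf_str; splits; auto.
    + apply isfun_lam_strong; [apply HV|unfold posr; defi].
    + apply isfun_lam_strong; [apply HV|unfold negr; defi].
    + intros r x n [Hr E]; rewrite (ap_rp Hr), (ap_rn Hr); splits.
      * intros w; destruct (posr_spec r w) as [-> ->]; tauto.
      * intros w; destruct (posr_spec r w) as [-> ->].
        destruct (HR r x n (conj Hr E) w) as [K1 K2]; split; [exact K1|].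
        intros N L; now apply (crisp_pw M n) in N; auto.
      * intros w; destruct (negr_spec r w) as [-> ->]; tauto.
      * assert (K : forall w, w ∊ negr r -> w ∊ pw M n).
        { intros w K; apply (negr_spec r w) in K; destruct K as (_ & x' & n' & E' & K).
          rewrite E in E'; apply kp_inj in E'; destruct E'; now subst. }
        intros w; split; [apply K|]; intros N; apply negr_spec; intros L.
        apply (crisp_pw M n) in N; apply N, K, negr_spec, L.
    + apply (crisp_rel_set M Deq).
    + now apply rel_set_on.
    + apply (crisp_rel_set M Dneq).
    + now apply rel_set_on.
    + intros a b; rewrite !Hen; intros (Ha & Hb & z & K); splits; auto; exists z; tauto.
    + intros a b [Ha Hb]; rewrite Hep; tauto.
  - intros a b Ha Hb; rewrite Hen; tauto.
  - intros r x n w Hr E Hw; split; [now apply HP|now apply (ap_rn_in Hr E)].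
  - intros p s Hp Hs.
    assert (Heq : forall s x y, s ∊ pw M om -> x ∊ tm C -> y ∊ tm C ->
      (op (vl cI s x) (vl cI s y) ∊ ep <-> vl cI s x = vl cI s y) /\
      (op (vl cI s x) (vl cI s y) ∊ en <-> eq_neg V (vl cI s x) (vl cI s y))).
    { intros t x y Ht Hx Hy; pose proof (vl_in HI Ht Hx); pose proof (vl_in HI Ht Hy).
      rewrite Hep, Hen, eq_neg_iff; fold (neq (vl cI t x) (vl cI t y)); tauto. }
    assert (Hrel : forall s r x n f, s ∊ pw M om -> r ∊ P -> r = kp x n ->
      isfun f n (fun y => y ∊ tm C) ->
      (vls cI s n f ∊ ap rp r <-> vls cI s n f ∊ ap rI r) /\
      (vls cI s n f ∊ ap rn r <-> vls cI s n f ∉- ap rI r)).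
    { intros t r x n f Ht Hr E Hf; split; [now apply HP|].
      apply (ap_rn_in Hr E); now apply vls_in with C. }
    split.
    + intros (S & HS & K).
      destruct (@crisp_relation V (Fm true C P) (pw M om) (posin S)) as (X & CX & HX);
        [unfold posin; defi|].
      destruct (@crisp_relation V (Fm true C P) (pw M om) (negin S)) as (Y & CY & HY);
        [unfold negin; defi|].
      exists X; split; [|now apply HX]; exists Y; splits; auto.
      revert HS; apply (@sat_transfer V C P HV M cI M cI (fun a => a) (fun s => s)); auto.
      * eauto.
      * intros t x y Ht Hx Hy; destruct (Heq t x y Ht Hx Hy); split; symmetry; assumption.
      * intros t r x n f Ht Hr E Hf; destruct (Hrel t r x n f Ht Hr E Hf); split; symmetry; assumption.
    + intros (X & (Y & CX & CY & HS) & K).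
      destruct (@four_valued_relation V (Fm true C P) (pw M om) (posin X) (posin Y)) as [S HSS].
      * unfold posin; defi.
      * unfold posin; defi.
      * intros q t Hq Ht K1 K2; apply NNPP; intros NG.
        exact (tf_spec_consistent HI (cons NG) HS Hq Ht (conj K1 K2)).
      * intros q t Hq Ht K1 K2; apply NNPP; intros NG.
        destruct (tf_spec_complete HI (comp NG) HS Hq Ht) as [K3|K3];
          [exact (K1 K3)|exact (K2 K3)].
      * exists S; split; [|now apply HSS].
        revert HS; apply (@sat_transfer V C P HV M cI M cI (fun a => a) (fun s => s)); auto.
        eauto.
Qed.
End Model.
End TarskiAsTF.

(** * Isomorphisms of T/F-models *)

Section Isomorphism.
Context {V : universe}.
Implicit Types (e : nat -> V) (x y z u v w a b c d i n s p q r S X Y D U W M : V).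
Variables (C P : V).
Hypothesis HV : vocab C P.

(** The action of [g] on [n]-tuples, and for [n = om] on assignments. *)
Definition mp (g : V -> V) n w : V := lam (fun i => g (ap w i)) n.

Section Map.
Variable g : V -> V.
Hypothesis Dg : DefF (fun e => g (e 0)).

Lemma DefF_mp (h j : (nat -> V) -> V) : DefF h -> DefF j -> DefF (fun e => mp g (h e) (j e)).
Proof.
  assert (D := fun h => @DefF_fun V g h Dg).
  apply (@DefF_fun2 V (mp g)); unfold mp, lam; defi.
Qed.

Lemma DefF_mp_body w : DefF (fun e => g (ap w (e 0))).
Proof. assert (D := fun h => @DefF_fun V g h Dg); defi. Qed.

Lemma isfun_mp n w (A B : V -> Prop) : (forall y, A y -> B (g y)) ->
  isfun w n A -> isfun (mp g n w) n B.
Proof.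
  intros H Hw; apply isfun_lam; [apply Hw|apply DefF_mp_body|].
  intros i Hi; apply H; now apply (isfun_ap Hw).
Qed.

Lemma ap_mp n w i : i ∊ n -> ap (mp g n w) i = g (ap w i).
Proof. apply (@ap_lam V (fun i => g (ap w i))), DefF_mp_body. Qed.

Lemma mp_pw M M' n w : (forall a, a ∊ M -> g a ∊ M') -> w ∊ pw M n -> mp g n w ∊ pw M' n.
Proof. intros H; rewrite !pw_in; now apply isfun_mp. Qed.

Lemma mp_up s n a M M' : (forall a, a ∊ M -> g a ∊ M') -> s ∊ pw M om -> n ∊ om -> a ∊ M ->
  mp g om (up s n a) = up (mp g om s) n (g a).
Proof.
  intros H Hs Hn Ha; pose proof (up_pw Hs Hn Ha) as Hu.
  pose proof (mp_pw H Hs) as Hm; apply pw_in in Hs.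
  pose proof (mp_pw H Hu) as F; apply pw_in in Hu; apply pw_in in Hm; apply pw_in in F.
  apply (isfun_ext F (up_isfun Hm Hn (H a Ha))); intros i Hi; rewrite (ap_mp _ Hi).
  destruct (ap_up Hs Hn Ha Hi) as [U1 U2], (ap_up Hm Hn (H a Ha) Hi) as [U3 U4].
  destruct (classic (i = n)) as [E|E].
  - now rewrite (U1 E), (U3 E).
  - now rewrite (U2 E), (U4 E), ap_mp.
Qed.
End Map.

Lemma mp_mp f g n w M : DefF (fun e => f (e 0)) -> DefF (fun e => g (e 0)) ->
  (forall a, a ∊ M -> g (f a) = a) -> w ∊ pw M n -> mp g n (mp f n w) = w.
Proof.
  intros Df Dg H Hw; apply pw_in in Hw.
  assert (F : isfun (mp g n (mp f n w)) n (fun _ => True)).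
  { apply (isfun_mp Dg (A := fun _ => True)); [auto|].
    now apply (isfun_mp Df (A := fun y => y ∊ M)). }
  apply (isfun_ext F Hw); intros i Hi; rewrite !ap_mp by assumption.
  now apply H, (isfun_ap Hw).
Qed.

(** Positive equality is absent because [tf_str] makes it the identity. The maps have to be
    definable so that tuples and satisfaction sets can be carried along them inside [V]. *)
Definition tf_iso M cI rp rn en M' cI' rp' rn' en' (f g : V -> V) : Prop :=
  DefF (fun e => f (e 0)) /\ DefF (fun e => g (e 0)) /\
  (forall a, a ∊ M -> f a ∊ M' /\ g (f a) = a) /\ (forall b, b ∊ M' -> g b ∊ M /\ f (g b) = b) /\
  (forall c, c ∊ C -> ap cI c ∊ M /\ ap cI' c = f (ap cI c)) /\
  (forall a b, a ∊ M -> b ∊ M -> (op a b ∊ en <-> op (f a) (f b) ∊ en')) /\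
  (forall r x n w, r ∊ P -> r = kp x n -> w ∊ pw M n ->
    (w ∊ ap rp r <-> mp f n w ∊ ap rp' r) /\ (w ∊ ap rn r <-> mp f n w ∊ ap rn' r)).

Lemma tf_iso_sym M cI rp rn en M' cI' rp' rn' en' f g :
  tf_iso M cI rp rn en M' cI' rp' rn' en' f g -> tf_iso M' cI' rp' rn' en' M cI rp rn en g f.
Proof.
  intros (Df & Dg & Hf & Hg & Hc & He & Hr); unfold tf_iso; splits; auto.
  - intros c Hc'; destruct (Hc c Hc') as [A E]; rewrite E; split; [now apply Hf|].
    symmetry; now apply Hf.
  - intros a b Ha Hb; destruct (Hg a Ha) as [A EA], (Hg b Hb) as [B EB].
    rewrite (He (g a) (g b) A B), EA, EB; tauto.
  - intros r x n w R E Hw.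
    assert (K : mp g n w ∊ pw M n) by (apply (mp_pw Dg (M := M')); auto; intros a Ha; now apply Hg).
    destruct (Hr r x n _ R E K) as [-> ->].
    rewrite (mp_mp Dg Df (M := M')); auto; [tauto|]; intros a Ha; now apply Hg.
Qed.

(** The truth and falsity sets are pulled back along the inverse [g], to which [sat_transfer]
    applies. One direction is enough, as [tf_iso] is symmetric. *)
Lemma tf_iso_true M cI rp rn ep en M' cI' rp' rn' ep' en' f g p s :
  tf_str C P M cI rp rn ep en -> tf_str C P M' cI' rp' rn' ep' en' ->
  tf_iso M cI rp rn en M' cI' rp' rn' en' f g -> p ∊ Fm true C P -> s ∊ pw M om ->
  tf_true C P M cI rp rn ep en p s -> tf_true C P M' cI' rp' rn' ep' en' p (mp f om s).
Proof.
  intros HM HM' I Hp Hs (X & (Y & CX & CY & HS) & K).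
  pose proof (tf_iso_sym I) as (_ & _ & _ & _ & Hc & He & Hr).
  destruct I as (Df & Dg & Hf & Hg & _).
  assert (GM : forall a, a ∊ M' -> g a ∊ M) by (intros a Ha; now apply Hg).
  assert (FM : forall a, a ∊ M -> f a ∊ M') by (intros a Ha; now apply Hf).
  assert (Dm : forall h j, DefF h -> DefF j -> DefF (fun e => mp g (h e) (j e)))
    by (intros h j; now apply DefF_mp).
  destruct (@crisp_relation V (Fm true C P) (pw M' om) (fun p s => posin X p (mp g om s)))
    as (X' & CX' & HX'); [unfold posin; defi|].
  destruct (@crisp_relation V (Fm true C P) (pw M' om) (fun p s => posin Y p (mp g om s)))
    as (Y' & CY' & HY'); [unfold posin; defi|].
  assert (EV : forall s x, s ∊ pw M' om -> x ∊ tm C -> vl cI (mp g om s) x = g (vl cI' s x)).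
  { intros t x Ht Hx; apply tm_in in Hx; destruct Hx as [[n [Hn ->]]|[c [Hc' ->]]].
    - rewrite !vl_vc; now apply ap_mp.
    - rewrite !vl_cc; now apply Hc. }
  exists X'; split.
  2:{ apply HX'; [exact Hp|now apply (mp_pw Df FM)|].
      rewrite (mp_mp Df Dg (M := M)); auto; intros a Ha; now apply Hf. }
  exists Y'; splits; auto; revert HS.
  pose proof HM as (_ & _ & HI & _ & _ & _ & _ & _ & _ & _ & _ & Hep).
  pose proof HM' as (_ & _ & HI' & _ & _ & _ & _ & _ & _ & _ & _ & Hep').
  apply (@sat_transfer V C P HV M cI M' cI' g (mp g om)).
  - intros t; now apply mp_pw.
  - exact GM.
  - intros b Hb; exists (f b); now apply Hf.
  - intros t n a Ht Hn Ha; now apply (mp_up Dg GM).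
  - intros t x y Ht Hx Hy; rewrite !EV by assumption.
    pose proof (vl_in HI' Ht Hx) as Vx; pose proof (vl_in HI' Ht Hy) as Vy.
    split; [|symmetry; now apply He].
    rewrite Hep, Hep' by auto; split; [|congruence]; intros E.
    rewrite <- (proj2 (Hg _ Vx)), <- (proj2 (Hg _ Vy)); congruence.
  - intros t r x n h Ht R E Hh.
    assert (EL : vls cI (mp g om t) n h = mp g n (vls cI' t n h)).
    { pose proof (vls_in HI (mp_pw Dg GM Ht) Hh) as L; pose proof (vls_in HI' Ht Hh) as L'.
      assert (L'' := mp_pw Dg GM L'); apply pw_in in L; apply pw_in in L''.
      apply (isfun_ext L L''); intros i Hi; rewrite ap_mp, !ap_vls by assumption.
      apply EV; [exact Ht|now apply (isfun_ap Hh)]. }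
    rewrite EL; destruct (Hr r x n (vls cI' t n h) R E) as [-> ->]; [|tauto].
    now apply vls_in with C.
  - intros q t Hq Ht; split; [now apply HX'|now apply HY'].
Qed.
End Isomorphism.

(** * From T/F-models to Tarski models *)

Section TFAsTarski.
Context {V : universe}.
Implicit Types (e : nat -> V) (x y z u v w a b c d i n s p q r S X Y D U W : V).
Variables (C P : V).
Hypothesis HV : vocab C P.
Variables (M cI rp rn ep en : V).
Hypothesis HM : tf_str C P M cI rp rn ep en.
Hypothesis cons : ~ glut V -> consistent P M rp rn ep en.
Hypothesis comp : ~ gap V -> complete P M rp rn ep en.

(* A copy of a whose membership relation is the equality of the T/F-model: b is a positive member
   iff b =^+ a, and a negative member iff b =^- a or b is not in M. *)
Let f a : V := setof (fun z => z ∊ M /\ z = a) (fun z => ~ z ∊ M \/ op a z ∊ en).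

(** The inverse of [f], given by the members of its value to keep it definable: at [y = f a] both
    conditions reduce to membership in [a]. *)
Let g y : V := setof (fun z => exists a, a ∊ M /\ y = f a /\ z ∊ a)
  (fun z => forall a, ~ (a ∊ M /\ y = f a) \/ z ∉- a).

Lemma copy_DefF : DefF (fun e => f (e 0)) /\ DefF (fun e => g (e 0)).
Proof.
  assert (Df : forall h, DefF h -> DefF (fun e => f (h e))).
  { intros h; apply (@DefF_fun V f); unfold f; defi. }
  split; [apply Df; defi|unfold g; defi].
Qed.

(** The copy has a glut only at [z = a] when [a =^- a], and a gap only at some [z] in [M] with
    neither [a =^+ z] nor [a =^- z]. The first violates consistency and the second completeness of
    the model, so [V] has the glut or gap needed. *)
Lemma copy_spec a : a ∊ M ->
  has_members (fun z => z ∊ M /\ z = a) (fun z => ~ z ∊ M \/ op a z ∊ en) (f a).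
Proof.
  intros Ha; apply setof_spec.
  pose proof HM as (CM & _ & _ & _ & _ & _ & _ & _ & _ & _ & _ & Hep).
  apply (@four_valued_separation V M (fun z => z = a) (fun z => op a z ∊ en) CM); [defi|defi| |].
  - intros z _ -> K; apply NNPP; intros N; destruct (cons N) as [_ N2].
    apply (N2 (op a a)); split; [now apply Hep|exact K].
  - intros z Hz N1 N2; apply NNPP; intros N; destruct (comp N) as [_ K].
    destruct (K a z Ha Hz) as [K'|K']; [apply Hep in K'; auto|auto].
Qed.

Lemma copy_in a z : a ∊ M -> (z ∊ f a <-> z ∊ M /\ z = a) /\ (z ∉- f a <-> ~ z ∊ M \/ op a z ∊ en).
Proof. intros Ha; apply (copy_spec Ha). Qed.

Lemma copy_inj a b : a ∊ M -> b ∊ M -> f a = f b -> a = b.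
Proof.
  intros Ha Hb E; apply (copy_in a Hb); rewrite <- E; now apply (copy_in a Ha).
Qed.

Lemma copy_inv a : a ∊ M -> g (f a) = a.
Proof.
  intros Ha; apply setof_unique; intros z; split; split.
  - intros K; exists a; auto.
  - intros (b & Hb & E & K); now rewrite (copy_inj Ha Hb E).
  - intros K b; destruct (classic (b ∊ M /\ f a = f b)) as [[Hb E]|N]; [right|left; exact N].
    now rewrite <- (copy_inj Ha Hb E).
  - intros K; destruct (K a) as [N|N]; [destruct N; auto|exact N].
Qed.

(** The only positive member of [f b] is [b], and [b] is a negative member of [f a] iff [a =^- b].
    The other disjunct of [neq] gives [b =^- a], hence the appeal to symmetry. *)
Lemma copy_neq a b : a ∊ M -> b ∊ M -> (neq (f a) (f b) <-> op a b ∊ en).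
Proof.
  pose proof HM as (_ & _ & _ & _ & _ & _ & _ & _ & _ & _ & Hsym & _).
  intros Ha Hb; split.
  - intros [z [[K1 K2]|[K1 K2]]].
    + apply (copy_in z Ha) in K1; apply (copy_in z Hb) in K2; destruct K1 as [_ ->].
      destruct K2 as [K2|K2]; [easy|now apply Hsym].
    + apply (copy_in z Hb) in K1; apply (copy_in z Ha) in K2; destruct K1 as [_ ->].
      destruct K2 as [K2|K2]; [easy|exact K2].
  - intros K; exists b; right; split; [now apply (copy_in b Hb)|].
    apply (copy_in b Ha); now right.
Qed.

Let M' : V := csetof (fun y => exists a, a ∊ M /\ y = f a).

Lemma M'_aux : Def (fun e => exists a, a ∊ M /\ e 0 = f a) /\ bounded (fun y => exists a, a ∊ M /\ y = f a).
Proof.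
  assert (Df := fun h => @DefF_fun V f h (proj1 copy_DefF)).
  split; [defi|]; apply (bounded_img f); [apply copy_DefF|apply bounded_set].
Qed.

Lemma M'_in y : y ∊ M' <-> exists a, a ∊ M /\ y = f a.
Proof. revert y; exact (csetof_in (proj1 M'_aux) (proj2 M'_aux)). Qed.

Lemma crisp_M' : crisp M'.
Proof. apply crisp_csetof; apply M'_aux. Qed.

Lemma copy_M' a : a ∊ M -> f a ∊ M'.
Proof. intros Ha; apply M'_in; eauto. Qed.

Lemma inv_M' y : y ∊ M' -> g y ∊ M /\ f (g y) = y.
Proof. intros H; apply M'_in in H; destruct H as (a & Ha & ->); now rewrite copy_inv. Qed.

(** Tuples outside the new domain are negative members, as the strong inclusion in [tarski_str]
    demands. *)
Let rel r : V := setof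
  (fun w => exists x n, r = kp x n /\ w ∊ pw M' n /\ mp g n w ∊ ap rp r)
  (fun w => forall x n, r = kp x n -> ~ w ∊ pw M' n \/ mp g n w ∊ ap rn r).

Lemma rel_DefF : DefF (fun e => rel (e 0)).
Proof.
  assert (Dm : forall h j, DefF h -> DefF j -> DefF (fun e => mp g (h e) (j e)))
    by (intros h j; apply DefF_mp, copy_DefF).
  unfold rel; defi.
Qed.

Lemma rel_in r x n : r ∊ P -> r = kp x n -> forall w,
  (w ∊ rel r <-> w ∊ pw M' n /\ mp g n w ∊ ap rp r) /\
  (w ∉- rel r <-> ~ w ∊ pw M' n \/ mp g n w ∊ ap rn r).
Proof.
  intros Hr E.
  assert (K : has_members (fun w => w ∊ pw M' n /\ mp g n w ∊ ap rp r)
    (fun w => ~ w ∊ pw M' n \/ mp g n w ∊ ap rn r) (rel r)); [|exact K].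
  assert (Dm : forall h j, DefF h -> DefF j -> DefF (fun e => mp g (h e) (j e)))
    by (intros h j; apply DefF_mp, copy_DefF).
  destruct (@four_valued_separation V (pw M' n) (fun w => mp g n w ∊ ap rp r)
    (fun w => mp g n w ∊ ap rn r) (crisp_pw M' n)) as [R HR].
  - defi.
  - defi.
  - intros w _ K1 K2; apply NNPP; intros N; destruct (cons N) as [N1 _].
    exact (N1 r Hr _ (conj K1 K2)).
  - intros w Hw K1 K2; apply NNPP; intros N; destruct (comp N) as [N1 _].
    assert (L : mp g n w ∊ pw M n)
      by (apply (mp_pw (proj2 copy_DefF) (M := M')); [apply inv_M'|exact Hw]).
    destruct (N1 r x n Hr E _ L) as [K|K]; auto.
  - unfold rel; erewrite setof_unique; [exact HR|].
    intros w; destruct (HR w) as [-> ->]; split; split.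
    + intros K; exists x, n; tauto.
    + intros (x' & n' & E' & K); rewrite E in E'; apply kp_inj in E'; destruct E' as [_ <-]; exact K.
    + intros K x' n' E'; rewrite E in E'; apply kp_inj in E'; destruct E' as [_ <-]; exact K.
    + intros K; exact (K x n E).
Qed.

(** The Tarski model of copies is turned back into a T/F-model by [tarski_as_tf], and [f] is an
    isomorphism from the original T/F-model onto that one; so truth agrees along the way. *)
Lemma tf_as_tarski : exists M' cI' rI' h, tarski_str C P M' cI' rI' /\
  forall s, s ∊ pw M om -> h s ∊ pw M' om /\ forall p, p ∊ Fm true C P ->
  (tf_true C P M cI rp rn ep en p s <-> tarski_true C P M' cI' rI' p (h s)).
Proof.
  pose proof HM as (CM & [a0 Ha0] & HI & _).
  destruct copy_DefF as [Df Dg].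
  assert (Df' := fun h => @DefF_fun V f h Df).
  pose (cI' := lam (fun c => f (ap cI c)) C); pose (rI' := lam rel P).
  assert (HcI : forall c, c ∊ C -> ap cI c ∊ M /\ ap cI' c = f (ap cI c)).
  { intros c Hc; split; [now apply (isfun_ap HI)|].
    apply (@ap_lam V (fun c => f (ap cI c))); [defi|exact Hc]. }
  assert (HrI : forall r, r ∊ P -> ap rI' r = rel r) by (intros r; apply ap_lam, rel_DefF).
  assert (HT : tarski_str C P M' cI' rI').
  { unfold tarski_str; splits.
    - exact crisp_M'.
    - exists (f a0); now apply copy_M'.
    - apply isfun_lam; [apply HV|defi|]; intros c Hc; now apply copy_M', HcI.
    - apply isfun_lam_strong; [apply HV|apply rel_DefF].
    - intros r x n [Hr E] w; rewrite (HrI r Hr); destruct (rel_in Hr E w) as [-> ->].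
      split; [tauto|]; intros N; left; now apply (crisp_pw M' n w). }
  destruct (tarski_as_tf HV HT) as (rp' & rn' & ep' & en' & HM' & _ & _ & Hen & Hrel & Hsat).
  assert (I : tf_iso C P M cI rp rn en M' cI' rp' rn' en' f g).
  { unfold tf_iso; splits; auto.
    - intros a Ha; split; [now apply copy_M'|now apply copy_inv].
    - exact inv_M'.
    - intros a b Ha Hb; rewrite (Hen _ _ (copy_M' Ha) (copy_M' Hb)); symmetry; now apply copy_neq.
    - intros r x n w Hr E Hw.
      assert (K : mp f n w ∊ pw M' n) by (apply (mp_pw Df (M := M)); [exact copy_M'|exact Hw]).
      destruct (Hrel r x n _ Hr E K) as [-> ->]; rewrite (HrI r Hr).
      destruct (rel_in Hr E (mp f n w)) as [-> ->].
      rewrite (mp_mp Df Dg copy_inv Hw); tauto. }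
  exists M', cI', rI', (mp f om); split; [exact HT|].
  intros s Hs; assert (Hs' : mp f om s ∊ pw M' om) by (apply (mp_pw Df (M := M)); [exact copy_M'|exact Hs]).
  split; [exact Hs'|]; intros p Hp; rewrite (Hsat p _ Hp Hs'); split.
  - exact (tf_iso_true HV HM HM' I Hp Hs).
  - intros K; rewrite <- (mp_mp Df Dg copy_inv Hs).
    apply (tf_iso_true HV HM' HM (tf_iso_sym I) Hp Hs' K).
Qed.
End TFAsTarski.

(** * The four coincidences *)

Section Main.
Context {V : universe}.
Implicit Types (e : nat -> V) (x y z u v w a b c d i n s p q r S X Y D U W M : V).
Variables (C P : V).
Hypothesis HV : vocab C P.

Definition sub_formulas Sigma : Prop :=
  forall z, (z ∊ Sigma -> z ∊ Fm false C P) /\ (z ∉- Fm false C P -> z ∉- Sigma).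

(** [R] has to admit exactly the T/F-models that [V] can imitate: all of them if [V] has gluts and
    gaps, the consistent ones if it has only gaps, the complete ones if it has only gluts. *)
Lemma coincides_tf (R : V -> V -> V -> V -> V -> Prop) :
  (forall M cI rp rn ep en, tf_str C P M cI rp rn ep en ->
    (R M rp rn ep en <-> (~ glut V -> consistent P M rp rn ep en) /\
      (~ gap V -> complete P M rp rn ep en))) ->
  coincides C P (tf_entails C P R).
Proof.
  intros HR Sigma p [HS Hp].
  assert (Hp' : p ∊ Fm true C P) by now apply Fm_false_true.
  assert (HS' : forall q, q ∊ Sigma -> q ∊ Fm true C P)
    by (intros q Hq; apply Fm_false_true; [exact HV|now apply HS]).
  split; intros H.
  - intros M cI rp rn ep en [HM HRM] s Hs K.
    apply (HR _ _ _ _ _ _ HM) in HRM; destruct HRM as [cons comp].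
    destruct (tf_as_tarski HV HM cons comp) as (M' & cI' & rI' & h & HT & Hh).
    destruct (Hh s Hs) as [Hs' E]; apply (E p Hp'), (H M' cI' rI' HT _ Hs').
    intros q Hq; apply (E q (HS' q Hq)), K, Hq.
  - intros M cI rI HT s Hs K.
    destruct (tarski_as_tf HV HT) as (rp & rn & ep & en & HM & cons & comp & _ & _ & E).
    apply (E p s Hp' Hs), (H M cI rp rn ep en); [|exact Hs|].
    + split; [exact HM|]; apply (HR _ _ _ _ _ _ HM); split; assumption.
    + intros q Hq; apply (E q s (HS' q Hq) Hs), K, Hq.
Qed.

(** Without gluts and gaps every set is crisp and the falsity of an equation is distinctness. So
    Tarski models are classical structures, with the same satisfaction sets. *)
Lemma coincides_fol : ~ glut V -> ~ gap V -> coincides C P (fol_entails C P).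
Proof.
  intros NG NP Sigma p _.
  assert (A : forall x, crisp x).
  { intros x z; split; [intros K L; apply NG; exists x, z; auto|].
    intros K; apply NNPP; intros L; apply NP; exists x, z; auto. }
  assert (E : forall M cI rI q s, tarski_true C P M cI rI q s <-> fol_true C P M cI rI q s).
  { intros M cI rI q s.
    assert (B : forall S, tarski_spec C P M cI rI S <->
      sat_spec C P M cI eq (fun a b => a <> b) (fun r w => w ∊ ap rI r) (fun r w => ~ w ∊ ap rI r)
        (posin S) (fun p s => ~ posin S p s)).
    { intros S.
      assert (N : forall a b, eq_neg V a b <-> a <> b).
      { intros a b; rewrite eq_neg_iff; fold (neq a b); split.
        - intros K ->; now apply NG, neq_glut with b.
        - intros K; destruct (eq_or_neq a b NP); tauto. }
      split; apply (@sat_transfer V C P HV M cI M cI (fun a => a) (fun s => s)); auto; eauto.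
      - intros t x y _ _ _; rewrite N; tauto.
      - intros t r x n f _ _ _ _; rewrite (A (ap rI r) (vls cI t n f)); tauto.
      - intros p' t _ _; unfold posin, negin; rewrite (A S (kp p' t)); tauto.
      - intros t x y _ _ _; rewrite N; tauto.
      - intros t r x n f _ _ _ _; rewrite (A (ap rI r) (vls cI t n f)); tauto.
      - intros p' t _ _; unfold posin, negin; rewrite (A S (kp p' t)); tauto. }
    split; intros (S & K & L); exists S; split; try exact L; [split; [apply A|]|]; now apply B. }
  split; intros H M cI rI HT s Hs K; apply E, H; auto.
  - apply HT.
  - intros q Hq; now apply E, K.
  - split; [exact HT|auto].
  - intros q Hq; now apply E, K.
Qed.

(* ex falso: v0 ≠ v0 entails v1 = v2; excluded middle: v0 = v0 entails v1 = v2 ∨ v1 ≠ v2.  The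
   premise v0 = v0 of the latter only serves to provide the satisfaction relation. *)
Definition vr (j : nat) : V := vc (nm j).
Definition falsum : V := notc (eqc (vr 0) (vr 0)).
Definition verum : V := eqc (vr 0) (vr 0).
Definition goal_eq : V := eqc (vr 1) (vr 2).
Definition goal_lem : V := orc goal_eq (notc goal_eq).
Definition ex_falso (entails : V -> V -> Prop) : Prop := entails (pr falsum falsum) goal_eq.
Definition excluded_middle (entails : V -> V -> Prop) : Prop := entails (pr verum verum) goal_lem.

Lemma vr_tm j : vr j ∊ tm C.
Proof. apply tm_in; left; exists (nm j); split; [apply nm_om|reflexivity]. Qed.

Lemma eqc_Fm full j l : eqc (vr j) (vr l) ∊ Fm full C P.
Proof. destruct (Fm_closed full HV) as (F1 & _); apply F1; split; apply vr_tm. Qed.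

Lemma notc_Fm full p : p ∊ Fm full C P -> notc p ∊ Fm full C P.
Proof. destruct (Fm_closed full HV) as (_ & _ & F3 & _); apply F3. Qed.

Lemma orc_Fm full p q : p ∊ Fm full C P -> q ∊ Fm full C P -> orc p q ∊ Fm full C P.
Proof. destruct (Fm_closed full HV) as (_ & _ & _ & _ & F5 & _); intros; apply F5; auto. Qed.

Lemma sub_formulas_single q : q ∊ Fm false C P -> sub_formulas (pr q q).
Proof.
  intros Hq z; split.
  - intros K; apply pr_in in K; assert (z = q) as -> by tauto; exact Hq.
  - intros K; apply pr_spec; intros L; assert (z = q) as -> by tauto.
    now apply (crisp_Fm false HV q) in K.
Qed.

Lemma coincides_ex_falso entails :
  coincides C P entails -> (ex_falso (tarski_entails C P) <-> ex_falso entails).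
Proof.
  intros H; apply H; split; [|apply eqc_Fm].
  apply sub_formulas_single, notc_Fm, eqc_Fm.
Qed.

Lemma coincides_excluded_middle entails :
  coincides C P entails -> (excluded_middle (tarski_entails C P) <-> excluded_middle entails).
Proof.
  intros H; apply H; split; [apply sub_formulas_single, eqc_Fm|].
  apply orc_Fm; [apply eqc_Fm|apply notc_Fm, eqc_Fm].
Qed.

Section Tests.
Variables (M cI : V) (eqp eqn Rp Rn T F : V -> V -> Prop) (s : V).
Hypothesis HS : sat_spec C P M cI eqp eqn Rp Rn T F.
Hypothesis Hs : s ∊ pw M om.

Lemma sat_eq_vars j l : (T (eqc (vr j) (vr l)) s <-> eqp (ap s (nm j)) (ap s (nm l))) /\
  (F (eqc (vr j) (vr l)) s <-> eqn (ap s (nm j)) (ap s (nm l))).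
Proof.
  destruct (sat_eq HS Hs (vr_tm j) (vr_tm l)) as [-> ->].
  unfold vr; rewrite !vl_vc; tauto.
Qed.

Lemma sat_falsum : T falsum s <-> eqn (ap s (nm 0)) (ap s (nm 0)).
Proof.
  unfold falsum; destruct (sat_not HS Hs (eqc_Fm true 0 0)) as [-> _]; apply sat_eq_vars.
Qed.

Lemma sat_goal_lem : T goal_lem s <->
  eqp (ap s (nm 1)) (ap s (nm 2)) \/ eqn (ap s (nm 1)) (ap s (nm 2)).
Proof.
  unfold goal_lem, goal_eq.
  destruct (sat_or HS Hs (eqc_Fm true 1 2) (notc_Fm (eqc_Fm true 1 2))) as [-> _].
  destruct (sat_not HS Hs (eqc_Fm true 1 2)) as [-> _].
  destruct (sat_eq_vars 1 2) as [-> ->]; tauto.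
Qed.
End Tests.

Lemma single_premise (R : V -> Prop) q : (forall p, p ∊ pr q q -> R p) <-> R q.
Proof.
  split; [intros H; apply H, pr_in; auto|intros H p K; apply pr_in in K].
  assert (p = q) as -> by tauto; exact H.
Qed.

(* A two-element domain {a,b}, and an assignment with v0 = v1 = a and v2 = b. *)
Section TwoElements.
Variables a b : V.
Let M : V := pr a b.
Let cI : V := lam (fun _ => a) C.
Let s : V := up (lam (fun _ => a) om) (nm 2) b.

Lemma two_crisp : crisp M.
Proof. apply crisp_pr. Qed.

Lemma two_left : a ∊ M.
Proof. apply pr_in; auto. Qed.

Lemma two_right : b ∊ M.
Proof. apply pr_in; auto. Qed.

Lemma two_const : isfun cI C (fun y => y ∊ M).
Proof. apply isfun_lam; [apply HV|defi|intros; apply two_left]. Qed.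

Lemma two_const_fun : isfun (lam (fun _ => a) om) om (fun y => y ∊ M).
Proof. apply isfun_lam; [apply crisp_om|defi|intros; apply two_left]. Qed.

Lemma two_assignment : s ∊ pw M om.
Proof. apply up_pw; [apply pw_in, two_const_fun|apply nm_om|apply two_right]. Qed.

Lemma two_values : ap s (nm 0) = a /\ ap s (nm 1) = a /\ ap s (nm 2) = b.
Proof.
  assert (K : forall j, ap s (nm j) = if Nat.eqb j 2 then b else a).
  { intros j; destruct (ap_up two_const_fun (nm_om 2) two_right (nm_om j)) as [U1 U2].
    destruct (Nat.eqb_spec j 2) as [->|N]; [now apply U1|].
    unfold s; rewrite U2; [apply (@ap_lam V (fun _ => a)); [defi|apply nm_om]|].
    intros E; now apply nm_inj in E. }
  rewrite !K; auto.
Qed.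

(** Satisfaction sets are available for T/F-models, while [tarski_as_tf] compares only the truth of
    formulas. Therefore [verum] is shown true in the T/F-model, and its truth in the Tarski model
    supplies [S]. *)
Lemma two_tarski : exists rI S, tarski_str C P M cI rI /\ tarski_spec C P M cI rI S.
Proof.
  pose (rI := lam (fun _ : V => emp) P).
  assert (HT : tarski_str C P M cI rI).
  { unfold tarski_str; splits.
    - apply two_crisp.
    - exists a; apply two_left.
    - apply two_const.
    - apply isfun_lam_strong; [apply HV|defi].
    - intros r x n [Hr _] z; unfold rI; rewrite (@ap_lam V (fun _ => emp)); [|defi|exact Hr].
      destruct (emp_spec z) as [-> ->]; tauto. }
  destruct (tarski_as_tf HV HT) as (rp & rn & ep & en & HM & _ & _ & _ & _ & E).
  destruct (@sat_exists V C P M cI (fun a b => op a b ∊ ep) (fun a b => op a b ∊ en)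
    (fun r w => w ∊ ap rp r) (fun r w => w ∊ ap rn r) HV) as (X & Y & CX & CY & HS); [defi..|].
  assert (K : tf_true C P M cI rp rn ep en verum s).
  { exists X; split; [exists Y; auto|].
    apply (sat_eq_vars HS two_assignment 0 0).
    pose proof HM as (_ & _ & _ & _ & _ & _ & _ & _ & _ & _ & _ & Hep); apply Hep; [|reflexivity].
    destruct two_values as [-> _]; split; apply two_left. }
  apply (E verum s (eqc_Fm true 0 0) two_assignment) in K; destruct K as (S & HS' & _).
  exists rI, S; auto.
Qed.

(** Relation symbols hold positively of all tuples and negatively of none, so they are consistent
    and complete at once; the restrictions the model meets depend only on [R], which interprets
    [=^-]. *)
Lemma two_tf (R : V -> V -> Prop) : Def (fun e => R (e 0) (e 1)) ->
  (forall x y, R x y -> R y x) -> exists rp rn ep en X Y,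
  tf_str C P M cI rp rn ep en /\
  (forall r w, r ∊ P -> ~ w ∊ ap rn r) /\
  (forall r x n w, r ∊ P -> r = kp x n -> w ∊ pw M n -> w ∊ ap rp r) /\
  (forall x y, x ∊ M -> y ∊ M -> (op x y ∊ en <-> R x y)) /\
  (forall w, w ∊ en -> exists x y, w = op x y /\ R x y) /\
  crisp X /\ crisp Y /\ tf_spec C P M cI rp rn ep en X Y.
Proof.
  intros DR Sym.
  pose (full := fun r => csetof (fun w => exists x n, r = kp x n /\ w ∊ pw M n)).
  pose (rp := lam full P); pose (rn := lam (fun _ : V => emp) P).
  pose (ep := rel_set M eq); pose (en := rel_set M R).
  assert (Df : DefF (fun e => full (e 0))) by (unfold full; defi).
  assert (Deq : Def (fun e : nat -> V => e 0 = e 1)) by defi.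
  assert (Hrp : forall r x n, r ∊ P -> r = kp x n -> ap rp r = pw M n).
  { intros r x n Hr E; unfold rp; rewrite (ap_lam Df Hr); apply setof_unique.
    intros w; rewrite (crisp_pw M n w).
    assert (K : w ∊ pw M n <-> exists x n, r = kp x n /\ w ∊ pw M n); [|tauto].
    split; [intros K; exists x, n; auto|]; intros (x' & n' & E' & K).
    rewrite E in E'; apply kp_inj in E'; destruct E' as [_ ->]; exact K. }
  assert (Hrn : forall r, r ∊ P -> ap rn r = emp).
  { intros r Hr; apply (@ap_lam V (fun _ => emp)); [defi|exact Hr]. }
  assert (Hen : forall x y, op x y ∊ en <-> x ∊ M /\ y ∊ M /\ R x y)
    by (intros x y; apply (rel_set_in M DR)).
  assert (Hep : forall x y, op x y ∊ ep <-> x ∊ M /\ y ∊ M /\ x = y)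
    by (intros x y; apply (rel_set_in M Deq)).
  destruct (@sat_exists V C P M cI (fun a b => op a b ∊ ep) (fun a b => op a b ∊ en)
    (fun r w => w ∊ ap rp r) (fun r w => w ∊ ap rn r) HV) as (X & Y & CX & CY & HS); [defi..|].
  exists rp, rn, ep, en, X, Y; splits; auto.
  - unfold tf_str; splits.
    + apply two_crisp.
    + exists a; apply two_left.
    + apply two_const.
    + apply isfun_lam_strong; [apply HV|exact Df].
    + apply isfun_lam_strong; [apply HV|defi].
    + intros r x n [Hr E]; rewrite (Hrp r x n Hr E), (Hrn r Hr); splits.
      * apply crisp_pw.
      * tauto.
      * intros z; destruct (emp_spec z) as [-> ->]; tauto.
      * intros z; destruct (emp_spec z) as [-> ->]; tauto.
    + apply (crisp_rel_set M Deq).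
    + apply (rel_set_on Deq two_crisp).
    + apply (crisp_rel_set M DR).
    + apply (rel_set_on DR two_crisp).
    + intros x y; rewrite !Hen; intros (Hx & Hy & K); auto.
    + intros x y [Hx Hy]; rewrite Hep; tauto.
  - intros r w Hr; rewrite (Hrn r Hr); intros K; now apply emp_spec in K.
  - intros r x n w Hr E; now rewrite (Hrp r x n Hr E).
  - intros x y Hx Hy; rewrite Hen; tauto.
  - intros w K; pose proof (rel_set_inv DR K) as (x & y & -> & _); exists x, y.
    apply Hen in K; tauto.
Qed.
End TwoElements.

Lemma tarski_ex_falso : ex_falso (tarski_entails C P) <-> ~ glut V.
Proof.
  split.
  - intros H (x & z & K1 & K2).
    (* With [v0 = v1 = x] and [v2 = ∅] the glut [z] makes [v0 ≠ v0] true, and [x] differs from ∅ as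
       [z] is a positive member of it. *)
    assert (N : x <> emp) by (intros ->; now apply emp_spec in K1).
    destruct (two_tarski x emp) as (rI & S & HT & HS).
    pose proof (two_assignment x emp) as Hs; destruct (two_values x emp) as (V0 & V1 & V2).
    destruct (H _ _ _ HT _ Hs) as (S' & HS' & K).
    + apply single_premise; exists S; split; [exact HS|]; apply (sat_falsum HS Hs).
      rewrite V0; apply eq_neg_iff; exists z; auto.
    + apply (sat_eq_vars HS' Hs 1 2) in K; rewrite V1, V2 in K; auto.
  - intros NG M cI rI HT s Hs K; apply single_premise in K; destruct K as (S & HS & K).
    apply (sat_falsum HS Hs), eq_neg_iff in K; now apply neq_glut in K.
Qed.

Lemma tarski_excluded_middle : excluded_middle (tarski_entails C P) <-> ~ gap V.
Proof.
  split.
  - intros H (x & z & K1 & K2).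
    (* The set [c] has no positive members and a gap at [z] only. Lacking positive members, [c] and
       ∅ are not unequal; yet [c = ∅] fails, since [z] is not a negative member of [c]. *)
    destruct (@four_valued_separation V (pr z z) (fun _ => False) (fun _ => False))
      as [c Hc]; [apply two_crisp|defi|defi|tauto|intros; exists x, z; auto|].
    assert (N : c <> emp).
    { intros E; destruct (Hc z) as [_ L]; rewrite E in L.
      destruct (proj1 L (proj2 (proj2 (emp_spec z)) I)) as [L'|L']; [|exact L'].
      apply L', pr_in; auto. }
    destruct (two_tarski c emp) as (rI & S & HT & HS).
    pose proof (two_assignment c emp) as Hs; destruct (two_values c emp) as (V0 & V1 & V2).
    destruct (H _ _ _ HT _ Hs) as (S' & HS' & K).
    + apply single_premise; exists S; split; [exact HS|]; now apply (sat_eq_vars HS Hs 0 0).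
    + apply (sat_goal_lem HS' Hs) in K; rewrite V1, V2, eq_neg_iff in K.
      destruct K as [K|[w [[K _]|[K _]]]]; [exact (N K)| |].
      * apply Hc in K; tauto.
      * now apply emp_spec in K.
  - intros NG M cI rI HT s Hs K; apply single_premise in K; destruct K as (S & HS & K).
    exists S; split; [exact HS|]; apply (sat_goal_lem HS Hs); rewrite eq_neg_iff.
    now apply eq_or_neq.
Qed.

Lemma fol_ex_falso : ex_falso (fol_entails C P).
Proof.
  intros M cI rI HT s Hs K; apply single_premise in K; destruct K as (S & [_ HS] & K).
  now apply (sat_falsum HS Hs) in K.
Qed.

Lemma fol_excluded_middle : excluded_middle (fol_entails C P).
Proof.
  intros M cI rI HT s Hs K; apply single_premise in K; destruct K as (S & [CS HS] & K).
  exists S; split; [split; assumption|]; apply (sat_goal_lem HS Hs), classic.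
Qed.

Lemma consistent_ex_falso : ex_falso (tf_entails C P (consistent P)).
Proof.
  intros M cI rp rn ep en [HM [_ N]] s Hs K; apply single_premise in K.
  destruct K as (X & (Y & _ & _ & HS) & K); apply (sat_falsum HS Hs) in K.
  pose proof HM as (_ & _ & _ & _ & _ & _ & _ & _ & _ & _ & _ & Hep).
  apply pw_in in Hs; destruct (isfun_ap Hs (nm_om 0)) as [_ L].
  destruct (N (op (ap s (nm 0)) (ap s (nm 0)))); split; [now apply Hep|exact K].
Qed.

Lemma complete_excluded_middle : excluded_middle (tf_entails C P (complete P)).
Proof.
  intros M cI rp rn ep en [HM [_ N]] s Hs K; apply single_premise in K.
  destruct K as (X & (Y & CX & CY & HS) & K).
  exists X; split; [exists Y; auto|]; apply (sat_goal_lem HS Hs).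
  apply pw_in in Hs; apply N; now apply (isfun_ap Hs), nm_om.
Qed.

Lemma not_ex_falso (R : V -> V -> V -> V -> V -> Prop) :
  (forall M rp rn ep en, complete P M rp rn ep en -> R M rp rn ep en) ->
  ~ ex_falso (tf_entails C P R).
Proof.
  intros HR H.
  destruct (@two_tf emp (nm 1) (fun _ _ => True)) as
    (rp & rn & ep & en & X & Y & HM & _ & Hrp & Hen & _ & CX & CY & HS); [defi|auto|].
  pose proof (two_assignment emp (nm 1)) as Hs.
  destruct (two_values emp (nm 1)) as (V0 & V1 & V2).
  destruct (H _ _ _ _ _ _ (conj HM (HR _ _ _ _ _ (conj
    (fun r x n Hr E w Hw => or_introl (Hrp r x n w Hr E Hw))
    (fun x y Hx Hy => or_intror (proj2 (Hen x y Hx Hy) I))))) _ Hs) as (X' & (Y' & _ & _ & HS') & K).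
  - apply single_premise; exists X; split; [exists Y; auto|]; apply (sat_falsum HS Hs).
    rewrite V0; apply Hen; auto; apply two_left.
  - apply (sat_eq_vars HS' Hs 1 2) in K; rewrite V1, V2 in K.
    pose proof HM as (_ & _ & _ & _ & _ & _ & _ & _ & _ & _ & _ & Hep).
    apply Hep in K; [now apply (@nm_inj V 0 1) in K|]; split; [apply two_left|apply two_right].
Qed.

Lemma not_excluded_middle (R : V -> V -> V -> V -> V -> Prop) :
  (forall M rp rn ep en, consistent P M rp rn ep en -> R M rp rn ep en) ->
  ~ excluded_middle (tf_entails C P R).
Proof.
  intros HR H.
  destruct (@two_tf emp (nm 1) (fun _ _ => False)) as
    (rp & rn & ep & en & X & Y & HM & Hrn & _ & Hen & Hen' & CX & CY & HS); [defi|auto|].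
  pose proof (two_assignment emp (nm 1)) as Hs.
  destruct (two_values emp (nm 1)) as (V0 & V1 & V2).
  pose proof HM as (_ & _ & _ & _ & _ & _ & _ & _ & _ & _ & _ & Hep).
  assert (N : forall w, ~ w ∊ en) by (intros w K; destruct (Hen' w K) as (_ & _ & _ & L); exact L).
  destruct (H _ _ _ _ _ _ (conj HM (HR _ _ _ _ _ (conj
    (fun r Hr w K => Hrn r w Hr (proj2 K)) (fun w K => N w (proj2 K))))) _ Hs)
    as (X' & (Y' & _ & _ & HS') & K).
  - apply single_premise; exists X; split; [exists Y; auto|]; apply (sat_eq_vars HS Hs 0 0).
    rewrite V0; apply Hep; auto; split; apply two_left.
  - apply (sat_goal_lem HS' Hs) in K; rewrite V1, V2 in K; destruct K as [K|K]; [|exact (N _ K)].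
    apply Hep in K; [now apply (@nm_inj V 0 1) in K|]; split; [apply two_left|apply two_right].
Qed.

Lemma fde_iff : glut V /\ gap V <-> coincides C P (tf_entails C P (fun _ _ _ _ _ => True)).
Proof.
  split.
  - intros [G1 G2]; apply coincides_tf; tauto.
  - intros H; pose proof (coincides_ex_falso H) as A; pose proof (coincides_excluded_middle H) as B.
    rewrite tarski_ex_falso in A; rewrite tarski_excluded_middle in B.
    split; apply NNPP; intros N; [apply A in N|apply B in N]; revert N;
      [apply not_ex_falso|apply not_excluded_middle]; auto.
Qed.

Lemma k3_iff : ~ glut V /\ gap V <-> coincides C P (tf_entails C P (consistent P)).
Proof.
  split.
  - intros [G1 G2]; apply coincides_tf; tauto.
  - intros H; pose proof (coincides_ex_falso H) as A; pose proof (coincides_excluded_middle H) as B.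
    rewrite tarski_ex_falso in A; rewrite tarski_excluded_middle in B.
    split; [apply A, consistent_ex_falso|]; apply NNPP; intros N; apply B in N; revert N.
    apply not_excluded_middle; auto.
Qed.

Lemma lp_iff : ~ gap V /\ glut V <-> coincides C P (tf_entails C P (complete P)).
Proof.
  split.
  - intros [G1 G2]; apply coincides_tf; tauto.
  - intros H; pose proof (coincides_ex_falso H) as A; pose proof (coincides_excluded_middle H) as B.
    rewrite tarski_ex_falso in A; rewrite tarski_excluded_middle in B.
    split; [apply B, complete_excluded_middle|]; apply NNPP; intros N; apply A in N; revert N.
    apply not_ex_falso; auto.
Qed.

Lemma fol_iff : ~ glut V /\ ~ gap V <-> coincides C P (fol_entails C P).
Proof.
  split.
  - intros [G1 G2]; now apply coincides_fol.
  - intros H; pose proof (coincides_ex_falso H) as A; pose proof (coincides_excluded_middle H) as B.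
    rewrite tarski_ex_falso in A; rewrite tarski_excluded_middle in B.
    split; [apply A, fol_ex_falso|apply B, fol_excluded_middle].
Qed.
End Main.

(** * Evaluation of the sentences in the theorem *)

Local Open Scope bs4_scope.

Section Sentences.
Context {V : universe}.
Implicit Types (k : nat) (e : nat -> V).

(** Falsity of an inclusion asks for a positive member of the left set that is a negative member of
    the right one. For [x^!] in [x^?] this is a glut of [x], and for [x^?] in [x^!] a gap. *)
Lemma tr_ACLA k e : tr k e ACLA (glut V /\ gap V).
Proof.
  eapply tr_iff; [|unfold ACLA, subset; sem]; cbv beta; unfold glut, gap.
  split; (intros [(x & z & K) (x' & z' & K')]; split; [exists x, z|exists x', z']; tauto).
Qed.

Lemma tr_ACLA_cons k e : tr k e ACLA_cons (~ glut V /\ gap V).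
Proof.
  eapply tr_iff; [|unfold ACLA_cons, subset; sem]; cbv beta; unfold glut, gap.
  split; intros [H (x & z & K)]; (split; [|exists x, z; tauto]).
  - intros (y & w & L); destruct (H y w); tauto.
  - intros y w; split; intros L L'; apply H; exists y, w; auto.
Qed.

Lemma tr_ACLA_comp k e : tr k e ACLA_comp (~ gap V /\ glut V).
Proof.
  eapply tr_iff; [|unfold ACLA_comp, subset; sem]; cbv beta; unfold glut, gap.
  split; intros [H (x & z & K)]; (split; [|exists x, z; tauto]).
  - intros (y & w & L); destruct (H y w); tauto.
  - intros y w; split; intros L; apply NNPP; intros L'; apply H; exists y, w; auto.
Qed.

Lemma tr_all_classical k e : tr k e all_classical (~ glut V /\ ~ gap V).
Proof.
  eapply tr_iff; [|unfold all_classical; sem]; cbv beta; unfold glut, gap.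
  split.
  - intros H; split; intros (x & z & K); destruct (H x z); tauto.
  - intros [H1 H2] x z.
    assert (K : ~ (z ∊ x /\ z ∉- x) /\ ~ (~ z ∊ x /\ ~ z ∉- x)).
    { split; intros K; [apply H1|apply H2]; exists x, z; exact K. }
    destruct (classic (z ∊ x)), (classic (z ∉- x)); tauto.
Qed.
End Sentences.

Lemma coincidence_sentence (A : fm) (coin : trm -> trm -> fm) (T : universe -> Prop)
    (E : forall V : universe, V -> V -> Prop) :
  (forall (V : universe) k (e : nat -> V), tr k e A (T V)) ->
  (forall (V : universe) k (e : nat -> V) tC tP C P, vocab C P -> den k e tC C -> den k e tP P ->
    tr k e (coin tC tP) (E V C P)) ->
  (forall (V : universe) (C P : V), vocab C P -> (T V <-> E V C P)) ->
  BS4_proves PZFC (sentence (∀ C P, vocabulary C P → (A ↔ coin C P))).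
Proof.
  intros HA HC HE M HM e; pose (V := Build_universe HM).
  assert (H : @tr V 0 e (∀ C P, vocabulary C P → (A ↔ coin C P))
    (forall C P : V, vocab C P -> (T V <-> E V C P))).
  { do 2 (apply tr_all; intros); apply tr_imp; [apply tr_vocabulary; den|intros].
    apply tr_fiff; [apply HA|apply HC; [assumption|den|den]]. }
  apply H; intros C P; apply HE.
Qed.

Theorem theorem10p11 :
  BS4_proves PZFC (sentence
    (∀ C P, vocabulary C P → (ACLA ↔ coincide_FDE C P))) /\
  BS4_proves PZFC (sentence
    (∀ C P, vocabulary C P → (ACLA_cons ↔ coincide_K3 C P))) /\
  BS4_proves PZFC (sentence
    (∀ C P, vocabulary C P → (ACLA_comp ↔ coincide_LP C P))) /\
  BS4_proves PZFC (sentence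
    (∀ C P, vocabulary C P → (all_classical ↔ coincide_FOL C P))) /\
  BS4_proves PZFC (sentence
    (exactly_one ACLA ACLA_cons ACLA_comp all_classical)).
Proof.
  split; [|split; [|split; [|split]]].
  - apply coincidence_sentence with (fun V => glut V /\ gap V)
      (fun V C P => coincides C P (tf_entails C P (fun _ _ _ _ _ => True)));
      [intros; apply tr_ACLA| |intros V C P HV; now apply fde_iff].
    intros; apply tr_coincide; auto; intros; now apply tr_BS4_conseq.
  - apply coincidence_sentence with (fun V => ~ glut V /\ gap V)
      (fun V C P => coincides C P (tf_entails C P (consistent P)));
      [intros; apply tr_ACLA_cons| |intros V C P HV; now apply k3_iff].
    intros; apply tr_coincide; auto; intros; now apply tr_K3imp_conseq.
  - apply coincidence_sentence with (fun V => ~ gap V /\ glut V)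
      (fun V C P => coincides C P (tf_entails C P (complete P)));
      [intros; apply tr_ACLA_comp| |intros V C P HV; now apply lp_iff].
    intros; apply tr_coincide; auto; intros; now apply tr_LFI1_conseq.
  - apply coincidence_sentence with (fun V => ~ glut V /\ ~ gap V)
      (fun V C P => coincides C P (fol_entails C P));
      [intros; apply tr_all_classical| |intros V C P HV; now apply fol_iff].
    intros; apply tr_coincide; auto; intros; now apply tr_FOL_conseq.
  - intros M HM e; pose (V := Build_universe HM).
    pose proof (tr_ACLA (V := V) 0 e) as H1; pose proof (tr_ACLA_cons (V := V) 0 e) as H2.
    pose proof (tr_ACLA_comp (V := V) 0 e) as H3; pose proof (tr_all_classical (V := V) 0 e) as H4.
    unfold sentence, exactly_one.
    cut (truth V e (exactly_one ACLA ACLA_cons ACLA_comp all_classical 0)); [auto|].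
    unfold tr in *; unfold exactly_one, fconj, fdisj, fneg, fimp; cbn [truth falsity].
    change (fbot 0) with FBot; cbn [truth].
    (* Whether gluts exist and whether gaps exist are two classical questions, whose four
       combinations of answers are the four situations. *)
    rewrite H1, H2, H3, H4; destruct (classic (glut V)), (classic (gap V)); tauto.
Qed.
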